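(* Let $G$ be a finite strongly monomial group. Then the group generated by the generalized Bass units $b^{n_b}$ with $b=u_{k,m}(1-\widehat{H'}+h\widehat{H'})$, where $(H,K)$ ranges over the strong Shoda pairs of $G$, $h$ ranges over $H$, and $k,m$ range over the positive integers with $\gcd(k,|h|)=1$ and $k^m\equiv 1\mod |h|$, contains a subgroup of finite index in $\mathcal{Z}(\mathcal{U}(\mathbb{Z}G))$, the center of the unit group of $\mathbb{Z}G$.
   Context: Conventions: $a^b=b^{-1}ab$; $|h|$ is the order of $h$; $H'$ is the commutator subgroup of $H$; $\mathcal{U}(S)$ is the unit group of a ring $S$. For a subgroup $M$ of $G$, $\widehat{M}=\frac{1}{|M|}\sum_{x\in M}x\in\mathbb{Q}G$. For $K\lhd H\le G$ let $\varepsilon(H,K)=\prod_{M/K\in\mathcal{M}(H/K)}(\widehat{K}-\widehat{M})$, where $\mathcal{M}(H/K)$ is the set of minimal normal subgroups of $H/K$, and $\varepsilon(H,H)=\widehat{H}$. A strong Shoda pair of $G$ is a pair $(H,K)$ of subgroups of $G$ such that $K\le H\unlhd N_G(K)$, $H/K$ is cyclic and a maximal abelian subgroup of $N_G(K)/K$, and the distinct $G$-conjugates of $\varepsilon(H,K)$ are orthogonal. An irreducible (complex) character $\chi$ of $G$ is strongly monomial if $\chi=\theta^G$ (induced character) for a linear character $\theta$ of a subgroup $H$ with kernel $K$, where $(H,K)$ is a strong Shoda pair of $G$. The group $G$ is strongly monomial if all its irreducible characters are strongly monomial. For a torsion unit $x$ of order $n$ in an associative ring with identity and positive integers $k,m$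 with $k^m\equiv1\mod n$, put $$u_{k,m}(x)=(1+x+\dots+x^{k-1})^m+\frac{1-k^m}{n}(1+x+\dots+x^{n-1}),$$ which is a unit of that ring. For $H\le G$, $h\in H$ and positive integers $k,m$ with $\gcd(k,|h|)=1$ and $k^m\equiv1\mod|h|$, one has $u_{k,m}(1-\widehat{H'}+h\widehat{H'})=1-\widehat{H'}+u_{k,m}(h)\widehat{H'}$. This element $b$ is a unit of the order $\mathbb{Z}H(1-\widehat{H'})+\mathbb{Z}H\widehat{H'}$ of $\mathbb{Q}H$, so some positive power of it lies in $\mathcal{U}(\mathbb{Z}G)$; $n_b$ denotes the least positive integer with $b^{n_b}\in\mathcal{U}(\mathbb{Z}G)$, and $b^{n_b}$ is called a generalized Bass unit (based on $h$ and $H'$ with parameters $k$ and $m$). *)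

(* Defs.v *)
From mathcomp Require Import all_boot all_order all_algebra all_fingroup.
From mathcomp Require Import all_solvable all_field all_character.
From mathcomp Require Import boolp classical_sets cardinality.

Set Implicit Arguments.
Unset Strict Implicit.
Unset Printing Implicit Defensive.

Import Order.TTheory GRing.Theory Num.Theory GroupScope.
Local Open Scope ring_scope.

(* The multiplicative order of x is the n such that
   least_positive (fun j => x ^+ j = 1) n. *)
Definition least_positive (P : nat -> Prop) (n : nat) : Prop :=
  [/\ (0 < n)%N, P n & forall j, (0 < j)%N -> P j -> (n <= j)%N].

(* Subgroups of the (possibly infinite) unit group of a ring R, as subsets of
   R. In units_in, the inverse is required to lie in the subring S as well. *)
Section UnitGroups.
Variable R : pzRingType.
Implicit Types (S U A B X : set R) (x y z : R).

Definition units_in S : set R :=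
  [set x | S x /\ exists2 y, S y & x * y = 1 /\ y * x = 1]%classic.

Definition center_of U : set R :=
  [set z | U z /\ forall u, U u -> z * u = u * z]%classic.

Definition is_subgroup U A : Prop :=
  [/\ (A `<=` U)%classic, A 1, forall x y, A x -> A y -> A (x * y)
    & forall x y, A x -> x * y = 1 -> y * x = 1 -> A y].

Definition generated_in U X : set R := smallest (is_subgroup U) X.

Definition finite_index B A : Prop :=
  finite_set [set ([set x * a | a in A])%classic | x in B]%classic.

(* u_{k,m}(x), for x of order n and k ^ m = 1 modulo n; the division by n is
   then exact. *)
Definition bass_unit (n k m : nat) x : R :=
  (\sum_(i < k) x ^+ i) ^+ m
  + (\sum_(i < n) x ^+ i) *~ ((1 - k%:Z ^+ m) %/ n%:Z)%Z.

End UnitGroups.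

Section RationalGroupRing.
Variables (gT : finGroupType) (G : {group gT}).
Implicit Types H K M : {group gT}.

(* Following mxrepresentation, QG is encoded by its regular representation: it
   is the subring group_ring rat G of the matrix ring gmx, in which
   g in G is represented by gelt g, and these matrices are linearly
   independent. *)
Local Notation gmx := 'M[rat]_#|G|.

Definition gelt (g : gT) : gmx := regular_repr rat G g.

Definition integral_group_ring : set gmx :=
  [set a | exists c : gT -> int, a = \sum_(g in G) (c g)%:~R *: gelt g]%classic.

Definition unit_group : set gmx := units_in integral_group_ring.

Definition hat (A : {set gT}) : gmx := #|A|%:R^-1 *: gset_mx rat G A.

Definition gconj (a : gmx) (g : gT) : gmx := gelt g^-1%g * a * gelt g.

(* The minimal normal subgroups of H / K are the M / K for the M below. When K
   is normal in H the factors commute, so the order of the product is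
   irrelevant. *)
Definition epsilon H K : gmx :=
  if H :==: K then hat H else
  \prod_(M : {group gT} |
          [&& K \subset M, M \subset H & minnormal (M / K)%g (H / K)%g])
    (hat K - hat M).

Definition strong_shoda_pair H K : Prop :=
  [/\ K \subset H, H <| 'N_G(K), cyclic (H / K)%g,
      [max (H / K)%g of M | (M \subset ('N_G(K) / K)%g) && abelian M]
    & forall g1 g2, g1 \in G -> g2 \in G ->
        let e := epsilon H K in
        gconj e g1 <> gconj e g2 -> gconj e g1 * gconj e g2 = 0].

Definition strongly_monomial_char (chi : 'CF(G)) : Prop :=
  exists H K (theta : 'CF(H)),
    [/\ strong_shoda_pair H K, theta \is a linear_char, cfker theta = K
      & chi = 'Ind[G] theta].

Definition strongly_monomial : Prop :=
  forall i : Iirr G, strongly_monomial_char 'chi_i.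

(* v = b ^ n_b with b = u_{k,m}(1 - hat H' + h hat H'); here n is the order of
   the argument x of u_{k,m}, a divisor of the order of h. *)
Definition generalized_bass_unit H (h : gT) (k m : nat) (v : gmx) : Prop :=
  let H'hat := hat H^`(1)%g in
  let x := 1 - H'hat + gelt h * H'hat in
  exists n nb,
    let b := bass_unit n k m x in
    [/\ least_positive (fun j => x ^+ j = 1) n,
        least_positive (fun j => unit_group (b ^+ j)) nb
      & v = b ^+ nb].

Definition shoda_bass_units : set gmx :=
  [set v | exists H K h k m,
    [/\ strong_shoda_pair H K, h \in H, (0 < k)%N /\ (0 < m)%N,
        coprime k #[h]%g /\ (k ^ m = 1 %[mod #[h]%g])%N
      & generalized_bass_unit H h k m v]]%classic.

End RationalGroupRing.

Arguments integral_group_ring {gT} G.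
Arguments unit_group {gT} G.
Arguments shoda_bass_units {gT} G.

(* Main.v *)
Require Import Defs.
From HB Require Import structures.
From mathcomp Require Import all_boot all_order all_algebra all_fingroup.
From mathcomp Require Import all_solvable all_field all_character complex.
From mathcomp Require Import boolp classical_sets cardinality reals topology.
From mathcomp Require Import normedtype derive realfun sequences exp.
From mathcomp Require Rstruct.
From mathcomp Require Import ring lra zify.

Set Implicit Arguments.
Unset Strict Implicit.
Unset Printing Implicit Defensive.

Import Order.TTheory GRing.Theory Num.Theory.
Import numFieldNormedType.Exports Normc.

Local Open Scope ring_scope.
Local Notation subsetP := fintype.subsetP.

(* The logarithms of the absolute values of the central characters map the
   centre of U(ZG), with finite kernel, onto a discrete subgroup of a real
   vector space; a subgroup has finite index as soon as every linear form
   vanishing on its logarithms vanishes on those of the whole centre. Writing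
   an irreducible character as an induced one, such a form comes down to a
   family (lam_i) indexed by the linear characters chi_i of H with
   sum_i lam_i (ln|1 - chi_i(h)^k| - ln|1 - chi_i(h)|) = 0 for all h and k. As
   in the theorem of Bass and Milnor, F(h) = sum_i lam_i chi_i(h) then satisfies
   sum_m F(h^m)/m = 0, and the nonvanishing of L(1, f) for Dirichlet
   characters f forces F = 0. To pass from H to G, some power of the component
   at epsilon(H, K) of a Bass unit of H is a product of generalized Bass units,
   and the product of its G-conjugates is central because the distinct
   conjugates of epsilon(H, K) are orthogonal. *)

(** * Embedding the algebraic numbers into the complex numbers *)

(** No rank is computed: the dual formulation bypasses Dirichlet's unit theorem. Only constraints on
    the logarithms of central units enter, namely invariance under complex conjugation and vanishing
    sums over Galois orbits (norms of units have absolute value 1). [bass_milnor_dual] shows that a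
    form vanishing on the Bass units vanishes on every vector meeting these constraints. The
    obstacle in passing to G is that a generalized Bass unit of H spreads over many characters of H
    and that its conjugates need not commute. It must be cut down to the component at epsilon(H, K),
    but this idempotent has denominators. The lattice argument is therefore run twice: for the units
    of ZH trivial outside Q(H/H'), to see that a power of the component lies in the generated group,
    and then for the centre. The vanishing of L(1, f) is expressed by partial sums of size O(1/N),
    exactly what truncating the logarithmic series yields; its refutation works with finite sums
    only. *)

Section RealEmbedding.
Variable R : realType.
Implicit Types (x y : algC) (q : rat).

(* A real algebraic number is sent to the real number making the same rational
   cut, since algC comes with no map to the reals. *)
Definition cut_of x (r : R) : Prop :=
  forall q, (ratr q <= x -> ratr q <= r) /\ (x <= ratr q -> r <= ratr q).

Lemma cut_approx x (n : nat) : x \is Num.real -> (0 < n)%N ->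
  exists q, ratr q <= x /\ x <= ratr (q + n%:R^-1).
Proof.
move=> xR n0; have nx : x * n%:R \is Num.real by rewrite rpredM ?realn.
have n0C : 0 < n%:R :> algC by rewrite ltr0n.
have /andP[h1 h2] := real_floor_itv nx.
exists ((Num.floor (x * n%:R))%:~R / n%:R); split.
  by rewrite fmorph_div rmorph_int rmorph_nat ler_pdivrMr.
rewrite rmorphD fmorph_div fmorphV /= rmorph_int !ratr_nat -[X in _ + X]mul1r -mulrDl.
by rewrite ler_pdivlMr // ltW // -[1]/(1%:~R) -rmorphD.
Qed.

Lemma cut_exists x : x \is Num.real -> exists r, cut_of x r.
Proof.
move=> xR.
pose S := [set r : R | exists2 q, ratr q <= x & r = ratr q]%classic.
have [q0 [h0 h1]] := cut_approx xR (isT : (0 < 1)%N).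
have ub q : x <= ratr q -> ubound S (ratr q).
  move=> xq _ [q' h ->]; rewrite ler_rat -(ler_rat algC).
  exact: le_trans h xq.
have supS : has_sup S.
  split; first by exists (ratr q0); exists q0.
  by exists (ratr (q0 + 1%:R^-1)); apply: ub.
exists (sup S) => q; split=> h; first by apply: sup_upper_bound => //; exists q.
by apply: sup_le_ub; [case: supS | apply: ub].
Qed.

(** Replaces limits: additivity and multiplicativity of cuts are proved up to an error c / n. *)
Lemma small_eq (u v c : R) : (forall n : nat, (0 < n)%N -> `|u - v| <= c / n%:R) -> u = v.
Proof.
move=> h; apply/eqP; rewrite -subr_eq0 -normr_le0 leNgt; apply/negP => e0.
have c0 : 0 < c by have := lt_le_trans e0 (h 1%N isT); rewrite divr1.
have [n ltn] : exists n : nat, c / `|u - v| < n%:R.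
  by exists (Num.bound (c / `|u - v|)); rewrite archi_boundP // divr_ge0 // ltW.
have n0 : (0 < n)%N by rewrite -(ltr0n R) (le_lt_trans _ ltn) // divr_ge0 // ltW.
have := h _ n0; rewrite leNgt ltr_pdivrMr ?ltr0n // mulrC -ltr_pdivrMr //.
by rewrite ltn.
Qed.

Lemma cut_approx2 x r n : x \is Num.real -> cut_of x r -> (0 < n)%N ->
  exists q, [/\ ratr q <= x, x <= ratr (q + n%:R^-1), ratr q <= r & r <= ratr q + n%:R^-1].
Proof.
move=> xR cr n0; have [q [h1 h2]] := cut_approx xR n0.
exists q; split=> //; first by apply: (cr q).1.
by have := (cr _).2 h2; rewrite rmorphD fmorphV rmorph_nat.
Qed.

Lemma cut_add x y r s t : x \is Num.real -> y \is Num.real ->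
  cut_of x r -> cut_of y s -> cut_of (x + y) t -> t = r + s.
Proof.
move=> xR yR cr cs ct; apply: (@small_eq _ _ 2) => n n0.
have [q [a1 a2 a3 a4]] := cut_approx2 xR cr n0.
have [p [b1 b2 b3 b4]] := cut_approx2 yR cs n0.
have h1 : ratr (q + p) <= t by apply: (ct _).1; rewrite rmorphD lerD.
have h2 : t <= ratr ((q + n%:R^-1) + (p + n%:R^-1)).
  by apply: (ct _).2; rewrite rmorphD lerD.
move: h1 h2; rewrite !rmorphD !fmorphV !rmorph_nat => h1 h2.
have := ler_norml (t - (r+s)) (2/n%:R) => ->; lra.
Qed.

Lemma cut_ge0 x r : 0 <= x -> cut_of x r -> 0 <= r.
Proof. by move=> x0 cr; have := (cr 0).1; rewrite !rmorph0 => ->. Qed.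

Lemma cut_mul_ge0 x y r s t : 0 <= x -> 0 <= y ->
  cut_of x r -> cut_of y s -> cut_of (x * y) t -> t = r * s.
Proof.
move=> x0 y0 cr cs ct; apply: (@small_eq _ _ (2 * (r + s + 1))) => n n0.
have [r0 s0] := (cut_ge0 x0 cr, cut_ge0 y0 cs).
have key z u : 0 <= z -> 0 <= u -> cut_of z u -> exists q,
    [/\ 0 <= (ratr q : algC), ratr q <= z, z <= ratr (q + n%:R^-1) &
    [/\ 0 <= (ratr q : R), ratr q <= u & u <= ratr q + n%:R^-1]].
  move=> z0 u0 cu; have [q [a1 a2 a3 a4]] := cut_approx2 (ger0_real z0) cu n0.
  have [q0|q0] := leP 0 q; first by exists q; rewrite !ler0q.
  (* A negative lower approximation is replaced by 0, so that the bounds of the two factors may be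
     multiplied. *)
  exists 0; rewrite !rmorph0 !lexx z0 u0; split=> //.
    apply: le_trans a2 _; rewrite ler_rat; lra.
  split=> //; apply: le_trans a4 _; rewrite lerD2r lerq0; exact: ltW.
have [q [a0 a1 a2 [a3 a4 a5]]] := key _ _ x0 r0 cr.
have [p [b0 b1 b2 [b3 b4 b5]]] := key _ _ y0 s0 cs.
have h1 : ratr (q * p) <= t by apply: (ct _).1; rewrite rmorphM ler_pM.
have h2 : t <= ratr ((q + n%:R^-1) * (p + n%:R^-1)).
  by apply: (ct _).2; rewrite rmorphM ler_pM.
move: h1 h2; rewrite !rmorphM !rmorphD !fmorphV !rmorph_nat => h1 h2.
set e : R := n%:R^-1 in a5 b5 h1 h2 *.
have e0 : 0 <= e by rewrite invr_ge0.
have e1 : e <= 1 by rewrite invf_le1 ?ltr0n // ler1n.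
rewrite ler_norml -/e; nra.
Qed.

(** The default 0 is taken off the real line; [algC_embed] evaluates [emb] at real and imaginary
    parts only. *)
Definition emb x : R := xget 0 [set r | cut_of x r]%classic.

Lemma embP x : x \is Num.real -> cut_of x (emb x).
Proof. by move=> xR; have [r h] := cut_exists xR; apply: (xgetI 0 h). Qed.

Lemma embD x y : x \is Num.real -> y \is Num.real -> emb (x + y) = emb x + emb y.
Proof. by move=> xR yR; apply: cut_add (embP _) (embP _) (embP _); rewrite ?rpredD. Qed.

Lemma emb_rat q : emb (ratr q) = ratr q.
Proof.
have h : (ratr q : algC) \is Num.real by by apply: Creal_Crat; exact: Crat_rat.
by apply/eqP; rewrite eq_le (embP h _).2 // (embP h _).1.
Qed.

Lemma emb0 : emb 0 = 0.
Proof. by rewrite -(rmorph0 (@ratr algC)) emb_rat rmorph0. Qed.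

Lemma emb1 : emb 1 = 1.
Proof. by rewrite -(rmorph1 (@ratr algC)) emb_rat rmorph1. Qed.

Lemma embN x : x \is Num.real -> emb (- x) = - emb x.
Proof.
move=> xR; apply/eqP; rewrite -subr_eq0 opprK -embD ?rpredN //.
by rewrite addNr emb0.
Qed.

Lemma embM x y : x \is Num.real -> y \is Num.real -> emb (x * y) = emb x * emb y.
Proof.
move=> xR yR.
have pos u v : 0 <= u -> 0 <= v -> emb (u * v) = emb u * emb v.
  move=> u0 v0; apply: (cut_mul_ge0 u0 v0); apply: embP;
   by rewrite ?rpredM ?ger0_real.
have mixed u v : 0 <= u -> v \is Num.real -> emb (u * v) = emb u * emb v.
  move=> u0 vR; case/orP: (vR) => v0; first exact: pos.
  have uR := ger0_real u0.
  rewrite -[v]opprK mulrN embN ?rpredM ?rpredN // pos ?oppr_ge0 //.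
  by rewrite [emb (- - v)]embN ?rpredN // mulrN.
case/orP: (xR) => x0; first exact: mixed.
rewrite -[x]opprK mulNr embN ?rpredM ?rpredN // mixed ?oppr_ge0 //.
by rewrite [emb (- - x)]embN ?rpredN // mulNr.
Qed.

Definition algC_embed x : R[i] := (emb ('Re x) +i* emb ('Im x))%C.

Fact algC_embed_zmod : zmod_morphism algC_embed.
Proof.
move=> x y; rewrite /algC_embed raddfB [in 'Im _]raddfB /=.
by rewrite !embD ?rpredN ?Creal_Re ?Creal_Im // !embN ?Creal_Re ?Creal_Im.
Qed.

Fact algC_embed_monoid : monoid_morphism algC_embed.
Proof.
split=> [|x y]; rewrite /algC_embed.
  have h : (1 : algC) \is Num.real by apply: rpred1.
  by rewrite (Creal_ReP _ h) (Creal_ImP _ h) emb1 emb0.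
rewrite ReM ImM; have [rx ix] := (Creal_Re x, Creal_Im x).
have [ry iy] := (Creal_Re y, Creal_Im y).
rewrite embD ?rpredN ?rpredM // embN ?rpredM // embD ?rpredM // !embM //.
by simpc; rewrite [emb ('Re y) * _]mulrC.
Qed.

HB.instance Definition _ :=
  GRing.isZmodMorphism.Build algC R[i] algC_embed algC_embed_zmod.
HB.instance Definition _ :=
  GRing.isMonoidMorphism.Build algC R[i] algC_embed algC_embed_monoid.

Lemma algC_embed_conj x : algC_embed (x^*)%R = ((algC_embed x)^*)%C.
Proof.
by rewrite /algC_embed Re_conj Im_conj embN ?Creal_Im.
Qed.
End RealEmbedding.

(** * The logarithmic series on the unit circle *)

Section LogSeries.
Variable R : realType.

Lemma poly_ln_le (P Q : {poly R}) (k : R) :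
    (forall x : R, 0 <= x <= 1 -> 0 < Q.[x]) ->
    (forall x : R, 0 < x < 1 -> 0 <= P^`().[x] + k * (Q^`().[x] / Q.[x])) ->
  P.[0] + k * ln Q.[0] <= P.[1] + k * ln Q.[1].
Proof.
move=> Q0 H.
pose f x := P.[x] + k * ln Q.[x].
pose df x := P^`().[x] + k * (Q^`().[x] / Q.[x]).
have fd (x : R) : 0 <= x <= 1 -> is_derive x 1 f (df x).
  move=> hx; rewrite /f /df.
  have h1 := @is_derive1_ln R _ (Q0 _ hx).
  have h2 := @is_derive1_comp _ (@ln R) (horner Q) x _ _ h1 (is_derive_poly Q x).
  rewrite mulrC in h2.
  have h3 := @is_deriveZ _ _ _ _ k x 1 _ h2.
  exact: (@is_deriveD _ _ _ _ _ x 1 _ _ (is_derive_poly P x) h3).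
have [||c hc] := @MVT R f df 0 1 ltr01.
- by move=> x; rewrite in_itv /= => /andP[a b]; apply: fd; rewrite !ltW.
- apply: derivable_within_continuous => x; rewrite in_itv /= => hx.
  by have [] := fd x hx.
rewrite subr0 mulr1 => e; rewrite -subr_ge0 -/(f 0) -/(f 1) e.
by apply: H; move: hc; rewrite in_itv.
Qed.

(* r m plays Re (z ^ m) for |z| = 1 and c = Re z; then ln (2 - 2c) / 2 is
   ln |1 - z|. *)
Lemma log_series (c : R) (r : nat -> R) : c < 1 -> -1 <= c -> r 0%N = 1 -> r 1%N = c ->
    (forall m, r m.+2 = 2 * c * r m.+1 - r m) -> (forall m, `|r m| <= 1) ->
  exists K, forall N : nat,
    `|\sum_(1 <= m < N.+1) r m / m%:R + ln (2 - 2 * c) / 2| <= K / N.+1%:R.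
Proof.
move=> c1 cN1 r0 r1 rS rb.
(* [Q] is |1 - x z|^2 for |z| = 1 and Re z = c, so ln Q / 2 runs from 0 at x = 0 to ln |1 - z| at x
   = 1. *)
pose Q : {poly R} := 'X^2 - (2 * c) *: 'X + 1.
have QE x : Q.[x] = 1 - 2 * c * x + x ^+ 2 by rewrite /Q !hornerE; ring.
have Q'E x : Q^`().[x] = 2 * (x - c).
  rewrite /Q !poly.derivE !hornerE /=; ring.
have q0 (x : R) : 0 <= x <= 1 -> (1 - c) / 2 <= Q.[x].
  rewrite QE => /andP[x0 x1]; have [c0|c0] := leP c 0.
    have h1 : 0 <= - c * x by rewrite mulr_ge0 ?oppr_ge0.
    by have h2 := sqr_ge0 x; lra.
  have h1 := sqr_ge0 (x - c).
  have h2 : 0 <= (1 - c) * (2^-1 + c) by apply: mulr_ge0; lra.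
  nra.
have Q0 (x : R) : 0 <= x <= 1 -> 0 < Q.[x].
  by move=> /q0 h; apply: lt_le_trans h; lra.
pose S N : {poly R} := \sum_(m < N) (r m.+1 / m.+1%:R) *: 'X^(m.+1).
have S0 N : (S N).[0] = 0.
  by rewrite /S horner_sum big1 // => i _; rewrite !hornerE exprS mul0r mulr0.
have S1 N : (S N).[1] = \sum_(1 <= m < N.+1) r m / m%:R.
  rewrite /S horner_sum big_add1 big_mkord; apply: eq_bigr => i _.
  by rewrite !hornerE expr1n mulr1.
(* The recurrence of r makes the product telescope; one remainder of size at most 2 x^N is left. *)
have S'E N x : Q.[x] * (S N)^`().[x] = c - x - x ^+ N * (r N.+1 - x * r N).
  rewrite /S (raddf_sum (@deriv R)) horner_sum.
  elim: N => [|N IH]; first by rewrite big_ord0 r0 r1 expr0; ring.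
  rewrite big_ord_recr /= mulrDr IH derivZ derivXn /= hornerZ hornerMn hornerXn.
  rewrite QE rS.
  have -> : r N.+1 / N.+1%:R * (x ^+ N *+ N.+1) = r N.+1 * x ^+ N.
    by rewrite mulrnAr -mulr_natr mulrAC divfK ?pnatr_eq0.
  rewrite [x ^+ N.+1]exprS; ring.
(* The remainder is at most 2 x^N and [Q] is at least (1 - c) / 2. *)
pose K := 4 / (1 - c).
exists K => N.
have Kb (x : R) : 0 < x < 1 -> `|(x ^+ N * (r N.+1 - x * r N)) / Q.[x]| <= K * x ^+ N.
  move=> /andP[x0 x1]; have hx : 0 <= x <= 1 by rewrite !ltW.
  rewrite normrM normfV (gtr0_norm (Q0 _ hx)) normrM ger0_norm ?exprn_ge0 ?(ltW x0) //.
  rewrite ler_pdivrMr ?Q0 // mulrC mulrAC ler_pM2r ?exprn_gt0 //.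
  apply: le_trans (_ : 2 <= _).
    apply: le_trans (ler_normB _ _) _; rewrite normrM (ger0_norm (ltW x0)).
    have := rb N; have := rb N.+1; have := normr_ge0 (r N); nra.
  rewrite /K; have := q0 _ hx; rewrite -ler_pdivrMl ?divr_gt0 ?subr_gt0 //.
  by rewrite invf_div => h; apply: le_trans h; lra.
(* The derivative of [T] dominates the remainder, so [T] plus or minus the difference to be bounded
   is nondecreasing on [0, 1]. *)
pose T : {poly R} := (K / N.+1%:R) *: 'X^(N.+1).
have T'E x : T^`().[x] = K * x ^+ N.
  rewrite /T derivZ derivXn hornerZ hornerMn hornerXn mulrnAr -mulr_natr mulrAC.
  by rewrite divfK // pnatr_eq0.
have T0 : T.[0] = 0 by rewrite /T !hornerE exprS mul0r mulr0.
have T1 : T.[1] = K / N.+1%:R by rewrite /T !hornerE expr1n mulr1.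
have Q1 : Q.[1] = 2 - 2 * c by rewrite QE; ring.
have lnQ0 : ln Q.[0] = 0 by rewrite QE !(mulr0, expr0n) subr0 addr0 ln1.
clearbody T Q; have main (s : R) : `|s| = 1 ->
   0 <= K / N.+1%:R + s * (\sum_(1 <= m < N.+1) r m / m%:R + ln (2 - 2 * c) / 2).
  move=> s1; have := @poly_ln_le (T + s *: S N) Q (s / 2) Q0.
  rewrite !hornerD !hornerZ T0 S0 lnQ0 T1 S1 Q1 !mulr0 !add0r.
  rewrite [s * (_ + _)]mulrDr addrA [s * (ln _ / _)]mulrA [s / 2 * _]mulrAC; apply.
  move=> x hx; have hx' : 0 <= x <= 1 by case/andP: hx => a b; rewrite !ltW.
  rewrite derivD derivZ hornerD hornerZ T'E Q'E.
  have -> : (S N)^`().[x] = (c - x - x ^+ N * (r N.+1 - x * r N)) / Q.[x].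
    by rewrite -S'E mulrC mulKf // gt_eqF ?Q0.
  have : `|s * (x ^+ N * (r N.+1 - x * r N) / Q.[x])| <= K * x ^+ N.
    by rewrite normrM s1 mul1r Kb.
  rewrite ler_norml => /andP[_]; rewrite -subr_ge0 => h; apply: le_trans h _;
  rewrite le_eqVlt; apply/orP; left; apply/eqP; field.
  by rewrite gt_eqF ?Q0.
have h1 := main 1 (normr1 _); have h2 := main (-1) (etrans (normrN 1) (normr1 _)).
move: h1 h2; move: (_ + ln _ / 2) (K / N.+1%:R) => u v h1 h2.
by rewrite ler_norml; apply/andP; split; lra.
Qed.
End LogSeries.

(** * Nonvanishing of L(1, f) *)

Section DivisorSum.
Variables (R : realType) (g : nat -> R).
Hypothesis gM : forall a b, g (a * b)%N = g a * g b.
Hypothesis g1 : g 1%N = 1.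
Hypothesis g3 : forall a, [\/ g a = 0, g a = 1 | g a = -1].

Definition divisor_sum m := \sum_(e <- divisors m) g e.
Local Notation a := divisor_sum.

(** The divisors of p^(k+1) m that p divides are p times the divisors of p^k m; the others divide
    m. *)
Lemma divisor_sum_primeS p m k : prime p -> (0 < m)%N -> ~~ (p %| m)%N ->
  a (p ^ k.+1 * m) = g p * a (p ^ k * m) + a m.
Proof.
move=> pp m0 pm; have p0 := prime_gt0 pp.
have n0 j : (0 < p ^ j * m)%N by rewrite muln_gt0 expn_gt0 p0.
rewrite /a (bigID (fun e => p %| e)%N) /=; congr (_ + _).
  rewrite big_distrr -big_filter /=.
  transitivity (\sum_(e <- map (muln p) (divisors (p ^ k * m))) g e); last first.
    by rewrite big_map; apply: eq_bigr => e _; rewrite gM.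
  apply: perm_big.
  apply: uniq_perm.
  - by rewrite filter_uniq ?divisors_uniq.
  - rewrite map_inj_uniq ?divisors_uniq // => x y /eqP.
    by rewrite eqn_pmul2l // => /eqP.
  move=> e; rewrite mem_filter -dvdn_divisors //; apply/andP/mapP.
    case=> /dvdnP[e' ->]; rewrite expnSr -mulnA mulnCA mulnC dvdn_pmul2l // => h.
    by exists e'; rewrite -?dvdn_divisors // mulnC.
  case=> e'; rewrite -dvdn_divisors // => h ->; rewrite dvdn_mulr //; split=> //.
  by rewrite expnS -mulnA dvdn_pmul2l.
rewrite -big_filter; apply: perm_big; apply: uniq_perm; rewrite ?filter_uniq ?divisors_uniq //.
move=> e; rewrite mem_filter -!dvdn_divisors //; apply/andP/idP.
  case=> pe; rewrite Gauss_dvdr // coprime_sym coprimeXl //.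
  by rewrite prime_coprime.
move=> em; split; last by rewrite dvdn_mull.
by apply: contra pm => /dvdn_trans; apply.
Qed.

(** By the recursion S(k+1) = g(p) S(k) + a(m), the values S(k) are constant, grow, or alternate
    between a(m) and 0, as g(p) is 0, 1 or -1. Even exponents give the bound on squares. *)
Lemma divisor_sum_prime_pow p m k : prime p -> (0 < m)%N -> ~~ (p %| m)%N -> 0 <= a m ->
  0 <= a (p ^ k * m) /\ (~~ odd k -> a m <= a (p ^ k * m)).
Proof.
move=> pp m0 pm am; set S := fun k => a (p ^ k * m).
have S0 : S 0%N = a m by rewrite /S expn0 mul1n.
have SS j : S j.+1 = g p * S j + a m by rewrite /S divisor_sum_primeS.
rewrite -/(S k); case: (g3 p) => gp.
- by case: k => [|k]; rewrite ?S0 ?SS ?gp ?mul0r ?add0r lexx.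
- have h j : a m <= S j by elim: j => [|j IH]; rewrite ?S0 // SS gp mul1r lerDr (le_trans am).
  by split=> // ; apply: le_trans (h k).
have h j : S j = if odd j then 0 else a m.
  elim: j => [|j IH]; first by rewrite S0.
  by rewrite SS gp IH /=; case: (odd j) => /=; rewrite ?mulr0 ?add0r // mulN1r addNr.
by rewrite h; case: (odd k).
Qed.

Lemma divisor_sum1 : a 1 = 1.
Proof. by rewrite /a big_seq1. Qed.

Lemma pdiv_split m : (1 < m)%N -> exists p k n,
  [/\ prime p, (0 < n)%N, ~~ (p %| n)%N, m = (p ^ k * n)%N & (n < m)%N].
Proof.
move=> m1; have pp := pdiv_prime m1; have m0 := ltnW m1.
have [n pn e] := pfactor_coprime pp m0; rewrite prime_coprime // in pn.
exists (pdiv m), (logn (pdiv m) m), n.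
have n0 : (0 < n)%N by rewrite lt0n; apply: contraNneq pn => ->; rewrite dvdn0.
split=> //; first by rewrite mulnC.
rewrite [X in (_ < X)%N]e -[X in (X < _)%N]muln1 ltn_pmul2l //.
rewrite -[X in (X < _)%N](expn0 (pdiv m)) ltn_exp2l ?prime_gt1 //.
by rewrite logn_gt0 mem_primes pp m0 pdiv_dvd.
Qed.

Lemma divisor_sum_ge0 m : (0 < m)%N -> 0 <= a m.
Proof.
elim/ltn_ind: m => m IH m0; have [m1|] := ltnP 1 m; last first.
  by move=> h; have -> : m = 1%N by [lia]; rewrite divisor_sum1.
have [p [k [n [pp n0 pn e nm]]]] := pdiv_split m1.
by rewrite e; have [] := divisor_sum_prime_pow k pp n0 pn (IH _ nm n0).
Qed.

Lemma divisor_sum_sqr_ge1 m : (0 < m)%N -> 1 <= a (m ^ 2).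
Proof.
elim/ltn_ind: m => m IH m0; have [m1|] := ltnP 1 m; last first.
  by move=> h; have -> : m = 1%N by [lia]; rewrite exp1n divisor_sum1.
have [p [k [n [pp n0 pn e nm]]]] := pdiv_split m1.
rewrite e expnMn -expnM; apply: le_trans (IH _ nm n0) _.
have [] := @divisor_sum_prime_pow p (n ^ 2) (k * 2) pp.
- by rewrite expn_gt0 n0.
- by rewrite Euclid_dvdX // andbT.
- by apply: divisor_sum_ge0; rewrite expn_gt0 n0.
by move=> _; apply; rewrite muln2 odd_double.
Qed.
End DivisorSum.

(** * Summation by parts *)

Section AbelSummation.
Variable T : numDomainType.
Implicit Types a v B : nat -> T.

Lemma abel_summation a v M : (0 < M)%N ->
  let A m := \sum_(1 <= i < m.+1) a i in
  \sum_(1 <= i < M.+1) a i * v i =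
    A M * v M + \sum_(1 <= i < M) A i * (v i - v i.+1).
Proof.
case: M => // M _ A; elim: M => [|M IH].
  by rewrite big_nat1 big_geq // addr0 /A big_nat1.
have AS : A M.+2 = A M.+1 + a M.+2 by rewrite /A big_nat_recr.
rewrite big_nat_recr //= IH [in RHS]big_nat_recr //= AS.
by move: (A M.+1) (\sum_(_ <= i < _) _) => s r; ring.
Qed.

Lemma abel_bound a v B M : (0 < M)%N ->
    (forall m, (0 < m)%N -> `|\sum_(1 <= i < m.+1) a i| <= B m) ->
    (forall m, (0 < m)%N -> v m.+1 <= v m) -> (forall m, (0 < m)%N -> 0 <= v m) ->
  `|\sum_(1 <= i < M.+1) a i * v i|
    <= B M * v M + \sum_(1 <= i < M) B i * (v i - v i.+1).
Proof.
move=> M0 aB vd v0; rewrite abel_summation //.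
apply: le_trans (ler_normD _ _) _; apply: lerD.
  by rewrite normrM (ger0_norm (v0 _ M0)) ler_wpM2r ?v0 ?aB.
apply: le_trans (ler_norm_sum _ _ _) _; rewrite big_nat [leRHS]big_nat.
apply: ler_sum => i /andP[i1 _]; rewrite normrM [X in _ * X]ger0_norm ?subr_ge0 ?vd //.
by rewrite ler_wpM2r ?subr_ge0 ?vd ?aB.
Qed.

Lemma abel_bound_const a v c M :
    (forall m, (0 < m)%N -> `|\sum_(1 <= i < m.+1) a i| <= c) ->
    (forall m, (0 < m)%N -> v m.+1 <= v m) -> (forall m, (0 < m)%N -> 0 <= v m) ->
  `|\sum_(1 <= i < M.+1) a i * v i| <= c * v 1%N.
Proof.
move=> ac vd v0; case: M => [|M].
  rewrite big_geq // normr0 mulr_ge0 ?v0 //; apply: le_trans (ac 1%N isT).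
  exact: normr_ge0.
apply: le_trans (@abel_bound a v (fun=> c) M.+1 isT ac vd v0) _.
rewrite -big_distrr /= -mulrDr (eq_bigr (fun i => - (v i.+1 - v i))) => [|i _].
  by rewrite sumrN telescope_sumr // opprB addrC subrK.
by rewrite opprB.
Qed.
End AbelSummation.

(** * Inequalities for geometric sums *)

Section GeometricInequalities.
Variable R : realType.

(** x^e is below every term of (1 - x^e) / (1 - x) = 1 + x + ... + x^(e-1). *)
Lemma geom_sum_ge (x : R) e : 0 < x -> x < 1 -> e%:R * x ^+ e * (1 - x) <= 1 - x ^+ e.
Proof.
move=> x0 x1; elim: e => [|e IH]; first by rewrite !mul0r expr0 subrr.
rewrite exprS -natr1.
have h : x ^+ e <= 1 by rewrite exprn_ile1 // ltW.
have h3 : 0 <= x ^+ e by rewrite exprn_ge0 ?ltW.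
have h4 : x * (e%:R * x ^+ e * (1 - x)) <= x * (1 - x ^+ e) by rewrite ler_pM2l.
have h5 : 0 <= (1 - x * x ^+ e) * (1 - x).
  by rewrite mulr_ge0 ?subr_ge0 ?(ltW x1) // mulr_ile1 // ltW.
move: h4 h5; move: (x ^+ e) (e%:R : R) => y f h4 h5; lra.
Qed.

Lemma bernoulli_le (x : R) n : 0 <= x -> x <= 1 -> 1 - n%:R * (1 - x) <= x ^+ n.
Proof.
move=> x0 x1; elim: n => [|n IH]; first by rewrite mul0r subr0 expr0.
rewrite exprS -natr1; have h : 0 <= n%:R :> R by rewrite ler0n.
have h1 : x * (1 - n%:R * (1 - x)) <= x * x ^+ n by rewrite ler_wpM2l.
apply: le_trans h1.
have h2 : 0 <= n%:R * (1-x) * (1-x) by rewrite !mulr_ge0 // subr_ge0.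
nra.
Qed.

Lemma two_expr_le (x : R) e i j : 0 < x -> x < 1 -> (i + j <= e.*2)%N ->
  2 * x ^+ e <= x ^+ i + x ^+ j.
Proof.
move=> x0 x1 ij; have p k : 0 < x ^+ k by rewrite exprn_gt0.
rewrite -ler_sqr ?nnegrE ?addr_ge0 ?mulr_ge0 ?(ltW (p _)) //.
have h : x ^+ e.*2 <= x ^+ (i + j) by rewrite ler_wiXn2l // ltW.
rewrite -addnn !exprD in h; have h2 := sqr_ge0 (x ^+ i - x ^+ j).
rewrite expr2; nra.
Qed.

(** The term (i, j) is paired with (e - 1 - i, e - j): the exponents add up to 2e - 1, so the mean
    of the two terms is at least x^e. This bound makes [monsky_weight] decrease. *)
Lemma geom_sum_prod_ge (x : R) e : 0 < x -> x < 1 ->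
  e%:R * e.+1%:R * x ^+ e <= (\sum_(i < e) x ^+ i) * (\sum_(i < e.+1) x ^+ i).
Proof.
move=> x0 x1; rewrite -(ler_pM2l (_ : 0 < 2)) //.
have -> : 2 * ((\sum_(i < e) x ^+ i) * \sum_(i < e.+1) x ^+ i) =
   \sum_(i < e) \sum_(j < e.+1) (x ^+ (i + j) + x ^+ ((e - i.+1) + (e.+1 - j.+1))).
  under [RHS]eq_bigr do rewrite big_split.
  rewrite big_split /= mulr_natl mulr2n.
  congr (_ + _).
    rewrite big_distrl; apply: eq_bigr => i _; rewrite big_distrr /=.
    by apply: eq_bigr => j _; rewrite exprD.
  rewrite big_distrl (reindex_inj rev_ord_inj); apply: eq_bigr => i _.
  rewrite big_distrr (reindex_inj rev_ord_inj) /=.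
  by apply: eq_bigr => j _; rewrite exprD.
have -> : 2 * (e%:R * e.+1%:R * x ^+ e) = \sum_(i < e) \sum_(j < e.+1) 2 * x ^+ e.
  by rewrite !sumr_const !card_ord -[_ *+ e]mulr_natl -mulr_natl; ring.
apply: ler_sum => i _; apply: ler_sum => j _; apply: two_expr_le => //.
have := ltn_ord i; have := ltn_ord j; lia.
Qed.

Lemma sum_multiples (x : R) e D : (0 < e)%N -> 0 < x -> x < 1 ->
  (\sum_(1 <= m < D.+1 | (e %| m)%N) x ^+ m) * (1 - x ^+ e) =
    x ^+ e - x ^+ (e * (D %/ e).+1).
Proof.
move=> e0 x0 x1; elim: D => [|D IH].
  by rewrite big_geq // mul0r div0n muln1 subrr.
rewrite big_mkcond big_nat_recr //= -big_mkcond mulrDl IH divnS //.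
case: ifP => h; last by rewrite mul0r addr0.
have /dvdnP[q Dq] := h; rewrite add1n.
have -> : D.+1 = (e * (D %/ e).+1)%N.
  have := divnS D e0; rewrite h add1n => <-; rewrite Dq mulnK // mulnC //.
by rewrite !mulnS !exprD; ring.
Qed.
End GeometricInequalities.

(** * Real characters *)

Section Monsky.
Variable R : realType.

(* The weights of Monsky's proof of L(1, g) <> 0: the Lambert series
   sum_e g(e) x^e / (1 - x^e) = sum_m a(m) x^m is unbounded as x -> 1, since
   a >= 0 and a >= 1 on squares, but sum_e g(e) monsky_weight x e is bounded by
   Abel summation. *)
Definition monsky_weight (x : R) e := (e%:R * (1 - x))^-1 - x ^+ e / (1 - x ^+ e).

Lemma monsky_weightP (x : R) (b := monsky_weight x) : 0 < x -> x < 1 ->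
  [/\ b 1%N = 1, forall e, (0 < e)%N -> b e.+1 <= b e & forall e, (0 < e)%N -> 0 <= b e].
Proof.
move=> x0 x1; rewrite /b /monsky_weight {b}.
have d0 : 0 < 1 - x by rewrite subr_gt0.
have pe e : (0 < e)%N -> 0 < 1 - x ^+ e.
  by move=> e0; rewrite subr_gt0 exprn_ilt1 ?(ltW x0) // -lt0n.
split=> [|e e0|e e0]; first by rewrite mul1r expr1; field; rewrite gt_eqF.
- pose S n := \sum_(i < n) x ^+ i.
  have ES n : 1 - x ^+ n = (1 - x) * S n.
    by rewrite -[1 in LHS](expr1n _ n) subrXX; congr (_ * _);
       apply: eq_bigr => i _; rewrite expr1n mul1r.
  have S0 n : (0 < n)%N -> 0 < S n by move=> /pe; rewrite ES pmulr_rgt0.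
  have h := geom_sum_prod_ge e x0 x1; rewrite -/(S e) -/(S e.+1) in h.
  have [Se Se1] := (S0 e e0, S0 e.+1 isT).
  have eR : 0 < e%:R :> R by rewrite ltr0n.
  have e1R : 0 < e.+1%:R :> R by rewrite ltr0n.
  rewrite -subr_ge0 !ES.
  have SS : S e.+1 = S e + x ^+ e by rewrite /S big_ord_recr.
  have SS2 : S e.+1 = 1 + x * S e.
    rewrite /S big_ord_recl expr0 big_distrr; congr (_ + _).
    by apply: eq_bigr => i _; rewrite exprS.
  (* Factored this way, the difference has the sign given by [geom_sum_prod_ge]. *)
  have -> : (e%:R * (1 - x))^-1 - x ^+ e / ((1 - x) * S e)
    - ((e.+1%:R * (1 - x))^-1 - x ^+ e.+1 / ((1 - x) * S e.+1)) =
    (1 - x)^-1 * ((e%:R * e.+1%:R)^-1 - x ^+ e / (S e * S e.+1)).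
    have -> : x ^+ e.+1 / ((1 - x) * S e.+1) = x ^+ e * (S e.+1 - 1) / (S e * ((1 - x) * S e.+1)).
      by rewrite SS2 exprS; field; rewrite -SS2 !gt_eqF.
    rewrite -natr1; field; rewrite natr1 !gt_eqF //.
  rewrite mulr_ge0 ?invr_ge0 ?(ltW d0) // subr_ge0 ler_pdivrMr ?mulr_gt0 //.
  by rewrite -ler_pdivrMl ?invr_gt0 ?mulr_gt0 // invrK.
rewrite subr_ge0 ler_pdivrMr ?pe // -ler_pdivrMl ?invr_gt0 ?mulr_gt0 ?ltr0n //.
by rewrite invrK mulrAC geom_sum_ge.
Qed.

Variable g : nat -> R.
Hypothesis gM : forall a b, g (a * b)%N = g a * g b.
Hypothesis g1 : g 1%N = 1.
Hypothesis g3 : forall a, [\/ g a = 0, g a = 1 | g a = -1].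
Variables B C : R.
Hypothesis gB : forall m, (0 < m)%N -> `|\sum_(1 <= i < m.+1) g i| <= B.
Hypothesis gC : forall m, (0 < m)%N -> `|\sum_(1 <= i < m.+1) g i / i%:R| <= C / m%:R.

Local Notation a := (divisor_sum g).

(** Exchanging sums gives sum_e g(e) W(e), where W(e) is x^e / (1 - x^e) up to a tail of at most x^D
    / (1 - x). Since x^e / (1 - x^e) = 1 / (e (1 - x)) - [monsky_weight x e], the main term is
    controlled by [gC] for the first summand and by Abel summation for the second. *)
Lemma lambert_sum_bound (x : R) D : 0 < x -> x < 1 -> (0 < D)%N ->
  \sum_(1 <= m < D.+1) a m * x ^+ m
    <= B + C / (D%:R * (1 - x)) + D%:R * x ^+ D / (1 - x).
Proof.
move=> x0 x1 D0; have d0 : 0 < 1 - x by rewrite subr_gt0.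
have pe e : (0 < e)%N -> 0 < 1 - x ^+ e.
  by move=> e0; rewrite subr_gt0 exprn_ilt1 ?(ltW x0) // -lt0n.
have [b1 bd b0] := monsky_weightP x0 x1; set b := monsky_weight x in b1 bd b0.
have h1 := abel_bound_const D gB bd b0; rewrite b1 mulr1 in h1.
have h2 : `|\sum_(1 <= i < D.+1) g i / (i%:R * (1 - x))| <= C / (D%:R * (1 - x)).
  rewrite (eq_bigr (fun i => g i / i%:R * (1 - x)^-1)) => [|i _]; last first.
    by rewrite invfM mulrA.
  rewrite -big_distrl /= normrM normfV (gtr0_norm d0) invfM mulrA.
  by rewrite ler_pM2r ?invr_gt0 ?gC.
pose W e := \sum_(1 <= m < D.+1 | (e %| m)%N) x ^+ m.
have -> : \sum_(1 <= m < D.+1) a m * x ^+ m = \sum_(1 <= e < D.+1) g e * W e.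
  transitivity (\sum_(1 <= m < D.+1) \sum_(1 <= e < D.+1 | (e %| m)%N) g e * x ^+ m).
    rewrite big_nat [RHS]big_nat; apply: eq_bigr => m /andP[m1 mD].
    rewrite big_distrl /= -[RHS]big_filter; apply: perm_big.
    apply: uniq_perm; rewrite ?divisors_uniq ?filter_uniq ?iota_uniq // => e.
    rewrite mem_filter mem_index_iota -dvdn_divisors //; case: (boolP (e %| m)%N) => //= em.
    by rewrite (dvdn_gt0 m1 em) /= (leq_ltn_trans (dvdn_leq m1 em) mD).
  rewrite (exchange_big_dep_nat xpredT) //=; apply: eq_bigr => e _.
  by rewrite /W big_distrr.
have h3 e : (1 <= e < D.+1)%N ->
   g e * W e <= g e / (e%:R * (1 - x)) - g e * b e + x ^+ D / (1 - x).
  move=> /andP[e1 eD].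
  have -> : g e / (e%:R * (1 - x)) - g e * b e = g e * (x ^+ e / (1 - x ^+ e)).
    by rewrite /b /monsky_weight; ring.
  have -> : W e = x ^+ e / (1 - x ^+ e) - x ^+ (e * (D %/ e).+1) / (1 - x ^+ e).
    by rewrite -mulrBl -sum_multiples // mulfK // gt_eqF // pe.
  rewrite mulrBr lerD2l -mulrN.
  have u0 : 0 <= x ^+ (e * (D %/ e).+1) / (1 - x ^+ e).
    by rewrite divr_ge0 ?exprn_ge0 ?(ltW x0) ?(ltW (pe _ e1)).
  apply: (@le_trans _ _ (x ^+ (e * (D %/ e).+1) / (1 - x ^+ e))).
    by case: (g3 e) => ->; move: u0; move: (_ / _) => u u0; lra.
  rewrite ler_pM ?exprn_ge0 ?invr_ge0 ?(ltW x0) ?(ltW (pe _ e1)) //.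
    rewrite ler_wiXn2l ?(ltW x0) ?(ltW x1) //.
    by have := ltn_ceil D e1; lia.
  rewrite lef_pV2 ?posrE ?pe // lerD2l lerN2 -[leRHS]expr1.
  by rewrite ler_wiXn2l ?(ltW x0) ?(ltW x1).
have h4 : \sum_(1 <= e < D.+1) g e * W e <=
   \sum_(1 <= e < D.+1) (g e / (e%:R * (1 - x)) - g e * b e + x ^+ D / (1 - x)).
  by rewrite big_nat [leRHS]big_nat; apply: ler_sum => e /h3.
apply: le_trans h4 _; rewrite big_split sumrB /= sumr_const_nat subSS subn0.
rewrite -[_ *+ D]mulr_natl mulrA lerD2r addrC.
move: h1 h2; rewrite !ler_norml => /andP[h1 _] /andP[_ h2].
by apply: lerD => //; rewrite lerNl.
Qed.

(** The squares up to K^2 alone push the Lambert sum to at least K - 1/4, while a long truncation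
    keeps it at most B + 1/2; but K > B + 1. *)
Lemma real_char_contradiction : False.
Proof.
have B0 : 0 <= B by apply: le_trans (gB (ltn0Sn 0)); exact: normr_ge0.
have C0 : 0 <= C.
  by have := gC (ltn0Sn 0); rewrite divr1; apply: le_trans; exact: normr_ge0.
pose K := (Num.bound (B + 1)); have KB : B + 1 < K%:R by apply: archi_boundP; lra.
have K0 : (0 < K)%N by rewrite -(ltr0n R); lra.
have K0R : 0 < K%:R :> R by rewrite ltr0n.
(* With this y, Bernoulli's inequality gives K x^(K^2) >= K - K^3 y = K - 1/4. *)
pose y : R := (4 * K%:R ^+ 3)^-1; pose x := 1 - y.
have KK : 1 <= K%:R ^+ 3 :> R by rewrite exprn_ege1 // ler1n.
have y0 : 0 < y by rewrite invr_gt0; lra.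
have y1 : y <= 4^-1 by rewrite lef_pV2 ?posrE; lra.
have x0 : 0 < x by rewrite /x; lra.
have x1 : x < 1 by rewrite /x; lra.
have xy : 1 - x = y by rewrite /x; ring.
(* Truncating at 2E, the error terms are at most c / E, by using E x^E <= 1 / y twice; E > 2c makes
   them at most 1/2. *)
pose c := C / (2 * y) + 2 / y ^+ 3.
have c0 : 0 <= c by rewrite addr_ge0 // divr_ge0 ?mulr_ge0 ?exprn_ge0 ?(ltW y0).
pose E := (Num.bound (2 * c) + K ^ 2)%N.
have Ec : 2 * c < E%:R.
  rewrite natrD; apply: lt_le_trans (archi_boundP _) _; first by lra.
  by rewrite lerDl.
have EK : (K ^ 2 <= E)%N by rewrite leq_addl.
have E0 : (0 < E)%N by apply: leq_trans EK; rewrite expn_gt0 K0.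
have E0R : 0 < E%:R :> R by rewrite ltr0n.
have xE : E%:R * x ^+ E <= y^-1.
  rewrite -[leRHS]mul1r ler_pdivlMr // -xy; apply: le_trans (geom_sum_ge E x0 x1) _.
  by rewrite gerBl exprn_ge0 // ltW.
have D0 : (0 < E.*2)%N by rewrite double_gt0.
have := lambert_sum_bound x0 x1 D0; rewrite xy.
have e1 : C / (E.*2%:R * y) + E.*2%:R * x ^+ E.*2 / y <= c / E%:R.
  have -> : c / E%:R = C / (2 * y) / E%:R + 2 / y ^+ 3 / E%:R by rewrite /c; ring.
  apply: lerD.
    rewrite -muln2 natrM le_eqVlt; apply/orP; left; apply/eqP; field.
    by rewrite !gt_eqF.
  have -> : E.*2%:R * x ^+ E.*2 / y = 2 * ((E%:R * x ^+ E) * (E%:R * x ^+ E)) / (E%:R * y).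
    rewrite -addnn exprD natrD; field; rewrite !gt_eqF //.
  have -> : 2 / y ^+ 3 / E%:R = 2 * (y^-1 * y^-1) / (E%:R * y).
    field; rewrite !gt_eqF //.
  rewrite ler_pM2r ?invr_gt0 ?mulr_gt0 // ler_pM2l //.
  by rewrite ler_pM // mulr_ge0 ?exprn_ge0 // ltW.
have e2 : c / E%:R <= 2^-1 by rewrite ler_pdivrMr //; lra.
have e3 : K%:R * x ^+ (K ^ 2) <= \sum_(1 <= m < (E.*2).+1) a m * x ^+ m.
  have p0 m : (0 < m)%N -> 0 <= a m * x ^+ m.
    by move=> m0; rewrite mulr_ge0 ?exprn_ge0 ?(ltW x0) // divisor_sum_ge0.
  pose sq := [seq (k ^ 2)%N | k <- index_iota 1 K.+1].
  apply: (@le_trans _ _ (\sum_(m <- sq) a m * x ^+ m)).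
    rewrite big_map; apply: (@le_trans _ _ (\sum_(1 <= k < K.+1) x ^+ (K ^ 2))).
      by rewrite sumr_const_nat subSS subn0 -[leRHS]mulr_natl.
    apply: ler_sum_nat => k /andP[k1 kK].
    rewrite -[leLHS]mul1r ler_pM ?exprn_ge0 ?(ltW x0) //.
      exact: divisor_sum_sqr_ge1.
    by rewrite ler_wiXn2l ?(ltW x0) ?(ltW x1) // leq_sqr.
  rewrite [leRHS](bigID (fun m => m \in sq)) /= -[leLHS]addr0; apply: lerD.
    rewrite -[leRHS]big_filter le_eqVlt; apply/orP; left; apply/eqP.
    apply: perm_big; apply: uniq_perm.
    - rewrite map_inj_uniq ?iota_uniq // => u v /eqP; rewrite eqn_exp2r // => /eqP //.
    - by rewrite filter_uniq ?iota_uniq.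
    move=> m; rewrite mem_filter andb_idr // => /mapP[k].
    rewrite !mem_index_iota => /andP[k1 kK] ->; rewrite expn_gt0 k1 /=.
    rewrite ltnS; apply: leq_trans (_ : K ^ 2 <= _)%N; first by rewrite leq_sqr.
    by apply: leq_trans EK _; rewrite -addnn leq_addl.
  rewrite big_nat_cond; apply: sumr_ge0 => m /andP[/andP[m1 _] _]; exact: p0.
have e4 : K%:R - 4^-1 <= K%:R * x ^+ (K ^ 2).
  have h := bernoulli_le (K ^ 2) (ltW x0) (ltW x1).
  rewrite xy in h; rewrite -(ler_pM2l K0R) in h; apply: le_trans h.
  rewrite mulrBr mulr1 lerB // natrX /y le_eqVlt; apply/orP; left; apply/eqP.
  by field; rewrite gt_eqF.
move: e1 e2 e3 e4; move: (\sum_(_ <= _ < _) _) (C / _) (_ / y) (c / _) (K%:R * _).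
move: KB; move: (K%:R : R) => k *; lra.
Qed.
End Monsky.

(** * The weights m^(-del) and m^(-1-del) *)

Section PowerWeights.
Variables (R : realType) (del : R).
Hypotheses (del0 : 0 < del) (del1 : del <= 1).

Definition pow_decay (m : nat) : R := expR (- del * ln m%:R).
Definition pow_weight (m : nat) : R := pow_decay m / m%:R.
Local Notation v := pow_decay.
Local Notation w := pow_weight.

Lemma pow_decay_gt0 m : 0 < v m.
Proof. exact: expR_gt0. Qed.

Lemma pow_decay1 : v 1 = 1.
Proof. by rewrite /v ln1 mulr0 expR0. Qed.

Lemma pow_decayM a b : (0 < a)%N -> (0 < b)%N -> v (a * b) = v a * v b.
Proof. by move=> a0 b0; rewrite /v natrM lnM ?posrE ?ltr0n // mulrDr expRD. Qed.

Lemma pow_decay_decr a b : (0 < a)%N -> (a <= b)%N -> v b <= v a.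
Proof.
move=> a0 ab; rewrite /v ler_expR !mulNr lerN2 ler_pM2l // ler_ln ?posrE ?ltr0n ?ler_nat //.
exact: leq_trans ab.
Qed.

Lemma pow_decay_le1 m : (0 < m)%N -> v m <= 1.
Proof. by move=> m0; rewrite -pow_decay1 pow_decay_decr. Qed.

Lemma pow_decay_step_le m : (0 < m)%N -> v m - v m.+1 <= del / m%:R.
Proof.
move=> m0; have mR : 0 < m%:R :> R by rewrite ltr0n.
have m1R : 0 < m.+1%:R :> R by rewrite ltr0n.
have -> : v m.+1 = v m * expR (- del * ln (1 + m%:R^-1)).
  rewrite /v -expRD -mulrDr -lnM ?posrE ?addr_gt0 ?invr_gt0 //.
  by rewrite mulrDr mulr1 divff ?gt_eqF // natr1.
have l : ln (1 + m%:R^-1) <= m%:R^-1 :> R by apply: le_ln1Dx; have := invr_gt0 (m%:R : R); lra.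
have h := expR_ge1Dx (- del * ln (1 + m%:R^-1)).
have [vm vm1] := (pow_decay_gt0 m, pow_decay_le1 m0).
have h2 : del * ln (1 + m%:R^-1) <= del / m%:R by rewrite ler_pM2l.
have h3 : 0 <= del / m%:R by rewrite divr_ge0 ?(ltW del0).
move: h h2; move: (expR _) => E; move: (ln _) => L h h2; nra.
Qed.

(** Comparison with the integral of x^(-1-del), in difference form; it makes the tail in
    [pow_weight_tail] telescope. *)
Lemma pow_decay_step_ge m : (0 < m)%N -> del * w m.+1 <= v m - v m.+1.
Proof.
move=> m0; have mR : 0 < m%:R :> R by rewrite ltr0n.
have m1R : 0 < m.+1%:R :> R by rewrite ltr0n.
pose t : R := m.+1%:R^-1.
have t1 : t < 1 by rewrite invf_lt1 // ltr1n.
have t0 : 0 < t by rewrite invr_gt0.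
have -> : v m = v m.+1 * expR (- del * ln (1 - t)).
  rewrite /v -expRD -mulrDr -lnM ?posrE ?subr_gt0 //.
  by rewrite mulrBr mulr1 divff ?gt_eqF // -natr1 addrK.
have l : ln (1 - t) <= - t by apply: le_ln1Dx; rewrite ltrN2.
have h := expR_ge1Dx (- del * ln (1 - t)).
have vm := pow_decay_gt0 m.+1.
have h2 : del * ln (1 - t) <= del * - t by rewrite ler_pM2l.
rewrite /w -/t; move: h h2; move: (expR _) => E; move: (ln _) => L h h2; nra.
Qed.

Lemma pow_weight_gt0 m : (0 < m)%N -> 0 < w m.
Proof. by move=> m0; rewrite divr_gt0 ?pow_decay_gt0 ?ltr0n. Qed.

Lemma pow_weight1 : w 1 = 1.
Proof. by rewrite /w pow_decay1 divr1. Qed.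

Lemma pow_weightM a b : (0 < a)%N -> (0 < b)%N -> w (a * b) = w a * w b.
Proof. by move=> a0 b0; rewrite /w pow_decayM // natrM invfM mulrACA. Qed.

Lemma pow_weight_le m : (0 < m)%N -> w m <= m%:R^-1.
Proof.
by move=> m0; rewrite ler_piMl ?invr_ge0 ?ler0n // pow_decay_le1.
Qed.

Lemma pow_weight_tail P M : (0 < P)%N -> \sum_(P.+1 <= m < M.+1) w m <= v P / del.
Proof.
move=> P0; have [PM|MP] := leqP P M; last first.
  by rewrite big_geq 1?ltnW // divr_ge0 ?(ltW (pow_decay_gt0 _)) ?(ltW del0).
rewrite ler_pdivlMr // mulrC big_distrr /= big_add1 /=.
apply: (@le_trans _ _ (\sum_(P <= i < M) - (v i.+1 - v i))).
  apply: ler_sum_nat => i /andP[iP _]; rewrite opprB pow_decay_step_ge //.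
  exact: leq_trans iP.
by rewrite sumrN telescope_sumr // opprB gerBl (ltW (pow_decay_gt0 _)).
Qed.

Lemma pow_weight_sum M : \sum_(1 <= m < M.+1) w m <= 2 / del.
Proof.
case: M => [|M]; first by rewrite big_geq // divr_ge0 // (ltW del0).
rewrite big_ltn // pow_weight1.
have := pow_weight_tail M.+1 (ltn0Sn 0); rewrite pow_decay1.
have : 1 <= del^-1 by rewrite invf_ge1.
move: (\sum_(_ <= _ < _) _) => s; lra.
Qed.

Lemma pow_decay_vanishes eta : 0 < eta -> exists P, (0 < P)%N /\ forall M, (P <= M)%N -> v M <= eta.
Proof.
move=> e0; pose P := (Num.bound (expR (- ln eta / del))).
have hP : expR (- ln eta / del) < P%:R.
  by apply: archi_boundP; rewrite ltW // expR_gt0.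
have P0 : (0 < P)%N by rewrite -(ltr0n R); apply: lt_trans hP; exact: expR_gt0.
exists P; split=> // M PM; apply: le_trans (pow_decay_decr P0 PM) _.
rewrite /v -[leRHS]lnK ?posrE // ler_expR.
have : ln (expR (- ln eta / del)) < ln P%:R by rewrite ltr_ln ?posrE ?expR_gt0 ?ltr0n.
rewrite expRK ltr_pdivrMr // => h; rewrite mulNr lerNl mulrC; exact: ltW.
Qed.
End PowerWeights.

Local Open Scope complex_scope.

Section NormC.
Variable R : rcfType.

Lemma normc_ge0 (x : R[i]) : 0 <= normc x.
Proof. by case: x => a b; rewrite /normc sqrtr_ge0. Qed.

Lemma normc_real (x : R) : normc x%:C = `|x|.
Proof. by rewrite /normc /= expr0n addr0 sqrtr_sqr. Qed.

Lemma normcE_norm (x : R[i]) : `|x| = (normc x)%:C.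
Proof. by []. Qed.

Lemma normc_sum_le (I : Type) (r : seq I) (P : pred I) (F : I -> R[i]) (G : I -> R) :
  (forall i, P i -> normc (F i) <= G i) ->
  normc (\sum_(i <- r | P i) F i) <= \sum_(i <- r | P i) G i.
Proof.
move=> FG; elim/big_rec2: _ => [|i y x Pi xy]; first by rewrite normc0.
by apply: le_trans (le_normcD _ _) _; rewrite lerD ?FG.
Qed.

Lemma normcX (x : R[i]) n : normc (x ^+ n) = normc x ^+ n.
Proof.
by elim: n => [|n IH]; rewrite ?expr0 ?normc1 // !exprS normcM IH.
Qed.

Lemma normc_prod (I : Type) (r : seq I) (P : pred I) (F : I -> R[i]) :
  normc (\prod_(i <- r | P i) F i) = \prod_(i <- r | P i) normc (F i).
Proof. by apply: (big_morph _ (@normcM R) (normc1 R)). Qed.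

Lemma normc_sqr (x : R[i]) : normc x ^+ 2 = complex.Re x ^+ 2 + complex.Im x ^+ 2.
Proof. by case: x => a b /=; rewrite sqr_sqrtr // addr_ge0 ?sqr_ge0. Qed.
End NormC.

(** * Truncated Euler products *)

Section Sieve.
Variables (R : realType) (del : R).
Hypotheses (del0 : 0 < del) (del1 : del <= 1).
Local Notation w := (pow_weight del).
Local Notation v := (pow_decay del).
Variable g : nat -> R[i].
Hypothesis gM : forall a b, g (a * b)%N = g a * g b.
Hypothesis g1 : g 1%N = 1.
Hypothesis gn : forall a, normc (g a) <= 1.

Definition dterm m := g m * (w m)%:C.

(* Sieving by all primes up to P leaves 1 plus a small tail: a truncated Euler
   product that needs no convergence theory. *)
Definition sieved (ps : seq nat) M :=
  \sum_(1 <= m < M.+1 | all (fun p => ~~ (p %| m)%N) ps) dterm m.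

Lemma normc_dterm m : (0 < m)%N -> normc (dterm m) <= w m.
Proof.
move=> m0; have wm := pow_weight_gt0 del m0.
by rewrite /dterm normcM normc_real (gtr0_norm wm) ler_piMl // ltW.
Qed.

Lemma dtermM a b : (0 < a)%N -> (0 < b)%N -> dterm (a * b) = dterm a * dterm b.
Proof. by move=> a0 b0; rewrite /dterm gM pow_weightM // rmorphM mulrACA. Qed.

Lemma normc_sieved_tail (Q : pred nat) P M : (0 < P)%N ->
  normc (\sum_(P.+1 <= m < M.+1 | Q m) dterm m) <= v P / del.
Proof.
move=> P0; apply: le_trans (pow_weight_tail del0 M P0).
rewrite [X in normc X]big_nat_cond.
apply: le_trans (normc_sum_le _ (G := w) _) _.
  by move=> m /andP[/andP[Pm _] _]; apply: normc_dterm; apply: leq_ltn_trans Pm.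
rewrite -big_nat_cond [leRHS](bigID Q) /= lerDl.
rewrite big_nat_cond; apply: sumr_ge0 => m /andP[/andP[Pm _] _].
by apply/ltW/pow_weight_gt0; apply: leq_ltn_trans Pm.
Qed.

(** The multiples of p in [sieved ps M] sum to [dterm p * sieved ps (M %/ p)]; the error comes from
    the terms between M / p and M, which form a tail. *)
Lemma sieved_step p ps M : prime p -> all prime ps -> p \notin ps -> (p <= M)%N ->
  normc ((1 - dterm p) * sieved ps M - sieved (p :: ps) M) <= v (M %/ p) / del.
Proof.
move=> pp pps pnps pM; have p0 := prime_gt0 pp.
have q0 : (0 < M %/ p)%N by rewrite divn_gt0.
set C := fun m => all (fun q => ~~ (q %| m)%N) ps.
have e1 : sieved ps M = dterm p * sieved ps (M %/ p) + sieved (p :: ps) M.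
  rewrite {1}/sieved (bigID (fun m => p %| m)%N) /=; congr (_ + _); last first.
    by apply: eq_bigl => m; rewrite andbC.
  rewrite /sieved big_distrr /= -[LHS]big_filter -[RHS]big_filter.
  transitivity (\sum_(m <- map (muln p) [seq m <- index_iota 1 (M %/ p).+1 | C m]) dterm m).
    apply: perm_big; apply: uniq_perm.
    - by rewrite filter_uniq ?iota_uniq.
    - rewrite map_inj_uniq ?filter_uniq ?iota_uniq // => x y /eqP.
      by rewrite eqn_pmul2l // => /eqP.
    have CpE m : C (p * m)%N = C m.
      apply: eq_in_all => q qps; have qpr := allP pps q qps.
      rewrite Euclid_dvdM // dvdn_prime2 //.
      by have [qp|//] := eqVneq q p; rewrite qp (negPf pnps) in qps.
    move=> m; rewrite mem_filter mem_index_iota; apply/idP/mapP.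
      case/andP=> /andP[Cm0 /dvdnP[k km]] /andP[m0 mM]; exists k; last by rewrite mulnC.
      have Cm : C m := Cm0.
      rewrite mem_filter mem_index_iota -CpE mulnC -km Cm /= ltnS leq_divRL // -km.
      by rewrite (mM : m <= M)%N andbT; move: m0; rewrite km muln_gt0 => /andP[].
    case=> k; rewrite mem_filter mem_index_iota => /andP[Ck /andP[k0 kM]] ->.
    rewrite -/(C _) CpE Ck dvdn_mulr //= muln_gt0 p0 k0 /=.
    by move: kM; rewrite !ltnS leq_divRL // mulnC.
  rewrite big_map big_seq_cond [RHS]big_seq_cond; apply: eq_bigr => m.
  by rewrite andbT mem_filter mem_index_iota => /and3P[_ m0 _]; rewrite dtermM.
have e2 : sieved ps M = sieved ps (M %/ p) + \sum_((M %/ p).+1 <= m < M.+1 | C m) dterm m.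
  by rewrite /sieved (big_cat_nat (n := (M %/ p).+1)) //= ltnS leq_div.
have e3 : sieved (p :: ps) M = sieved ps M - dterm p * sieved ps (M %/ p).
  by rewrite e1 addrC addKr.
have -> : (1 - dterm p) * sieved ps M - sieved (p :: ps) M =
   - (dterm p * (sieved ps M - sieved ps (M %/ p))) by rewrite e3; ring.
rewrite normcN normcM {1}e2 addrC addKr.
have h := normc_sieved_tail C M q0.
have dp : normc (dterm p) <= 1.
  apply: le_trans (normc_dterm p0) _; apply: le_trans (pow_weight_le del0 p0) _.
  by rewrite invf_le1 ?ltr0n // ler1n.
apply: le_trans h; rewrite ler_piMl ?normc_ge0 //.
Qed.

Lemma sieved_limit ps eta : uniq ps -> all prime ps -> 0 < eta ->
  exists M0, forall M, (M0 <= M)%N ->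
    normc (\prod_(p <- ps) (1 - dterm p) * sieved [::] M - sieved ps M) <= eta.
Proof.
elim: ps eta => [|p ps IH] eta.
  by move=> _ _ e0; exists 0%N => M _; rewrite big_nil mul1r subrr normc0 ltW.
rewrite /= => /andP[pnps ups] /andP[pp pps] e0.
have p0 := prime_gt0 pp.
(* The inductive error gets multiplied by |1 - dterm p| <= 2, which leaves eta / 2 for the new
   step. *)
have [M1 h1] := IH (eta / 4) ups pps (divr_gt0 e0 (ltr0n _ 4)).
have e1 : 0 < eta * del / 2 by rewrite divr_gt0 ?mulr_gt0.
have [P [P0 h2]] := pow_decay_vanishes del0 e1.
exists (maxn M1 (P * p)) => M; rewrite geq_max => /andP[MM1 MP].
have pM : (p <= M)%N by apply: leq_trans MP; rewrite leq_pmull.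
have h3 := sieved_step pp pps pnps pM.
have h4 : v (M %/ p) / del <= eta / 2.
  by rewrite ler_pdivrMr // mulrAC h2 // leq_divRL.
rewrite big_cons.
have -> : (1 - dterm p) * \prod_(j <- ps) (1 - dterm j) * sieved [::] M - sieved (p :: ps) M
  = (1 - dterm p) * (\prod_(j <- ps) (1 - dterm j) * sieved [::] M - sieved ps M)
    + ((1 - dterm p) * sieved ps M - sieved (p :: ps) M) by ring.
apply: le_trans (le_normcD _ _) _; rewrite normcM.
have dp : normc (1 - dterm p) <= 2.
  apply: le_trans (le_normcD _ _) _; rewrite normcN normc1.
  have : normc (dterm p) <= 1.
    apply: le_trans (normc_dterm p0) _; apply: le_trans (pow_weight_le del0 p0) _.
    by rewrite invf_le1 ?ltr0n // ler1n.
  lra.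
have h5 := h1 M MM1; have := normc_ge0 (1 - dterm p).
have := normc_ge0 (\prod_(j <- ps) (1 - dterm j) * sieved [::] M - sieved ps M).
have h6 := le_trans h3 h4.
move: h5 h6 dp; move: (normc _) (normc _) (normc _) => x y z *; nra.
Qed.

Definition primes_upto P := [seq p <- index_iota 2 P.+1 | prime p].

(** Every m with 1 < m <= P has a prime divisor up to P, so only m = 1 and a tail beyond P
    survive. *)
Lemma sieved_primes P M : (0 < P)%N -> (0 < M)%N ->
  normc (sieved (primes_upto P) M - 1) <= v P / del.
Proof.
move=> P0 M0; rewrite /sieved.
pose C m := all (fun p => ~~ (p %| m)%N) (primes_upto P).
have C1 : C 1%N.
  by apply/allP => p; rewrite mem_filter dvdn1 => /andP[/prime_gt1 p1 _]; rewrite gtn_eqF.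
rewrite big_ltn_cond //= -/(C 1%N) C1.
have -> : dterm 1 = 1 by rewrite /dterm g1 pow_weight1 mulr1.
rewrite addrC addKr.
have CF m : (1 < m)%N -> C m -> (P < m)%N.
  move=> m1 Cm; rewrite ltnNge; apply: contraL Cm => mP; apply/allPn.
  exists (pdiv m); last by rewrite negbK pdiv_dvd.
  rewrite mem_filter pdiv_prime // mem_index_iota prime_gt1 ?pdiv_prime //= ltnS.
  by apply: leq_trans mP; apply: pdiv_leq; apply: ltnW.
apply: le_trans (normc_sieved_tail C M P0).
have [PM|MP] := leqP P M; last first.
  rewrite big_nat_cond big_pred0 ?normc0 ?normc_ge0 // => m.
  apply/negP => /andP[/andP[m1 mM] Cm]; have := CF m m1 Cm; lia.
rewrite (big_cat_nat (n := P.+1)) //= big_nat_cond big_pred0 ?add0r // => m.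
apply/negP => /andP[/andP[m1 mM] Cm]; have := CF m m1 Cm; lia.
Qed.

(** Stands for the identity between a Dirichlet series and its Euler product: product times sum
    differs from 1 by at most 1/4 from sieving and 1/4 from the tail. *)
Lemma euler_lower P : (0 < P)%N -> v P / del <= 4^-1 ->
  exists M0, forall M, (M0 <= M)%N ->
   2^-1 <= normc (\prod_(p <- primes_upto P) (1 - dterm p))
            * normc (\sum_(1 <= m < M.+1) dterm m).
Proof.
move=> P0 vP.
have e0 : 0 < 4^-1 :> R by rewrite invr_gt0.
have [||M0 h] := @sieved_limit (primes_upto P) 4^-1 _ _ e0.
- by rewrite filter_uniq ?iota_uniq.
- exact: filter_all.
exists (maxn M0 1) => M; rewrite geq_max => /andP[/h {}h M1].
have h2 := sieved_primes P0 M1.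
rewrite -normcM.
have -> : \sum_(1 <= m < M.+1) dterm m = sieved [::] M by [].
move: h h2; set x := _ * sieved [::] M; move: (sieved (primes_upto P) M) => y h h2.
have : normc (1 : R[i]) <= normc x + (normc (x - y) + normc (y - 1)).
  have {1}-> : 1 = x - ((x - y) + (y - 1)) by ring.
  apply: le_trans (le_normcD _ _) _; rewrite lerD2l normcN; exact: le_normcD.
rewrite normc1; lra.
Qed.
End Sieve.

(** * The 3-4-1 inequality *)

Section ThreeFourOne.
Variable R : realType.

Lemma mul_le_mean_sqr (x y : R) : x * y <= ((x + y) / 2) ^+ 2.
Proof. have := sqr_ge0 (x - y); rewrite !expr2; lra. Qed.

(* AM-GM in place of the usual cosine inequality, one Euler factor at a time. *)
Lemma three_four_one_real (t c : R) : 0 <= t -> t <= 1 -> -1 <= c -> c <= 1 ->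
  ((1 - t) ^+ 2) ^+ 3 * (1 - 2 * t * c + t ^+ 2) ^+ 4
    * (1 - 2 * t * (2 * c ^+ 2 - 1) + t ^+ 2) <= ((1 + t ^+ 2) ^+ 4) ^+ 2.
Proof.
move=> t0 t1 cN1 c1.
set A := (1 - t) ^+ 2; set B := 1 - _ + _; set D := 1 - _ + _.
have A0 : 0 <= A by rewrite sqr_ge0.
have B0 : 0 <= B by rewrite /B; nra.
have D0 : 0 <= D.
  have u0 := sqr_ge0 c; have u1 : c ^+ 2 <= 1 by rewrite expr2; nra.
  by rewrite /D; move: (c ^+ 2) u0 u1 => u u0 u1; nra.
(* [u] is the mean of A, A, A, D; AM-GM for these and four copies of B is applied by repeated
   halving. *)
pose u := (A + (A + D) / 2) / 2.
have u0 : 0 <= u by rewrite /u; lra.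
have h1 : A ^+ 3 * D <= u ^+ 4.
  have -> : A ^+ 3 * D = A ^+ 2 * (A * D) by ring.
  apply: (@le_trans _ _ (A ^+ 2 * ((A + D) / 2) ^+ 2)).
    by rewrite ler_wpM2l ?sqr_ge0 ?mul_le_mean_sqr.
  rewrite -exprMn (_ : u ^+ 4 = (u ^+ 2) ^+ 2); last by rewrite -exprM.
  rewrite ler_sqr ?nnegrE ?sqr_ge0 ?mul_le_mean_sqr //.
  by rewrite mulr_ge0 // divr_ge0 // addr_ge0.
have h2 : u ^+ 4 * B ^+ 4 <= (((u + B) / 2) ^+ 2) ^+ 4.
  rewrite -exprMn lerXn2r ?nnegrE ?sqr_ge0 ?mul_le_mean_sqr //.
  exact: mulr_ge0.
have -> : A ^+ 3 * B ^+ 4 * D = (A ^+ 3 * D) * B ^+ 4 by ring.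
apply: le_trans (_ : u ^+ 4 * B ^+ 4 <= _); first by rewrite ler_wpM2r ?exprn_ge0.
apply: le_trans h2 _; rewrite -!exprM mulnC [(4 * 2)%N]mulnC.
have h3 : (u + B) / 2 <= 1 + t ^+ 2.
  have -> : (u + B) / 2 = 1 + t ^+ 2 - t * (1 + c) ^+ 2 / 2.
    by rewrite /u /A /B /D; field.
  rewrite gerBl; apply: divr_ge0 => //; apply: mulr_ge0 => //; exact: sqr_ge0.
rewrite lerXn2r ?nnegrE //; first by rewrite divr_ge0 // addr_ge0.
by rewrite addr_ge0 ?sqr_ge0.
Qed.

(** At z = f(p) and t = p^(-1-del) these are the Euler factors of |f|, f and f^2. The bound is 1 +
    O(t^2), so its product over the primes stays bounded. *)
Lemma three_four_one (t : R) (z : R[i]) : 0 <= t -> t <= 1 -> z = 0 \/ normc z = 1 ->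
  normc (1 - (normc z)%:C * t%:C) ^+ 3 * normc (1 - z * t%:C) ^+ 4
    * normc (1 - (z * z) * t%:C) <= (1 + t ^+ 2) ^+ 4.
Proof.
move=> t0 t1 [->|z1].
  rewrite normc0 !mul0r subr0 normc1 !expr1n !mulr1.
  by rewrite exprn_ege1 // lerDl sqr_ge0.
rewrite -ler_sqr ?nnegrE ?mulr_ge0 ?exprn_ge0 ?normc_ge0 ?addr_ge0 ?sqr_ge0 //.
have sq (a b d : R) : (a ^+ 3 * b ^+ 4 * d) ^+ 2 = (a ^+ 2) ^+ 3 * (b ^+ 2) ^+ 4 * d ^+ 2.
  by ring.
rewrite sq z1 mul1r !normc_sqr; have := normc_sqr z; rewrite z1 expr1n.
case: z {z1} => c s /= cs.
have s2 : s ^+ 2 = 1 - c ^+ 2 by rewrite cs; ring.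
have c2 : c ^+ 2 <= 1 by rewrite cs lerDl sqr_ge0.
have [cN1 c1] : -1 <= c /\ c <= 1.
  apply/andP; rewrite -ler_norml -(@ler_sqr _ `|c| 1) ?nnegrE //.
  by rewrite real_normK ?num_real // expr1n.
apply: le_trans (three_four_one_real t0 t1 cN1 c1).
simpc; rewrite /= le_eqVlt; apply/orP; left; apply/eqP; congr (_ ^+ 3 * _ ^+ 4 * _).
- by rewrite expr0n addr0.
- have -> : (1 - c * t) ^+ 2 + (- (s * t)) ^+ 2 = 1 - 2 * t * c + (c ^+ 2 + s ^+ 2) * t ^+ 2.
    by ring.
  by rewrite -cs mul1r.
have -> : (1 - (c * c - s * s) * t) ^+ 2 + (- ((c * s + s * c) * t)) ^+ 2 =
   1 - 2 * t * (c ^+ 2 - s ^+ 2) + (c ^+ 2 + s ^+ 2) ^+ 2 * t ^+ 2 by ring.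
by rewrite -cs s2; ring.
Qed.

(** The product of 1 + 1/n^2 for 2 <= n <= P is at most 2P / (P + 1), by induction, since (n^2 -
    1)(n^2 + 1) <= n^4. *)
Lemma prod_one_plus_inv_sqr P (Q : pred nat) (t : nat -> R) :
    (forall p, (0 < p)%N -> 0 <= t p <= p%:R^-1) ->
  \prod_(p <- [seq p <- index_iota 2 P.+1 | Q p]) (1 + t p ^+ 2) <= 2.
Proof.
move=> ht; rewrite big_filter.
apply: (@le_trans _ _ (\prod_(2 <= p < P.+1) (1 + (p%:R^-1) ^+ 2))).
  rewrite [leRHS](bigID Q) /= -[leLHS]mulr1 ler_pM //.
  - by apply: prodr_ge0 => p _; rewrite addr_ge0 ?sqr_ge0.
  - rewrite big_nat_cond [leRHS]big_nat_cond; apply: ler_prod => p /andP[/andP[p2 _] _].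
    have /andP[a b] := ht p (ltnW p2).
    by rewrite addr_ge0 ?sqr_ge0 //= lerD2l lerXn2r // nnegrE invr_ge0.
  - elim/big_rec: _ => // p x _ x1; rewrite mulr_ege1 // lerDl sqr_ge0 //.
have [P1|] := leqP 1 P; last first.
  by case: P => // _; rewrite big_geq // ler1n.
have : \prod_(2 <= p < P.+1) (1 + (p%:R^-1) ^+ 2) <= 2 * P%:R / P.+1%:R :> R.
  elim: P P1 => // -[_ _|P IH _]; first by rewrite big_geq // mulr1 divff ?lexx // pnatr_eq0.
  rewrite big_nat_recr //=; apply: le_trans (_ : 2 * P.+1%:R / P.+2%:R * (1 + P.+2%:R^-1 ^+ 2) <= _).
    by rewrite ler_wpM2r ?IH // addr_ge0 ?sqr_ge0.
  have y0 : 0 < P.+2%:R :> R by rewrite ltr0n.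
  rewrite -[P.+3%:R]natr1; have -> : P.+1%:R = P.+2%:R - 1 :> R by rewrite -[in RHS]natr1 addrK.
  move: (P.+2%:R : R) y0 => y y0.
  have -> : 2 * (y - 1) / y * (1 + y^-1 ^+ 2) = 2 * (y / (y + 1)) * ((y^+4 - 1) / y ^+ 4).
    field; rewrite !gt_eqF ?addr_gt0 //.
  rewrite -[leRHS]mulrA ler_piMr //; first by rewrite mulr_ge0 // divr_ge0 ?addr_ge0 ?(ltW y0).
  by rewrite ler_pdivrMr ?exprn_gt0 // mul1r gerBl.
move/le_trans; apply; rewrite ler_pdivrMr ?ltr0n // ler_pM2l // ler_nat //.
Qed.
End ThreeFourOne.

(** * Characters with nonprincipal square *)

Section ComplexChar.
Variable R : realType.

Lemma sum_inv_sqr_le M : \sum_(1 <= i < M) (i%:R ^- 2) <= 2 :> R.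
Proof.
case: M => [|[|M]]; [by rewrite big_geq | by rewrite big_geq |].
suff : \sum_(1 <= i < M.+2) (i%:R ^- 2) <= 2 - M.+1%:R^-1 :> R.
  by move=> h; apply: le_trans h _; rewrite gerBl invr_ge0.
elim: M => [|M IH]; first by rewrite big_nat1 expr1n invr1; lra.
rewrite big_nat_recr //=; apply: le_trans (lerD IH (lexx _)) _.
rewrite -[M.+2%:R]natr1; move: (ltr0Sn R M); move: (M.+1%:R : R) => y y0.
rewrite -subr_ge0.
have -> : 2 - (y + 1)^-1 - (2 - y^-1 + (y + 1) ^- 2) = (y * (y + 1) ^+ 2)^-1.
  by field; rewrite !gt_eqF // addr_gt0.
by rewrite invr_ge0 mulr_ge0 ?sqr_ge0 // ltW.
Qed.

Variable f : nat -> R[i].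
Hypothesis fM : forall a b, f (a * b)%N = f a * f b.
Hypothesis f1 : f 1%N = 1.
Hypothesis fn : forall a, f a = 0 \/ normc (f a) = 1.
Variables B C : R.
Hypothesis fB : forall m, (0 < m)%N -> normc (\sum_(1 <= i < m.+1) f i * f i) <= B.
Hypothesis fC : forall m, (0 < m)%N ->
  normc (\sum_(1 <= i < m.+1) f i / i%:R) <= C / m%:R.

Lemma fn1 a : normc (f a) <= 1.
Proof. by case: (fn a) => ->; rewrite ?normc0. Qed.

Lemma sqr_series_bound del M : 0 < del -> del <= 1 ->
  normc (\sum_(1 <= m < M.+1) dterm del (fun a => f a * f a) m) <= B.
Proof.
move=> d0 d1.
have wd m : (0 < m)%N -> pow_weight del m.+1 <= pow_weight del m.
  move=> m0; rewrite /pow_weight ler_pM ?(ltW (pow_decay_gt0 _ _)) ?invr_ge0 //.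
    by rewrite pow_decay_decr.
  by rewrite lef_pV2 ?posrE ?ltr0n // ler_nat.
have := @abel_bound_const R[i] (fun a => f a * f a) (fun m => (pow_weight del m)%:C) B%:C M.
rewrite pow_weight1 mulr1 normcE_norm lecR; apply.
- by move=> m m0; rewrite normcE_norm lecR fB.
- by move=> m m0; rewrite lecR wd.
- by move=> m m0; rewrite ler0c ltW // pow_weight_gt0.
Qed.

(** [fC] says that L(1, f) = 0 with tails O(1/m). Summation by parts against m^(-del), whose steps
    are at most del / m, turns this into a zero of the series at del = 0. *)
Lemma series_bound del M : 0 < del -> del <= 1 -> (0 < M)%N ->
  normc (\sum_(1 <= m < M.+1) dterm del f m) <= C / M%:R + 2 * C * del.
Proof.
move=> d0 d1 M0.
have C0 : 0 <= C by have := fC (ltn0Sn 0); rewrite divr1; apply: le_trans; exact: normc_ge0.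
have := @abel_bound R[i] (fun i => f i / i%:R) (fun m => (pow_decay del m)%:C)
  (fun m => (C / m%:R)%:C) M M0 _ _ _.
have -> : \sum_(1 <= i < M.+1) f i / i%:R * (pow_decay del i)%:C =
          \sum_(1 <= m < M.+1) dterm del f m.
  apply: eq_bigr => i _; rewrite /dterm /pow_weight -mulrA; congr (_ * _).
  by rewrite rmorphM fmorphV rmorph_nat mulrC.
rewrite normcE_norm -rmorphM.
have -> : \sum_(1 <= i < M) (C / i%:R)%:C * ((pow_decay del i)%:C - (pow_decay del i.+1)%:C)
  = (\sum_(1 <= i < M) C / i%:R * (pow_decay del i - pow_decay del i.+1))%:C.
  by rewrite rmorph_sum; apply: eq_bigr => i _; rewrite -rmorphB -rmorphM.
rewrite -rmorphD lecR => h; apply: le_trans (h _ _ _) _.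
- by move=> m m0; rewrite normcE_norm lecR fC.
- by move=> m m0; rewrite lecR pow_decay_decr.
- by move=> m m0; rewrite ler0c ltW // pow_decay_gt0.
apply: lerD.
  by rewrite ler_piMr ?divr_ge0 // pow_decay_le1.
apply: (@le_trans _ _ (\sum_(1 <= i < M) C * del * i%:R ^- 2)).
  apply: ler_sum_nat => i /andP[i0 _].
  have -> : C * del * i%:R ^- 2 = C / i%:R * (del / i%:R) by rewrite expr2 invfM; ring.
  by rewrite ler_wpM2l ?divr_ge0 // pow_decay_step_le.
have -> : 2 * C * del = C * del * 2 by ring.
rewrite -big_distrr /= ler_wpM2l ?mulr_ge0 ?(ltW d0) //.
exact: sum_inv_sqr_le.
Qed.

Lemma principal_series_bound del M : 0 < del -> del <= 1 ->
  normc (\sum_(1 <= m < M.+1) dterm del (fun a => (normc (f a))%:C) m) <= 2 / del.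
Proof.
move=> d0 d1; apply: le_trans (pow_weight_sum d0 d1 M).
rewrite [X in normc X]big_nat [leRHS]big_nat; apply: normc_sum_le => m /andP[m0 _].
by apply: normc_dterm => // a; rewrite normc_real ger0_norm ?normc_ge0 ?fn1.
Qed.

(** Near del = 0 the series of |f| has at most a simple pole, that of f a zero, and that of f^2 is
    bounded, so S0^3 S1^4 S2 = O(del). The Euler products contribute at most 16, yet [euler_lower]
    bounds everything below by 2^(-8). *)
Lemma complex_char_contradiction : False.
Proof.
have B0 : 0 <= B by apply: le_trans (fB (ltn0Sn 0)); exact: normc_ge0.
have C0 : 0 <= C by have := fC (ltn0Sn 0); rewrite divr1; apply: le_trans; exact: normc_ge0.
(* 16 (2 / del)^3 (3 C del)^4 B = Q del, and the next choice of del makes this less than 2^(-8). *)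
pose Q := 16 * 8 * 81 * C ^+ 4 * B.
have Q0 : 0 <= Q by rewrite !mulr_ge0 ?exprn_ge0.
pose del := (256 * Q + 1)^-1.
have d0 : 0 < del by rewrite invr_gt0; lra.
have d1 : del <= 1 by rewrite invf_le1; lra.
have [P [P0 vP]] := pow_decay_vanishes d0 (divr_gt0 d0 (ltr0n _ 4)).
have vPd : pow_decay del P / del <= 4^-1.
  by rewrite ler_pdivrMr // mulrC; apply: vP.
have n0 a : normc ((normc (f a))%:C) <= 1 by rewrite normc_real ger0_norm ?normc_ge0 ?fn1.
have n2 a : normc (f a * f a) <= 1 by rewrite normcM mulr_ile1 ?normc_ge0 ?fn1.
have [||M0 h0] := @euler_lower R del d0 d1 (fun a => (normc (f a))%:C) _ _ n0 P P0 vPd.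
- by move=> a b; rewrite fM normcM rmorphM.
- by rewrite f1 normc1.
have [M1 h1] := @euler_lower R del d0 d1 f fM f1 fn1 P P0 vPd.
have [||M2 h2] := @euler_lower R del d0 d1 (fun a => f a * f a) _ _ n2 P P0 vPd.
- by move=> a b; rewrite fM mulrACA.
- by rewrite f1 mulr1.
(* M also exceeds 1 / del, so that C / M <= C del. *)
pose M := (M0 + M1 + M2 + (Num.bound del^-1).+1)%N.
have Mp : (0 < M)%N by rewrite /M addnS.
have := h0 M ltac:(rewrite /M; lia); have := h1 M ltac:(rewrite /M; lia).
have := h2 M ltac:(rewrite /M; lia) => {h0 h1 h2}.
have := principal_series_bound M d0 d1; have := sqr_series_bound M d0 d1.
have : normc (\sum_(1 <= m < M.+1) dterm del f m) <= 3 * C * del.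
  apply: le_trans (series_bound d0 d1 Mp) _.
  have -> : 3 * C * del = C * del + 2 * C * del by ring.
  rewrite lerD2r ler_wpM2l // invf_ple ?posrE ?ltr0n //.
  apply: le_trans (ltW (archi_boundP _)) _; first by rewrite invr_ge0 ltW.
  by rewrite ler_nat /M addnS; apply: leq_trans (leqnSn _); rewrite leq_addl.
set S0 := normc (\sum_(_ <= _ < _) dterm del (fun a => (_)%:C) _).
set S1 := normc (\sum_(_ <= _ < _) dterm del f _).
set S2 := normc (\sum_(_ <= _ < _) dterm del (fun a => f a * _) _).
set E0 := normc (\prod_(p <- _) (1 - dterm del (fun a => (_)%:C) _)).
set E1 := normc (\prod_(p <- _) (1 - dterm del f _)).
set E2 := normc (\prod_(p <- _) (1 - dterm del (fun a => f a * _) _)).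
move=> b1 b2 b0 l2 l1 l0.
have [S00 S10 S20] : [/\ 0 <= S0, 0 <= S1 & 0 <= S2] by rewrite !normc_ge0.
have [E00 E10 E20] : [/\ 0 <= E0, 0 <= E1 & 0 <= E2] by rewrite !normc_ge0.
have q (x : R[i]) n : 0 <= normc x ^+ n by rewrite exprn_ge0 ?normc_ge0.
have EE : E0 ^+ 3 * E1 ^+ 4 * E2 <= 16.
  rewrite /E0 /E1 /E2 !normc_prod -!prodrXl -!big_split.
  apply: (@le_trans _ _ (\prod_(p <- primes_upto P) (1 + (pow_weight del p) ^+ 2) ^+ 4)).
    rewrite big_filter [leRHS]big_filter big_nat_cond [leRHS]big_nat_cond.
    apply: ler_prod => p /andP[/andP[p2 _] _].
    apply/andP; split; first exact: mulr_ge0 (mulr_ge0 (q _ _) (q _ _)) (normc_ge0 _).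
    rewrite /dterm.
    have p0 : (0 < p)%N by apply: ltnW.
    apply: three_four_one (fn p).
      by rewrite ltW // pow_weight_gt0.
    apply: le_trans (pow_weight_le d0 p0) _.
    by rewrite invf_le1 ?ltr0n // ler1n.
  rewrite prodrXl (_ : 16 = 2 ^+ 4 :> R); last by rewrite -natrX.
  rewrite lerXn2r ?nnegrE //.
    by apply: prodr_ge0 => p _; rewrite addr_ge0 ?sqr_ge0.
  apply: prod_one_plus_inv_sqr => p p0.
  by rewrite ltW ?pow_weight_gt0 // pow_weight_le.
have SS : S0 ^+ 3 * S1 ^+ 4 * S2 <= (2 / del) ^+ 3 * (3 * C * del) ^+ 4 * B.
  have p1 : S0 ^+ 3 <= (2 / del) ^+ 3 by rewrite lerXn2r ?nnegrE // (le_trans S00 b0).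
  have p2 : S1 ^+ 4 <= (3 * C * del) ^+ 4 by rewrite lerXn2r ?nnegrE // (le_trans S10 b1).
  by apply: ler_pM => //; [apply: mulr_ge0; apply: exprn_ge0|apply: ler_pM => //; apply: exprn_ge0].
have : (2^-1) ^+ 3 * (2^-1) ^+ 4 * 2^-1 <= (E0 * S0) ^+ 3 * (E1 * S1) ^+ 4 * (E2 * S2).
  have h : 0 <= 2^-1 :> R by rewrite invr_ge0.
  have p1 : (2^-1) ^+ 3 <= (E0 * S0) ^+ 3 by rewrite lerXn2r ?nnegrE // (le_trans h l0).
  have p2 : (2^-1) ^+ 4 <= (E1 * S1) ^+ 4 by rewrite lerXn2r ?nnegrE // (le_trans h l1).
  by apply: ler_pM => //; [apply: mulr_ge0; apply: exprn_ge0|apply: ler_pM => //; apply: exprn_ge0].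
have -> : (E0 * S0) ^+ 3 * (E1 * S1) ^+ 4 * (E2 * S2) =
  (E0 ^+ 3 * E1 ^+ 4 * E2) * (S0 ^+ 3 * S1 ^+ 4 * S2) by ring.
apply/negP; rewrite -ltNge.
have : (E0 ^+ 3 * E1 ^+ 4 * E2) * (S0 ^+ 3 * S1 ^+ 4 * S2)
   <= 16 * ((2 / del) ^+ 3 * (3 * C * del) ^+ 4 * B).
  by apply: ler_pM => //; do 2?[apply: mulr_ge0 => //]; apply: exprn_ge0.
move/le_lt_trans; apply.
have -> : 16 * ((2 / del) ^+ 3 * (3 * C * del) ^+ 4 * B) = Q * del.
  by rewrite /Q; field; rewrite gt_eqF.
have -> : (2^-1) ^+ 3 * (2^-1) ^+ 4 * 2^-1 = 256^-1 :> R by field.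
rewrite /del ltr_pdivrMr; lra.
Qed.
End ComplexChar.

(** * Nonvanishing for all Dirichlet characters *)

Section DirichletChar.
Variables (R : realType) (d : nat).
Hypothesis d0 : (0 < d)%N.
Implicit Types h f : nat -> R[i].

Lemma periodic_mod h : (forall a, h (a + d)%N = h a) -> forall a, h (a %% d)%N = h a.
Proof.
move=> hp a; rewrite {2}(divn_eq a d) addnC; elim: (a %/ d)%N => [|q IH].
  by rewrite mul0n addn0.
by rewrite mulSn addnCA addnC hp.
Qed.

Lemma coprime_modn_mull_inj a i j : coprime a d ->
  (a * i = a * j %[mod d])%N -> (i = j %[mod d])%N.
Proof.
move=> ca; wlog ij : i j / (j <= i)%N.
  by move=> H; case/orP: (leq_total i j) => h e; [apply/esym|]; apply: H.
move/eqP; rewrite eqn_mod_dvd ?leq_mul // -mulnBr Gauss_dvdr 1?coprime_sym //.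
by move=> h; apply/eqP; rewrite eqn_mod_dvd.
Qed.

(** Multiplication by some a with h(a) outside {0, 1} permutes the residues and multiplies the sum
    by h(a). *)
Lemma char_sum_dichotomy h : (forall a b, h (a * b)%N = h a * h b) ->
    (forall a, h (a + d)%N = h a) -> (forall a, h a != 0 -> coprime a d) ->
  (\sum_(m < d) h m = 0) \/ forall a, h a != 0 -> h a = 1.
Proof.
move=> hM hp hc.
have [[a /andP[ha ha1]]|nex] := pselect (exists a, (h a != 0) && (h a != 1)).
  left; have ca := hc a ha.
  pose F (i : 'I_d) : 'I_d := Ordinal (ltn_pmod (a * i) d0).
  have Finj : injective F.
    move=> i j /(congr1 val) /= /(coprime_modn_mull_inj ca).
    by rewrite !modn_small // => /val_inj.
  have e : h a * (\sum_(m < d) h m) = \sum_(m < d) h m.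
    rewrite big_distrr [RHS](reindex_inj Finj) /=; apply: eq_bigr => i _.
    by rewrite periodic_mod // hM.
  apply/eqP; have /eqP := e; rewrite -subr_eq0 -[X in _ - X]mul1r -mulrBl mulf_eq0 subr_eq0.
  by rewrite (negPf ha1).
right=> a ha; apply/eqP; apply: contraPT nex => ha1; apply; by exists a; rewrite ha.
Qed.

Lemma char_partial_sum h : (forall a, h (a + d)%N = h a) -> (forall a, normc (h a) <= 1) ->
  \sum_(m < d) h m = 0 -> forall m, normc (\sum_(1 <= i < m.+1) h i) <= d%:R + 1.
Proof.
move=> hp hn hs m.
have key N : normc (\sum_(0 <= i < N) h i) <= d%:R.
  elim/ltn_ind: N => N IH; have [Nd|dN] := ltnP N d.
    apply: le_trans (normc_sum_le _ (G := fun=> 1) _) _ => //.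
    by rewrite sumr_const_nat subn0 ler_nat ltnW.
  rewrite (big_cat_nat (n := d)) //= big_mkord hs add0r -{1}[d]add0n big_addn.
  by under eq_bigr do rewrite hp; apply: IH; lia.
have := key m.+1; rewrite big_ltn // => k1.
have -> : \sum_(1 <= i < m.+1) h i = (h 0%N + \sum_(1 <= i < m.+1) h i) + - h 0%N.
  by rewrite addrC addKr.
by apply: le_trans (le_normcD _ _) _; rewrite normcN lerD.
Qed.

(* That is, L(1, f) <> 0 (or the series diverges, for principal f): for
   nonprincipal f the tails of the series are O(1/N). *)
Theorem dirichlet_nonvanishing f (C : R) :
    (forall a b, f (a * b)%N = f a * f b) -> f 1%N = 1 ->
    (forall a, f (a + d)%N = f a) -> (forall a, f a != 0 -> coprime a d) ->
    (forall a, f a = 0 \/ normc (f a) = 1) ->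
  ~ forall N, (0 < N)%N -> normc (\sum_(1 <= i < N.+1) f i / i%:R) <= C / N%:R.
Proof.
move=> fM f1 fp fc fn H.
have fn1 a : normc (f a) <= 1 by case: (fn a) => ->; rewrite ?normc0.
(* A square with vanishing period sum is the complex case; otherwise f takes only the values 0, 1
   and -1. *)
have [||a|s2|t2] := @char_sum_dichotomy (fun a => f a * f a).
- by move=> a b; rewrite fM mulrACA.
- by move=> a; rewrite fp.
- by rewrite mulf_eq0 negb_or => /andP[/fc].
  apply: (@complex_char_contradiction R f fM f1 fn (d%:R + 1) C _ H) => m _.
  apply: char_partial_sum => //.
    by move=> a; rewrite fp.
  by move=> a; rewrite normcM mulr_ile1 ?normc_ge0 ?fn1.
have f3 a : [\/ f a = 0, f a = 1 | f a = -1].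
  have [->|fa] := eqVneq (f a) 0; first by constructor 1.
  have /eqP := t2 a (mulf_neq0 fa fa); rewrite -expr2 sqrf_eq1 => /orP[]/eqP ->.
    by constructor 2.
  by constructor 3.
pose g a := complex.Re (f a).
have fg a : f a = (g a)%:C by rewrite /g; case: (f3 a) => ->; simpc.
have [s1|t1] := char_sum_dichotomy fM fp fc.
  apply: (@real_char_contradiction R g _ _ _ (d%:R + 1) C).
  - by move=> a b; apply: complexI; rewrite -fg fM !fg rmorphM.
  - by apply: complexI; rewrite -fg.
  - move=> a; case: (f3 a); rewrite /g => ->; [constructor 1|constructor 2|constructor 3] => //=.
  - move=> m m0; rewrite -normc_real rmorph_sum /=.
    under eq_bigr do rewrite -fg; exact: char_partial_sum.
  move=> m m0; apply: le_trans (H m m0); rewrite -normc_real rmorph_sum /= le_eqVlt.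
  apply/orP; left; apply/eqP; congr normc; apply: eq_bigr => i _.
  by rewrite fg rmorphM fmorphV rmorph_nat.
have g0 a : 0 <= g a.
  rewrite -ler0c -fg; have [->//|fa] := eqVneq (f a) 0; by rewrite t1.
(* For principal f all terms are nonnegative and the first one is 1, so the sums cannot tend to
   0. *)
have low N : (0 < N)%N -> 1 <= C / N%:R.
  move=> N0; apply: le_trans (H N N0).
  have -> : \sum_(1 <= i < N.+1) f i / i%:R = (\sum_(1 <= i < N.+1) g i / i%:R)%:C.
    rewrite rmorph_sum; apply: eq_bigr => i _; by rewrite fg rmorphM fmorphV rmorph_nat.
  rewrite normc_real; apply: le_trans (ler_norm _); rewrite big_ltn // /g f1 /= divr1 lerDl.
  by apply: sumr_ge0 => i _; apply: divr_ge0 (g0 i) _; rewrite ler0n.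
have := low (Num.bound C).+1 isT; rewrite ler_pdivlMr ?ltr0n // mul1r leNgt => /negP; apply.
have [C0|C0] := leP 0 C; last by apply: lt_trans C0 _; rewrite ltr0n.
by apply: lt_trans (archi_boundP C0) _; rewrite ltr_nat.
Qed.
End DirichletChar.

Local Close Scope complex_scope.

(** * The theorem of Bass and Milnor for abelian groups *)

Section UnitExponent.
Variable N : nat.
Hypothesis N1 : (1 < N)%N.

Definition uexp (k : {unit 'Z_N}) : nat := val k.

Lemma uexp_coprime k : coprime (uexp k) N.
Proof.
by rewrite coprime_sym -unitZpE // natr_Zp; apply: (valP k).
Qed.

Lemma uexpM k l : uexp (k * l)%g = ((uexp k * uexp l) %% N)%N.
Proof. exact: (congr1 (modn _) (Zp_cast N1)). Qed.

Lemma uexp1 : uexp 1%g = 1%N.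
Proof. by rewrite /uexp /= modn_small. Qed.

Lemma uexp_surj m : coprime m N -> exists k, uexp k = (m %% N)%N.
Proof.
rewrite coprime_sym -unitZpE // => mU; exists (FinRing.unit _ mU).
by rewrite /uexp /= val_Zp_nat.
Qed.

Lemma expr_uexpM (T : pzSemiRingType) (z : T) k l : z ^+ N = 1 ->
  z ^+ uexp (k * l)%g = (z ^+ uexp k) ^+ uexp l.
Proof. by move=> zN; rewrite uexpM expr_mod // exprM. Qed.

(** An arbitrary extension to algC: only the action on the N-th cyclotomic field is determined, so
    multiplicativity in k holds only there. *)
Definition cyclo_aut k : {rmorphism algC -> algC} :=
  sval (Qn_aut_exists (uexp_coprime k)).

Lemma cyclo_autE k z : z ^+ N = 1 -> cyclo_aut k z = z ^+ uexp k.
Proof. by move=> zN; rewrite /cyclo_aut; case: (Qn_aut_exists _) => u /= ->. Qed.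
End UnitExponent.

Section AutIrr.
Variables (N : nat) (N1 : (1 < N)%N) (aT : finGroupType) (A : {group aT}).
Hypotheses (cA : abelian A) (AN : (#|A| %| N)%N).
Implicit Types (i : Iirr A) (h : aT) (k l : {unit 'Z_N}).

Definition irr_act k i : Iirr A := aut_Iirr (cyclo_aut N1 k) i.

Lemma irr_linear i : 'chi[A]_i \is a linear_char.
Proof. by apply/char_abelianP. Qed.

Lemma irr_expN i h : h \in A -> 'chi[A]_i h ^+ N = 1.
Proof.
move=> hA; have /dvdnP[q ->] : (#[h]%g %| N)%N by apply: dvdn_trans AN; apply: order_dvdG.
by rewrite mulnC exprM lin_char_unity_root ?irr_linear // expr1n.
Qed.

Lemma irr_actE k i h : h \in A -> 'chi_(irr_act k i) h = 'chi_i h ^+ uexp k.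
Proof. by move=> hA; rewrite aut_IirrE cfunE cyclo_autE // irr_expN. Qed.

Lemma irr_actM k l i : irr_act (k * l)%g i = irr_act l (irr_act k i).
Proof.
by apply/irr_inj/cfun_inP => h hA; rewrite !irr_actE // expr_uexpM // irr_expN.
Qed.

Lemma irr_act_inj k : injective (irr_act k).
Proof. exact: aut_Iirr_inj. Qed.

Lemma irr_act_conj k i : irr_act k (conjC_Iirr i) = conjC_Iirr (irr_act k i).
Proof.
apply/irr_inj/cfun_inP => h hA.
by rewrite irr_actE // !conjC_IirrE !cfunE irr_actE // rmorphXn.
Qed.

Lemma sum_irr_act (T : nmodType) (F : Iirr A -> T) l i :
  \sum_k F (irr_act k (irr_act l i)) = \sum_k F (irr_act k i).
Proof.
rewrite [RHS](reindex_inj (mulgI l)); apply: eq_bigr => k _.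
by rewrite irr_actM.
Qed.
End AutIrr.

Local Open Scope complex_scope.

Section LogDistance.
Variable R : realType.
Local Notation phi := (@algC_embed R).

(** The default 0 at x = 1 matches the value 1 that a Bass unit takes there, see
    [bass_unit_root]. *)
Definition log_dist1 (x : algC) : R := if x == 1 then 0 else ln (normc (phi (1 - x))).

Lemma algC_embed_normc_conj x : normc (phi (x^*)%R) = normc (phi x).
Proof. by rewrite algC_embed_conj; case: (phi x) => a b /=; rewrite sqrrN. Qed.

Lemma log_dist1_conj x : log_dist1 (x^*)%R = log_dist1 x.
Proof.
rewrite /log_dist1 -{1}(rmorph1 (@Num.conj algC)) (inj_eq (fmorph_inj _)).
case: ifP => // _; rewrite -(rmorph1 (@Num.conj algC)) -rmorphB.
by rewrite algC_embed_normc_conj rmorph1.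
Qed.

Lemma log_series_unit_circle (z : R[i]) : normc z = 1 -> z != 1 ->
  exists K, forall N : nat,
    `|\sum_(1 <= m < N.+1) complex.Re (z ^+ m) / m%:R + ln (normc (1 - z))| <= K / N.+1%:R.
Proof.
move=> z1 zn1; have cs := normc_sqr z; rewrite z1 expr1n in cs.
pose c := complex.Re z; pose s := complex.Im z.
have zE : z = c +i* s by rewrite /c /s; case: (z).
have c_le : `|c| <= 1.
  rewrite -(@ler_sqr _ `|c| 1) ?nnegrE // real_normK ?num_real // expr1n cs.
  by rewrite lerDl sqr_ge0.
have c1 : c < 1.
  rewrite lt_neqAle (le_trans (ler_norm _) c_le) andbT; apply: contraNneq zn1 => cE.
  have s0 : s = 0.
    have : s ^+ 2 = 0 by have := cs; rewrite -/c -/s cE expr1n => h; lra.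
    by move/eqP; rewrite sqrf_eq0 => /eqP.
  by rewrite zE cE s0.
have [|||||K HK] := @log_series R c (fun m => complex.Re (z ^+ m)) c1.
- by move: c_le; rewrite ler_norml => /andP[].
- by rewrite expr0.
- by rewrite expr1.
- move=> m; have -> : z ^+ m.+2 = (2 * c)%:C * z ^+ m.+1 - z ^+ m.
    have z2 : z * z = (2 * c)%:C * z - 1.
      rewrite zE; simpc; have : c ^+ 2 + s ^+ 2 = 1 by rewrite -cs.
      by rewrite !expr2 => h; congr (_ +i* _); lra.
    by rewrite 2!exprS mulrA z2 mulrBl mul1r -mulrA.
  by case: (z ^+ m.+1) (z ^+ m) => [a b] [a' b'] /=; rewrite mul0r subr0.
- move=> m; rewrite -[leRHS](expr1n R m) -z1 -normcX.
  case: (z ^+ m) => a b /=; rewrite -(@ler_sqr _ `|a|) ?nnegrE ?sqrtr_ge0 //.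
  by rewrite real_normK ?num_real // sqr_sqrtr ?addr_ge0 ?sqr_ge0 // lerDl sqr_ge0.
exists K => N; have := HK N.
suff -> : ln (2 - 2 * c) / 2 = ln (normc (1 - z)) by [].
have n2 : normc (1 - z) ^+ 2 = 2 - 2 * c.
  rewrite normc_sqr zE /=; have : c ^+ 2 + s ^+ 2 = 1 by rewrite -cs.
  by rewrite !expr2 => h; lra.
rewrite -n2 lnXn.
  by rewrite -[ln _ *+ 2]mulr_natr mulfK ?pnatr_eq0.
rewrite lt_neqAle normc_ge0 andbT eq_sym; apply: contraNneq zn1 => /eq0_normc/eqP.
by rewrite subr_eq0 eq_sym.
Qed.
End LogDistance.

(** * Dirichlet characters from characters of the unit group modulo e *)

Section UnitsCharacters.
Variables (e : nat) (e1 : (1 < e)%N).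
Local Notation U := [set: {unit 'Z_e}]%G.

Lemma unit_Zp_abelian : abelian U.
Proof. exact: units_Zp_abelian. Qed.

Lemma units_char_lin (j : Iirr U) : 'chi_j \is a linear_char.
Proof. by apply/char_abelianP; apply: unit_Zp_abelian. Qed.

Definition residue_char (j : Iirr U) (m : nat) : algC :=
  if insub (m%:R : 'Z_e) is Some u then 'chi_j (u : {unit 'Z_e}) else 0.

Lemma residue_char_unit j m (u : {unit 'Z_e}) : (m = uexp u %[mod e])%N ->
  residue_char j m = 'chi_j u.
Proof.
move=> h; rewrite /residue_char; have -> : (m%:R : 'Z_e) = val u.
  apply: ord_inj; rewrite val_Zp_nat // h modn_small //.
  by rewrite -[X in (_ < X)%N](Zp_cast e1) ltn_ord.
by rewrite valK.
Qed.

Lemma residue_char_out j m : ~~ coprime m e -> residue_char j m = 0.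
Proof.
by move=> h; rewrite /residue_char insubF // -[RHS]/(false) unitZpE // coprime_sym (negPf h).
Qed.

Lemma coprime_unit m : coprime m e -> exists u : {unit 'Z_e}, (m = uexp u %[mod e])%N.
Proof.
by move=> /(uexp_surj e1)[u h]; exists u; rewrite h modn_mod.
Qed.

Lemma residue_charM j a b : residue_char j (a * b) = residue_char j a * residue_char j b.
Proof.
have [ca|ca] := boolP (coprime a e); last first.
  by rewrite [in LHS]residue_char_out ?[residue_char j a]residue_char_out ?mul0r // coprimeMl (negPf ca).
have [cb|cb] := boolP (coprime b e); last first.
  by rewrite [in LHS]residue_char_out ?[residue_char j b]residue_char_out ?mulr0 // coprimeMl (negPf cb) andbF.
have [u hu] := coprime_unit ca; have [v hv] := coprime_unit cb.
rewrite (residue_char_unit j hu) (residue_char_unit j hv).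
rewrite -lin_charM ?finset.in_setT ?units_char_lin //; apply: residue_char_unit.
by rewrite uexpM // modn_mod -modnMm hu hv modnMm.
Qed.

Lemma residue_char1 j : residue_char j 1 = 1.
Proof.
by rewrite (@residue_char_unit j 1 1%g) ?lin_char1 ?units_char_lin //.
Qed.

Lemma residue_char_periodic j a : residue_char j (a + e) = residue_char j a.
Proof.
rewrite /residue_char natrD; suff -> : (e%:R : 'Z_e) = 0 by rewrite addr0.
by apply: ord_inj; rewrite val_Zp_nat // modnn.
Qed.

Lemma residue_char_norm (R : realType) j a :
  algC_embed R (residue_char j a) = 0 \/ normc (algC_embed R (residue_char j a)) = 1.
Proof.
have [ca|ca] := boolP (coprime a e); last by left; rewrite residue_char_out // rmorph0.
right; have [u hu] := coprime_unit ca; rewrite (residue_char_unit j hu).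
have h := lin_char_unity_root (units_char_lin j) (finset.in_setT u).
have : normc (algC_embed R ('chi_j u)) ^+ #[u]%g = 1.
  by rewrite -normcX -rmorphXn h rmorph1 normc1.
by move/eqP; rewrite pexprn_eq1 ?normc_ge0 // -leqn0 leqNgt order_gt0 => /eqP.
Qed.
End UnitsCharacters.

Section BassMilnor.
Variables (R : realType) (N : nat) (N1 : (1 < N)%N) (aT : finGroupType) (A : {group aT}).
Hypotheses (cA : abelian A) (AN : (#|A| %| N)%N).
Local Notation phi := (@algC_embed R).
Local Notation act := (@irr_act N N1 aT A).
Implicit Types (lam g : Iirr A -> R) (h : aT).

Section Vanishing.
Variable lam : Iirr A -> R.
Hypothesis lam_even : forall i, lam (conjC_Iirr i) = lam i.
Hypothesis lam_sum0 : forall i, \sum_k lam (act k i) = 0.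
Hypothesis lam_log : forall h, h \in A -> \sum_i lam i * log_dist1 R ('chi_i h) = 0.

Let F h : R[i] := \sum_i (lam i)%:C * phi ('chi_i h).

(** The condition chi_i(h) = 1 is Galois-stable, so the sum is an average of vanishing orbit sums.
    It removes the harmonic series that these characters would contribute. *)
Lemma fixed_sum0 h : h \in A -> \sum_(i | 'chi_i h == 1) lam i = 0.
Proof.
move=> hA; pose n := #|{: {unit 'Z_N}}|.
have n0 : n%:R != 0 :> R by rewrite pnatr_eq0 -lt0n; apply/card_gt0P; exists 1%g.
apply: (mulfI n0); rewrite mulr0 mulr_natl -sumr_const.
transitivity (\sum_k \sum_(i | 'chi[A]_i h == 1) lam (act k i)).
  apply: eq_bigr => k _; rewrite (reindex_inj (@irr_act_inj _ N1 _ A k)) /=.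
  apply: eq_bigl => i; rewrite irr_actE //; apply/eqP/eqP => [e|->]; last by rewrite expr1n.
  have := congr1 (fun x => x ^+ uexp k^-1%g) e; rewrite expr1n -expr_uexpM ?(irr_expN cA AN) //.
  by rewrite mulgV uexp1 expr1.
by rewrite exchange_big big1 // => i _; apply: lam_sum0.
Qed.

Lemma irr_embed_norm (i : Iirr A) h : h \in A -> normc (phi ('chi_i h)) = 1.
Proof.
move=> hA; have : normc (phi ('chi_i h)) ^+ N = 1.
  by rewrite -normcX -rmorphXn irr_expN // rmorph1 normc1.
by move/eqP; rewrite pexprn_eq1 ?normc_ge0 // -leqn0 leqNgt (ltnW N1) => /eqP.
Qed.

(** F is invariant under complex conjugation because lam is even; the logarithmic series controls
    real parts only. *)
Lemma dual_real h m : h \in A ->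
  F (h ^+ m)%g = (\sum_i lam i * complex.Re (phi ('chi_i h) ^+ m))%:C.
Proof.
move=> hA; have e : F (h ^+ m)%g = \sum_i (lam i)%:C * (phi ('chi_i h) ^+ m).
  by apply: eq_bigr => i _; rewrite lin_charX ?irr_linear // rmorphXn.
have e2 : F (h ^+ m)%g = ((F (h ^+ m)%g)^*)%C.
  rewrite {2}e rmorph_sum /= e (reindex_inj (can_inj conjC_IirrK)).
  apply: eq_bigr => i _; rewrite lam_even conjC_IirrE cfunE algC_embed_conj.
  by rewrite rmorphM rmorphXn /= oppr0.
have {e2} -> : F (h ^+ m)%g = (complex.Re (F (h ^+ m)%g))%:C.
  move: e2; case: (F _) => a b /= [] /eqP; rewrite -subr_eq0 opprK -mulr2n mulrn_eq0 /=.
  by move/eqP ->.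
congr (_%:C); rewrite e raddf_sum; apply: eq_bigr => i _.
by case: (phi _ ^+ m) => a b /=; rewrite mul0r subr0.
Qed.

(** For chi_i(h) other than 1 the truncated series of Re(chi_i(h)^m) / m is -ln |1 - chi_i(h)| up to
    O(1/M), and these logarithms cancel by [lam_log]; the other characters cancel by
    [fixed_sum0]. *)
Lemma dual_series_bound h : h \in A -> exists K, forall M, (0 < M)%N ->
  normc (\sum_(1 <= m < M.+1) F (h ^+ m)%g / m%:R) <= K / M%:R.
Proof.
move=> hA; pose z (i : Iirr A) := phi ('chi_i h).
have zE i : (z i == 1) = ('chi_i h == 1) by rewrite /z fmorph_eq1.
have /fin_all_exists[K HK] i : exists k : R, z i != 1 -> forall M : nat,
    `|\sum_(1 <= m < M.+1) complex.Re (z i ^+ m) / m%:R + ln (normc (1 - z i))|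
      <= k / M.+1%:R.
  have [->|zi] := eqVneq (z i) 1; first by exists 0.
  by have [k Hk] := log_series_unit_circle (irr_embed_norm i hA) zi; exists k.
exists (\sum_(i | z i != 1) `|lam i| * K i) => M M0.
have -> : \sum_(1 <= m < M.+1) F (h ^+ m)%g / m%:R =
   (\sum_(i | z i != 1) lam i * (\sum_(1 <= m < M.+1) complex.Re (z i ^+ m) / m%:R
       + ln (normc (1 - z i))))%:C.
  under eq_bigr do rewrite dual_real // -[_%:R](rmorph_nat (real_complex R)) -fmorphV -rmorphM.
  rewrite -rmorph_sum /=; congr (_%:C).
  transitivity (\sum_i lam i * (\sum_(1 <= m < M.+1) complex.Re (z i ^+ m) / m%:R)).
    under eq_bigr do rewrite big_distrl /=.
    rewrite exchange_big; apply: eq_bigr => i _; rewrite big_distrr /=.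
    by apply: eq_bigr => m _; rewrite mulrA.
  rewrite (bigID (fun i => z i == 1)) /=.
  have -> : \sum_(i | z i == 1) lam i * (\sum_(1 <= m < M.+1) complex.Re (z i ^+ m) / m%:R) = 0.
    rewrite (eq_bigr (fun i => lam i * \sum_(1 <= m < M.+1) m%:R^-1)) => [|i /eqP ->].
      by rewrite -big_distrl /= (eq_bigl _ _ zE) fixed_sum0 // mul0r.
    by congr (_ * _); apply: eq_bigr => m _; rewrite expr1n mul1r.
  rewrite add0r; under [RHS]eq_bigr do rewrite mulrDr.
  rewrite big_split /= -[LHS]addr0; congr (_ + _); symmetry.
  have := lam_log hA; rewrite (bigID (fun i => z i == 1)) /= big1 ?add0r => [e|i].
    rewrite -[RHS]e; apply: eq_bigr => i; rewrite zE /log_dist1 => /negPf ->.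
    by rewrite rmorphB rmorph1.
  by rewrite zE /log_dist1 => ->; rewrite mulr0.
rewrite normc_real big_distrl /=; apply: le_trans (ler_norm_sum _ _ _) _.
apply: ler_sum => i zi; rewrite normrM -mulrA ler_wpM2l //.
apply: le_trans (HK i zi M) _.
have K0 : 0 <= K i by have := HK i zi 0%N; rewrite divr1; apply: le_trans.
by rewrite ler_wpM2l // lef_pV2 ?posrE ?ltr0n // ler_nat.
Qed.

Lemma scaled_dirichlet_eq0 d (f : nat -> R[i]) (c : R[i]) (K : R) : (0 < d)%N ->
    (forall a b, f (a * b)%N = f a * f b) -> f 1%N = 1 ->
    (forall a, f (a + d)%N = f a) -> (forall a, f a != 0 -> coprime a d) ->
    (forall a, f a = 0 \/ normc (f a) = 1) ->
    (forall M, (0 < M)%N -> normc (\sum_(1 <= m < M.+1) c * f m / m%:R) <= K / M%:R) ->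
  c = 0.
Proof.
move=> d0 fM f1 fp fc fn H; apply/eqP; apply: contraT => c0.
case: (@dirichlet_nonvanishing R d d0 f (K / normc c) fM f1 fp fc fn) => M M0.
have nc : 0 < normc c.
  by rewrite lt_neqAle normc_ge0 andbT eq_sym; apply: contraNneq c0 => /eq0_normc ->.
rewrite mulrAC ler_pdivlMr // mulrC -normcM big_distrr /=.
by under eq_bigr do rewrite mulrA; apply: H.
Qed.

(* Induction on the order e of h: when the values of F on the proper powers
   h ^+ m, gcd (m, e) > 1, vanish, the twisted averages of m |-> F (h ^+ m)
   over the units modulo e are multiples of Dirichlet characters. *)
Lemma dual_eq0 h : h \in A -> F h = 0.
Proof.
have [n] := ubnP #[h]%g; elim: n h => // n IH h; rewrite ltnS => hn hA.
set e := #[h]%g in hn.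
have [e1|] := ltnP 1 e; last first.
  rewrite leq_eqVlt ltnS leqn0 (negPf (lt0n_neq0 (order_gt0 h))) orbF.
  (* For h = 1 the function m |-> F(h^m) is constant, a multiple of the principal character modulo
     1. *)
  rewrite order_eq1 => /eqP h1; have [K HK] := dual_series_bound hA.
  apply: (@scaled_dirichlet_eq0 1 (fun=> 1) _ K) => //.
  - by move=> a b; rewrite mulr1.
  - by move=> a _; rewrite coprimen1.
  - by move=> a; right; rewrite normc1.
  move=> M /HK; rewrite h1; under eq_bigr do rewrite expg1n.
  by under [X in _ -> normc X <= _]eq_bigr do rewrite mulr1.
pose U := [set: {unit 'Z_e}]%G.
pose c (j : Iirr U) : R[i] := \sum_k phi ('chi_j k^-1%g) * F (h ^+ uexp k)%g.
have cE j m : \sum_k phi ('chi_j k^-1%g) * F (h ^+ (uexp k * m))%g = c j * phi (residue_char j m).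
  have [cm|cm] := boolP (coprime m e); last first.
    rewrite residue_char_out // rmorph0 mulr0 big1 // => k _.
    suff -> : F (h ^+ (uexp k * m))%g = 0 by rewrite mulr0.
    apply: IH; last by rewrite groupX.
    apply: leq_trans hn; rewrite orderXgcd -/e ltn_Pdiv ?order_gt0 //.
    have : (0 < gcdn e (uexp k * m))%N by rewrite gcdn_gt0 order_gt0.
    rewrite leq_eqVlt eq_sym => /orP[|//] => /eqP g1.
    have : coprime e (uexp k * m) by rewrite /coprime g1.
    by rewrite coprimeMr [coprime e m]coprime_sym (negPf cm) andbF.
  have [u hu] := coprime_unit e1 cm.
  rewrite (residue_char_unit e1 j hu) /c big_distrl /= [RHS](reindex_inj (mulIg u)) /=.
  apply: eq_bigr => k _; rewrite mulrAC -rmorphM /= -lin_charM ?finset.in_setT ?units_char_lin //.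
  have kuC : (k * u = u * k)%g.
    by apply: (centsP (units_Zp_abelian e)); rewrite finset.in_setT.
  congr (phi ('chi_j _) * F _); first by rewrite kuC invMg mulgKV.
  by apply/eqP; rewrite eq_expg_mod_order uexpM // modn_mod -modnMmr hu modnMmr.
have c0 j : c j = 0.
  have /fin_all_exists[K HK] (k : {unit 'Z_e}) : exists K : R, forall M, (0 < M)%N ->
      normc (\sum_(1 <= m < M.+1) F ((h ^+ uexp k) ^+ m)%g / m%:R) <= K / M%:R.
    by apply: dual_series_bound; rewrite groupX.
  apply: (@scaled_dirichlet_eq0 e (phi \o residue_char j) _
     (\sum_k normc (phi ('chi_j k^-1%g)) * K k)).
  - exact: ltnW.
  - by move=> a b; rewrite /= residue_charM // rmorphM.
  - by rewrite /= residue_char1 // rmorph1.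
  - by move=> a; rewrite /= residue_char_periodic.
  - by move=> a; apply: contraNT => ca /=; rewrite residue_char_out // rmorph0.
  - by move=> a; apply: residue_char_norm.
  move=> M M0; under eq_bigr do rewrite /= -cE big_distrl /=.
  rewrite exchange_big big_distrl /=; apply: normc_sum_le => k _.
  have -> : \sum_(1 <= m < M.+1) phi ('chi_j k^-1%g) * F (h ^+ (uexp k * m))%g / m%:R
     = phi ('chi_j k^-1%g) * \sum_(1 <= m < M.+1) F ((h ^+ uexp k) ^+ m)%g / m%:R.
    by rewrite big_distrr /=; apply: eq_bigr => m _; rewrite -expgM mulrA.
  by rewrite normcM -mulrA ler_wpM2l ?normc_ge0 // HK.
(* Summing over all characters of the unit group isolates k = 1, hence F(h) itself. *)
have : \sum_j c j = #|U|%:R * F h.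
  rewrite exchange_big /= (bigD1 1%g) //= uexp1 // expg1.
  have sumE (k : {unit 'Z_e}) : \sum_(j : Iirr U) phi ('chi_j k) = phi (cfReg U k).
    rewrite cfReg_sum sum_cfunE rmorph_sum; apply: eq_bigr => j _.
    by rewrite cfunE lin_char1 ?mul1r // units_char_lin.
  rewrite -big_distrl /= sumE invg1 cfRegE eqxx mulr1n rmorph_nat big1 ?addr0 // => k k1.
  by rewrite -big_distrl /= sumE cfRegE invg_eq1 (negPf k1) mulr0n rmorph0 mul0r.
rewrite big1 => [/esym/eqP|j _]; last exact: c0.
rewrite mulf_eq0 pnatr_eq0 => /orP[|/eqP //].
by rewrite -leqn0 leqNgt cardG_gt0.
Qed.

Lemma lam_eq0 i : lam i = 0.
Proof.
have : \sum_(h in A) F h * phi ('chi_i h^-1%g) = #|A|%:R * (lam i)%:C.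
  transitivity (\sum_j (lam j)%:C * phi (\sum_(h in A) 'chi_j h * 'chi_i h^-1%g)).
    under [RHS]eq_bigr do rewrite rmorph_sum big_distrr /=.
    rewrite exchange_big; apply: eq_bigr => h _; rewrite big_distrl /=.
    by apply: eq_bigr => j _; rewrite rmorphM mulrA.
  have orth j : \sum_(h in A) 'chi_j h * 'chi_i h^-1%g = #|A|%:R * (j == i)%:R.
    by rewrite -first_orthogonality_relation mulVKf // neq0CG.
  rewrite (bigD1 i) //= orth eqxx mulr1 rmorph_nat mulrC big1 ?addr0 // => j ji.
  by rewrite orth (negPf ji) mulr0 rmorph0 mulr0.
rewrite big1 => [/esym/eqP|h hA]; last by rewrite dual_eq0 // mul0r.
rewrite mulf_eq0 pnatr_eq0 -leqn0 leqNgt cardG_gt0 /= => /eqP h.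
by apply: (complexI (R := R)).
Qed.
End Vanishing.

(** The even part of lam, freed of its Galois averages, satisfies the hypotheses of [lam_eq0] and so
    vanishes. Thus lam is the sum of an odd form and of one constant on Galois orbits, and g is
    orthogonal to both. *)
Theorem bass_milnor_dual lam g :
    (forall h (k : {unit 'Z_N}), h \in A ->
       \sum_i lam i * (log_dist1 R ('chi_i h ^+ uexp k) - log_dist1 R ('chi_i h)) = 0) ->
    (forall i, g (conjC_Iirr i) = g i) ->
    (forall i, \sum_k g (act k i) = 0) ->
  \sum_i lam i * g i = 0.
Proof.
move=> lamb ge gs.
pose n := #|{: {unit 'Z_N}}|%:R : R.
have n0 : n != 0 by rewrite pnatr_eq0 -lt0n; apply/card_gt0P; exists 1%g.
pose s i := lam i + lam (conjC_Iirr i).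
pose lam' i := n * s i - \sum_k s (act k i).
have se i : s (conjC_Iirr i) = s i by rewrite /s conjC_IirrK addrC.
have sb h (k : {unit 'Z_N}) : h \in A ->
    \sum_i s i * log_dist1 R ('chi_i h ^+ uexp k) = \sum_i s i * log_dist1 R ('chi_i h).
  move=> hA; apply/eqP; rewrite -subr_eq0 -sumrB; apply/eqP.
  pose D i := log_dist1 R ('chi[A]_i h ^+ uexp k) - log_dist1 R ('chi[A]_i h).
  transitivity (\sum_i lam i * D i + \sum_i lam (conjC_Iirr i) * D i).
    by rewrite -big_split /=; apply: eq_bigr => i _; rewrite -mulrBr -mulrDl.
  have lD : \sum_i lam i * D i = 0 := lamb h k hA.
  rewrite lD add0r (reindex_inj (can_inj conjC_IirrK)) /= -[RHS]lD.
  apply: eq_bigr => i _; rewrite conjC_IirrK /D conjC_IirrE cfunE.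
  by rewrite -rmorphXn !log_dist1_conj.
have lam'0 i : lam' i = 0.
  apply: lam_eq0 => {i} [i|i|h hA].
  - rewrite /lam' se; congr (_ - _); apply: eq_bigr => k _.
    by rewrite irr_act_conj // se.
  - rewrite sumrB -big_distrr /=; under [X in _ - X]eq_bigr do rewrite sum_irr_act //.
    by rewrite sumr_const -[_ *+ _]mulr_natl subrr.
  rewrite /lam'; under eq_bigr do rewrite mulrBl -mulrA.
  rewrite sumrB -big_distrr /=; under [X in _ - X]eq_bigr do rewrite big_distrl /=.
  rewrite exchange_big /= [X in _ - X](eq_bigr (fun=> \sum_i s i * log_dist1 R ('chi_i h))) => [|k _].
    by rewrite sumr_const -[_ *+ _]mulr_natl subrr.
  rewrite -(sb h k^-1%g) // [RHS](reindex_inj (@irr_act_inj _ N1 _ A k)) /=.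
  apply: eq_bigr => i _; congr (_ * log_dist1 _ _).
  by rewrite irr_actE // -expr_uexpM ?(irr_expN cA AN) // mulgV uexp1 // expr1.
have sg : \sum_i s i * g i = 0.
  apply: (mulfI n0); rewrite mulr0 big_distrr /=.
  transitivity (\sum_i \sum_k s (act k i) * g i).
    apply: eq_bigr => i _; rewrite mulrA -big_distrl /=; congr (_ * _).
    by apply/eqP; rewrite -subr_eq0; apply/eqP/lam'0.
  rewrite exchange_big /=.
  transitivity (\sum_k \sum_i s i * g (act k^-1%g i)).
    apply: eq_bigr => k _; rewrite [RHS](reindex_inj (@irr_act_inj _ N1 _ A k)) /=.
    apply: eq_bigr => i _; rewrite -irr_actM // mulgV; congr (_ * g _).
    by apply/irr_inj/cfun_inP => h hA; rewrite irr_actE // uexp1 // expr1.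
  rewrite exchange_big big1 //= => i _; rewrite -big_distrr /=.
  rewrite (reindex_inj invg_inj) /=; under eq_bigr do rewrite invgK.
  by rewrite gs mulr0.
have : \sum_i s i * g i = 2 * \sum_i lam i * g i.
  rewrite /s; under eq_bigr do rewrite mulrDl.
  rewrite big_split /= mulr_natl mulr2n; congr (_ + _).
  rewrite (reindex_inj (can_inj conjC_IirrK)) /=; apply: eq_bigr => i _.
  by rewrite conjC_IirrK ge.
by rewrite sg => /esym/eqP; rewrite mulf_eq0 pnatr_eq0 => /eqP.
Qed.
End BassMilnor.

Local Close Scope complex_scope.

(** * Lattices of logarithms *)

Section LatticeIndex.
Variables (R : realType) (T : pzRingType) (Z A : set T) (I : finType) (l : T -> I -> R).
Hypothesis ZM : forall x y, Z x -> Z y -> Z (x * y).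
Hypothesis AZ : (A `<=` Z)%classic.
Hypothesis A1 : A 1.
Hypothesis AM : forall x y, A x -> A y -> A (x * y).
Hypothesis AV : forall x, A x -> exists2 y, A y & x * y = 1.
Hypothesis lM : forall x y i, Z x -> Z y -> l (x * y) i = l x i + l y i.
Hypothesis lfin : forall B : R, finite_set [set z | Z z /\ forall i, `|l z i| <= B]%classic.
Hypothesis ldual : forall lam : I -> R, (forall a, A a -> \sum_i lam i * l a i = 0) ->
  forall z, Z z -> \sum_i lam i * l z i = 0.

Let row_of z : 'rV[R]_#|I| := \row_j l z (enum_val j).
Let mat_of m (a : 'I_m -> T) : 'M[R]_(m, #|I|) := \matrix_i row_of (a i).

Lemma max_rank_family : exists m (a : 'I_m -> T), (forall i, A (a i)) /\
  forall b, A b -> (row_of b <= mat_of a)%MS.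
Proof.
pose P k := `[< exists m (a : 'I_m -> T), (forall i, A (a i)) /\ \rank (mat_of a) = k >].
have P0 : exists k, P k.
  exists (\rank (@mat_of 0 (fun=> 1))); apply/asboolP; exists 0%N, (fun=> 1); split=> //.
have Pb k : P k -> (k <= #|I|)%N.
  by move=> /asboolP[m [a [_ <-]]]; apply: rank_leq_col.
have [k /asboolP[m [a [aA rk]]] kmax] := ex_maxnP P0 Pb.
exists m, a; split=> // b bA.
pose a' : 'I_(m + 1) -> T := fun i => match split i with inl j => a j | inr _ => b end.
have a'E : mat_of a' = col_mx (mat_of a) (row_of b).
  apply/row_matrixP => i; rewrite rowK /a'; case: splitP => j ij.
    have -> : i = lshift 1 j by apply: val_inj.
    by rewrite rowKu rowK.
  have -> : i = rshift m j by apply: val_inj.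
  rewrite rowKd row_id //.
have a'A i : A (a' i) by rewrite /a'; case: splitP.
have r' : (\rank (mat_of a') <= k)%N.
  by apply: kmax; apply/asboolP; exists (m + 1)%N, a'.
have sub : (mat_of a <= mat_of a')%MS by rewrite a'E -addsmxE addsmxSl.
have sup : (mat_of a' <= mat_of a)%MS.
  by rewrite -(geq_leqif (mxrank_leqif_sup sub)) rk.
by apply: submx_trans sup; rewrite a'E -addsmxE addsmxSr.
Qed.

Lemma integer_combination m (a : 'I_m -> T) (c : 'I_m -> int) : (forall i, A (a i)) ->
  exists2 b, A b & forall j, l b j = \sum_i (c i)%:~R * l (a i) j.
Proof.
move=> aA; pose S (f : I -> R) := exists2 b, A b & forall j, l b j = f j.
have l1 j : l 1 j = 0.
  have := @lM 1 1 j (AZ A1) (AZ A1); rewrite mulr1 => h; lra.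
have S0 : S (fun=> 0) by exists 1.
have SD f g : S f -> S g -> S (fun j => f j + g j).
  move=> [x xA xf] [y yA yg]; exists (x * y); first exact: AM.
  by move=> j; rewrite lM ?xf ?yg //; apply: AZ.
have SN f : S f -> S (fun j => - f j).
  move=> [x xA xf]; have [y yA xy] := AV xA; exists y => // j.
  have := @lM x y j (AZ xA) (AZ yA); rewrite xy l1 xf => h; lra.
have SZ f (k : int) : S f -> S (fun j => k%:~R * f j).
  move=> Sf; have Sn (n : nat) : S (fun j => n%:R * f j).
    elim: n => [|n IH]; first by under [fun _ => _ * _]boolp.funext do rewrite mul0r.
    under [fun _ => _ * _]boolp.funext do rewrite -natr1 mulrDl mul1r.
    exact: SD.
  case: k => n; first exact: Sn.
  under [fun _ => _ * _]boolp.funext do rewrite NegzE mulrNz mulNr.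
  exact/SN/Sn.
have Ssum (r : seq 'I_m) : S (fun j => \sum_(i <- r) (c i)%:~R * l (a i) j).
  elim: r => [|i r IH]; first by under [fun _ => \sum_(_ <- _) _]boolp.funext do rewrite big_nil.
  under [fun _ => \sum_(_ <- _) _]boolp.funext do rewrite big_cons.
  by apply: SD => //; apply: SZ; exists (a i).
exact: Ssum.
Qed.

(** A family of maximal rank in A spans the logarithms of all of Z: apply [ldual] to the columns of
    a cokernel matrix. Subtracting the integer parts of the coordinates leaves a bounded vector, and
    by [lfin] only finitely many elements have one. *)
Theorem lattice_finite_index :
  exists2 F : set T, finite_set F & forall z, Z z -> exists2 a, A a & F (z * a).
Proof.
have [m [a [aA amax]]] := max_rank_family.
pose B := \sum_(i < m) \sum_(j < #|I|) `|mat_of a i j|.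
exists [set z | Z z /\ forall i, `|l z i| <= B]%classic; first exact: lfin.
move=> z Zz.
have : (row_of z <= mat_of a)%MS.
  rewrite submxE; apply/eqP/rowP => j; rewrite [RHS]mxE.
  pose lam i := cokermx (mat_of a) (enum_rank i) j.
  have rE y : (row_of y *m cokermx (mat_of a)) 0 j = \sum_i lam i * l y i.
    rewrite mxE [RHS](reindex (@enum_val I predT)) /=; last first.
      by exists enum_rank => x _; [apply: enum_valK | apply: enum_rankK].
    by apply: eq_bigr => i _; rewrite mxE mulrC /lam enum_valK.
  rewrite rE; apply: ldual => // b bA; rewrite -rE.
  by have := amax b bA; rewrite submxE => /eqP ->; rewrite mxE.
move/submxP => [x xE].
have [b bA bl] := @integer_combination m a (fun i => - Num.floor (x 0 i)) aA.
exists b => //; split; first by apply: ZM => //; apply: AZ.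
move=> i; rewrite lM //; last exact: AZ.
have -> : l z i = \sum_k x 0 k * l (a k) i.
  have := congr1 (fun M : 'rV_#|I| => M 0 (enum_rank i)) xE.
  rewrite !mxE enum_rankK => ->; apply: eq_bigr => k _.
  by rewrite !mxE enum_rankK.
rewrite bl -big_split /=; apply: le_trans (ler_norm_sum _ _ _) _.
apply: ler_sum => k _; rewrite -mulrDl normrM.
apply: (@le_trans _ _ `|l (a k) i|).
  rewrite ler_piMl // rmorphN ler_norml.
  have /andP[h1 h2] := floor_itv (x 0 k).
  by move: h2; rewrite intrD => h2; apply/andP; split; lra.
rewrite (bigD1 (enum_rank i)) //= !mxE enum_rankK lerDl.
by apply: sumr_ge0.
Qed.
End LatticeIndex.

(** * The rational group ring *)

Section GroupRing.
Variables (gT : finGroupType) (G : {group gT}).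
Local Notation gmx := 'M[rat]_#|G|.
Local Notation gelt := (@gelt gT G).
Local Notation hat := (@hat gT G).
Implicit Types (a b : gmx) (g h x y : gT) (H M K : {group gT}).

Lemma gscaleAl (q : rat) a b : (q *: a) * b = q *: (a * b).
Proof. by rewrite -[LHS]/((q *: a) *m b) -scalemxAl. Qed.

Lemma gscaleAr (q : rat) a b : a * (q *: b) = q *: (a * b).
Proof. by rewrite -[LHS]/(a *m (q *: b)) -scalemxAr. Qed.

Lemma gelt1 : gelt 1%g = 1.
Proof. exact: repr_mx1. Qed.

Lemma geltM g h : g \in G -> h \in G -> gelt (g * h)%g = gelt g * gelt h.
Proof. exact: repr_mxM. Qed.

Lemma geltVM g : g \in G -> gelt g^-1%g * gelt g = 1.
Proof. by move=> gG; rewrite -geltM ?groupV // mulVg gelt1. Qed.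

Lemma geltMV g : g \in G -> gelt g * gelt g^-1%g = 1.
Proof. by move=> gG; rewrite -geltM ?groupV // mulgV gelt1. Qed.

(* The coefficient of g in a: the entry of the regular representation in the
   row of the identity and the column of g. *)
Definition co a g : rat := a (gring_index G 1%g) (gring_index G g).

Lemma coD a b g : co (a + b) g = co a g + co b g. Proof. by rewrite /co mxE. Qed.
Lemma coN a g : co (- a) g = - co a g. Proof. by rewrite /co mxE. Qed.
Lemma co0 g : co 0 g = 0. Proof. by rewrite /co mxE. Qed.
Lemma coZ q a g : co (q *: a) g = q * co a g. Proof. by rewrite /co mxE. Qed.
Lemma co_sum (I : Type) (r : seq I) (P : pred I) (F : I -> gmx) g :
  co (\sum_(i <- r | P i) F i) g = \sum_(i <- r | P i) co (F i) g.
Proof. by rewrite /co summxE. Qed.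

Lemma co_gelt x g : x \in G -> g \in G -> co (gelt x) g = (x == g)%:R.
Proof.
move=> xG gG; rewrite /co /gelt /= mxE /= gring_indexK ?group1 // mul1g.
by rewrite mxE eqxx (inj_in_eq (can_in_inj (@gring_indexK _ G))) // eq_sym //.
Qed.

Lemma co_lin H (c : gT -> rat) g : H \subset G -> g \in G ->
  co (\sum_(h in H) c h *: gelt h) g = if g \in H then c g else 0.
Proof.
move=> sHG gG; rewrite co_sum.
transitivity (\sum_(h in H) c h * (h == g)%:R).
  by apply: eq_bigr => h hH; rewrite coZ co_gelt // (subsetP sHG).
case: ifP => gH.
  rewrite (bigD1 g) //= eqxx mulr1 big1 ?addr0 // => h /andP[_ /negPf ->].
  by rewrite mulr0.
rewrite big1 // => h hH; have [e|_] := eqVneq h g; last by rewrite mulr0.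
by rewrite -e hH in gH.
Qed.

Definition span_of H a := exists c : gT -> rat, a = \sum_(h in H) c h *: gelt h.

Lemma span_ofE H a : H \subset G -> span_of H a -> a = \sum_(h in H) co a h *: gelt h.
Proof.
move=> sHG [c aE]; rewrite [LHS]aE; apply: eq_bigr => h hH; congr (_ *: _).
by rewrite aE co_lin ?(subsetP sHG) // hH.
Qed.

Lemma span_of0 H : span_of H 0.
Proof. by exists (fun=> 0); rewrite big1 // => h _; rewrite scale0r. Qed.

Lemma span_ofD H a b : span_of H a -> span_of H b -> span_of H (a + b).
Proof.
move=> [c ->] [d ->]; exists (fun h => c h + d h); rewrite -big_split.
by apply: eq_bigr => h _; rewrite scalerDl.
Qed.

Lemma span_ofZ H q a : span_of H a -> span_of H (q *: a).
Proof.
move=> [c ->]; exists (fun h => q * c h); rewrite scaler_sumr.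
by apply: eq_bigr => h _; rewrite scalerA.
Qed.

Lemma span_ofN H a : span_of H a -> span_of H (- a).
Proof. by rewrite -scaleN1r; apply: span_ofZ. Qed.

Lemma span_ofB H a b : span_of H a -> span_of H b -> span_of H (a - b).
Proof. by move=> ha hb; apply: span_ofD => //; apply: span_ofN. Qed.

Lemma span_of_sum H (I : Type) (r : seq I) (P : pred I) (F : I -> gmx) :
  (forall i, P i -> span_of H (F i)) -> span_of H (\sum_(i <- r | P i) F i).
Proof.
move=> hF; elim/big_ind: _ => //; first exact: span_of0.
exact: span_ofD.
Qed.

Lemma span_of_gelt H h : h \in H -> span_of H (gelt h).
Proof.
move=> hH; exists (fun g => (g == h)%:R); rewrite (bigD1 h) //= eqxx scale1r.
by rewrite big1 ?addr0 // => g /andP[_ /negPf ->]; rewrite scale0r.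
Qed.

Lemma span_of1 H : span_of H 1.
Proof. by rewrite -gelt1; apply: span_of_gelt. Qed.

Lemma span_ofM H a b : H \subset G -> span_of H a -> span_of H b -> span_of H (a * b).
Proof.
move=> sHG [c ->] [d ->]; rewrite big_distrl; apply: span_of_sum => h hH.
rewrite big_distrr; apply: span_of_sum => k kH /=.
rewrite gscaleAl gscaleAr; do 2!apply: span_ofZ.
by rewrite -geltM ?(subsetP sHG) //; apply: span_of_gelt; rewrite groupM.
Qed.

Lemma span_ofX H a n : H \subset G -> span_of H a -> span_of H (a ^+ n).
Proof.
move=> sHG ha; elim: n => [|n IH]; first exact: span_of1.
by rewrite exprS; apply: span_ofM.
Qed.

Lemma span_ofS H M a : M \subset H -> span_of M a -> span_of H a.
Proof.
move=> sMH [c ->]; apply: span_of_sum => h hM.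
by apply/span_ofZ/span_of_gelt/(subsetP sMH).
Qed.

Lemma span_of_hat H M : M \subset H -> span_of H (hat M).
Proof.
move=> sMH; apply: span_ofZ; apply: span_of_sum => x xM.
by apply: span_of_gelt; apply: (subsetP sMH).
Qed.

Lemma span_of_prod H (I : Type) (r : seq I) (P : pred I) (F : I -> gmx) : H \subset G ->
  (forall i, P i -> span_of H (F i)) -> span_of H (\prod_(i <- r | P i) F i).
Proof.
move=> sHG hF; elim/big_ind: _ => //; first exact: span_of1.
by move=> a b; apply: span_ofM.
Qed.

Lemma co_geltM y a g : y \in G -> g \in G -> span_of G a ->
  co (gelt y * a) g = co a (y^-1 * g)%g.
Proof.
move=> yG gG aS; rewrite {1}(span_ofE (subxx _) aS) big_distrr /=.
rewrite (eq_bigr (fun h => co a h *: gelt (y * h)%g)) => [|h hG]; last first.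
  by rewrite gscaleAr geltM.
rewrite (reindex_inj (mulgI y^-1%g)) /=.
rewrite (eq_big (fun h => h \in G) (fun h => co a (y^-1 * h)%g *: gelt h)) => [|h|h _].
- by rewrite (co_lin (fun h => co a (y^-1 * h)%g)) // gG.
- by rewrite groupMl ?groupV.
by rewrite mulKVg.
Qed.

Lemma hat_geltl M x : M \subset G -> x \in M -> gelt x * hat M = hat M.
Proof.
move=> sMG xM; rewrite /hat gscaleAr; congr (_ *: _); rewrite /gset_mx big_distrr /=.
rewrite [RHS](reindex_inj (mulgI x)) /=; apply: eq_big => y; first by rewrite groupMl.
by move=> yM; apply/esym/geltM; apply: (subsetP sMG).
Qed.

Lemma hat_absorbl M a : M \subset G ->
  (forall x, x \in M -> gelt x * a = a) -> hat M * a = a.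
Proof.
move=> sMG ha; rewrite /hat gscaleAl /gset_mx big_distrl /=.
rewrite (eq_bigr (fun=> a)) => [|x xM]; last exact: ha.
by rewrite sumr_const -scaler_nat scalerA mulVf ?scale1r // pnatr_eq0 -lt0n cardG_gt0.
Qed.

Lemma hat_mul_sub M K : K \subset M -> M \subset G -> hat K * hat M = hat M.
Proof.
move=> sKM sMG; apply: hat_absorbl; first exact: fintype.subset_trans sKM sMG.
by move=> x xK; apply: hat_geltl => //; apply: (subsetP sKM).
Qed.

Lemma hat_idem M : M \subset G -> hat M * hat M = hat M.
Proof. exact: hat_mul_sub. Qed.

Lemma gconjM a b g : g \in G -> gconj (a * b) g = gconj a g * gconj b g.
Proof.
move=> gG; rewrite /gconj -!mulrA; congr (_ * (_ * _)).
by rewrite !mulrA geltMV // mul1r.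
Qed.

Lemma gconj1 g : g \in G -> gconj (1 : gmx) g = 1.
Proof. by move=> gG; rewrite /gconj mulr1 geltVM. Qed.

Lemma gconjD a b g : gconj (a + b) g = gconj a g + gconj b g.
Proof. by rewrite /gconj mulrDr mulrDl. Qed.

Lemma gconjN a g : gconj (- a) g = - gconj a g.
Proof. by rewrite /gconj mulrN mulNr. Qed.

Lemma gconjZ q a g : gconj (q *: a) g = q *: gconj a g.
Proof. by rewrite /gconj gscaleAr gscaleAl. Qed.

Lemma gconj_sum (I : Type) (r : seq I) (P : pred I) (F : I -> gmx) g :
  gconj (\sum_(i <- r | P i) F i) g = \sum_(i <- r | P i) gconj (F i) g.
Proof. by rewrite /gconj big_distrr big_distrl. Qed.

Lemma gconj_prod (I : Type) (r : seq I) (P : pred I) (F : I -> gmx) g : g \in G ->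
  gconj (\prod_(i <- r | P i) F i) g = \prod_(i <- r | P i) gconj (F i) g.
Proof.
move=> gG; apply: (big_morph (fun a => gconj a g)); first by move=> a b; apply: gconjM.
exact: gconj1.
Qed.

Lemma gconjX a g n : g \in G -> gconj (a ^+ n) g = gconj a g ^+ n.
Proof.
move=> gG; elim: n => [|n IH]; first exact: gconj1.
by rewrite !exprS gconjM // IH.
Qed.

Lemma gconj_gelt h g : h \in G -> g \in G -> gconj (gelt h) g = gelt (h ^ g)%g.
Proof. by move=> hG gG; rewrite /gconj -!geltM ?groupM ?groupV // conjgE mulgA. Qed.

Lemma gconj_comp a g h : g \in G -> h \in G -> gconj (gconj a g) h = gconj a (g * h)%g.
Proof.
by move=> gG hG; rewrite /gconj invMg !geltM ?groupV // !mulrA.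
Qed.

Lemma gconj_id a : gconj a 1%g = a.
Proof. by rewrite /gconj invg1 gelt1 mul1r mulr1. Qed.

Lemma gconjK a g : g \in G -> gconj (gconj a g) g^-1%g = a.
Proof. by move=> gG; rewrite gconj_comp ?groupV // mulgV gconj_id. Qed.

Lemma gconj_hat M g : M \subset G -> g \in G -> gconj (hat M) g = hat (M :^ g)%g.
Proof.
move=> sMG gG; rewrite /hat gconjZ cardJg; congr (_ *: _); rewrite /gset_mx gconj_sum.
rewrite [RHS](reindex_inj (conjg_inj g)); apply: eq_big => x /=; first by rewrite memJ_conjg.
by move=> xM; apply: gconj_gelt => //; apply: (subsetP sMG).
Qed.

Lemma span_of_gconj H a g : H \subset G -> g \in G -> span_of H a ->
  span_of (H :^ g)%G (gconj a g).
Proof.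
move=> sHG gG [c ->]; rewrite gconj_sum; apply: span_of_sum => h hH.
rewrite gconjZ gconj_gelt // ?(subsetP sHG) //; apply/span_ofZ/span_of_gelt.
by rewrite memJ_conjg.
Qed.

Lemma gelt_comm_gconj a g : g \in G -> gconj a g = a -> gelt g * a = a * gelt g.
Proof. by move=> gG {1}<-; rewrite /gconj !mulrA geltMV // mul1r. Qed.

(** * Linear extension of a multiplicative map *)

Section Extension.
Variables (V : pzRingType) (iota : rat -> V) (H : {group gT}) (r : gT -> V).
Hypothesis sHG : H \subset G.
Hypothesis iotaD : {morph iota : x y / x + y}.
Hypothesis iotaM : {morph iota : x y / x * y}.
Hypothesis iota0 : iota 0 = 0.
Hypothesis iota1 : iota 1 = 1.
Hypothesis iotaC : forall q v, iota q * v = v * iota q.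
Hypothesis r1 : r 1%g = 1.
Hypothesis rM : {in H &, {morph r : x y / (x * y)%g >-> x * y}}.

(* Multiplicative only on span_of H: coefficients outside H are ignored. *)
Definition extend a := \sum_(h in H) iota (co a h) * r h.

Lemma extend0 : extend 0 = 0.
Proof. by rewrite /extend big1 // => h _; rewrite co0 iota0 mul0r. Qed.

Lemma extendD a b : extend (a + b) = extend a + extend b.
Proof.
rewrite /extend -big_split; apply: eq_bigr => h _.
by rewrite coD iotaD mulrDl.
Qed.

Lemma extendZ q a : extend (q *: a) = iota q * extend a.
Proof.
by rewrite /extend big_distrr /=; apply: eq_bigr => h _; rewrite coZ iotaM mulrA.
Qed.

Lemma extend_sum (I : Type) (s : seq I) (P : pred I) (F : I -> gmx) :
  extend (\sum_(i <- s | P i) F i) = \sum_(i <- s | P i) extend (F i).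
Proof. by apply: (big_morph extend extendD extend0). Qed.

Lemma extend_gelt h : h \in H -> extend (gelt h) = r h.
Proof.
move=> hH; rewrite /extend (bigD1 h) //= co_gelt ?(subsetP sHG) // eqxx iota1 mul1r.
rewrite big1 ?addr0 // => g /andP[gH ngh]; rewrite co_gelt ?(subsetP sHG) //.
by rewrite eq_sym (negPf ngh) iota0 mul0r.
Qed.

Lemma extendN a : extend (- a) = - extend a.
Proof.
by apply/eqP; rewrite -addr_eq0 -extendD addNr extend0.
Qed.

Lemma extendM a b : span_of H a -> span_of H b -> extend (a * b) = extend a * extend b.
Proof.
move=> [c ->] [d ->]; rewrite big_distrl /= !extend_sum big_distrl /=.
apply: eq_bigr => h hH; rewrite big_distrr /= extend_sum big_distrr /=.
apply: eq_bigr => k kH; have [hG kG] := (subsetP sHG h hH, subsetP sHG k kH).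
rewrite gscaleAl gscaleAr !extendZ -geltM // !extend_gelt ?groupM // rM //.
by rewrite !mulrA; congr (_ * _); rewrite -!mulrA; congr (_ * _); rewrite iotaC.
Qed.
End Extension.
End GroupRing.

(** * Units of cyclotomic fields *)

Section CyclotomicNorm.
Variables (N : nat) (N1 : (1 < N)%N).

(** Quantified over all primitive roots, so that the root coming from an embedding of a number field
    can be used. *)
Definition in_cyclotomic (y : algC) : Prop :=
  forall xi : algC, N.-primitive_root xi -> exists p : {poly rat}, y = (map_poly ratr p).[xi].

Lemma in_cyclotomic_rat q : in_cyclotomic (ratr q).
Proof. by move=> xi _; exists q%:P; rewrite map_polyC hornerC. Qed.

Lemma in_cyclotomicD x y : in_cyclotomic x -> in_cyclotomic y -> in_cyclotomic (x + y).
Proof.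
move=> hx hy xi pxi; have [p ->] := hx xi pxi; have [q ->] := hy xi pxi.
by exists (p + q); rewrite rmorphD hornerD.
Qed.

Lemma in_cyclotomicM x y : in_cyclotomic x -> in_cyclotomic y -> in_cyclotomic (x * y).
Proof.
move=> hx hy xi pxi; have [p ->] := hx xi pxi; have [q ->] := hy xi pxi.
by exists (p * q); rewrite rmorphM hornerM.
Qed.

Lemma in_cyclotomic_sum (I : Type) (r : seq I) (P : pred I) (F : I -> algC) :
  (forall i, P i -> in_cyclotomic (F i)) -> in_cyclotomic (\sum_(i <- r | P i) F i).
Proof.
move=> h; elim/big_ind: _ => //; last exact: in_cyclotomicD.
by rewrite -(rmorph0 (@ratr algC)); apply: in_cyclotomic_rat.
Qed.

Lemma in_cyclotomic_root z : z ^+ N = 1 -> in_cyclotomic z.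
Proof.
move=> zN xi pxi; have [j ->] := prim_rootP pxi zN.
by exists 'X^j; rewrite map_polyXn hornerXn.
Qed.

Lemma in_cyclotomic_char (gT : finGroupType) (G : {group gT}) (chi : 'CF(G)) x :
  chi \is a character -> (#[x]%g %| N)%N -> in_cyclotomic (chi x).
Proof.
move=> Nchi xN; have [Gx|/cfun0->] := boolP (x \in G); last first.
  by rewrite -(rmorph0 (@ratr algC)); apply: in_cyclotomic_rat.
have [rG ->] := char_reprP Nchi.
have [e [_ [enx1 _] [-> _] _]] := repr_rsim_diag rG Gx.
apply: in_cyclotomic_sum => i _; apply: in_cyclotomic_root.
by have /dvdnP[q ->] := xN; rewrite mulnC exprM enx1 expr1n.
Qed.

Lemma cyclo_autM y k l : in_cyclotomic y ->
  cyclo_aut N1 (k * l)%g y = cyclo_aut N1 k (cyclo_aut N1 l y).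
Proof.
have [xi pxi] := C_prim_root_exists (ltnW N1); have xN := prim_expr_order pxi.
move=> /(_ xi pxi)[p ->].
have hE (u : {rmorphism algC -> algC}) z : u (map_poly ratr p).[z] = (map_poly ratr p).[u z].
  rewrite -horner_map -map_poly_comp; congr horner; apply: eq_map_poly => a /=.
  by rewrite fmorph_rat.
rewrite !hE !cyclo_autE ?rmorphXn /= ?cyclo_autE // -?exprM ?[(_ * N)%N]mulnC ?exprM ?xN ?expr1n //.
by rewrite uexpM // expr_mod // exprM exprAC.
Qed.

(** The product is Galois-invariant, hence rational; it and its inverse are algebraic integers. *)
Lemma cyclotomic_norm y : in_cyclotomic y -> y \in Aint -> y^-1 \in Aint -> y != 0 ->
  `|\prod_k cyclo_aut N1 k y| = 1.
Proof.
move=> Qy Ay AVy y0.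
have [z pz] := C_prim_root_exists (ltnW N1).
(* The cyclotomic field is obtained as the number field attached to a group of order N. *)
have cardZ : #|[set: 'Z_N]%G| = N by rewrite cardsT card_ord Zp_cast.
have := group_num_field_exists [set: 'Z_N]%G; rewrite cardZ.
move=> [Qn galQn [QnC gQnC [w [pw _] _]]].
have pxi : N.-primitive_root (QnC w) by rewrite fmorph_primitive_root.
set xi := QnC w in pxi; have xN := prim_expr_order pxi.
have [p yE] := Qy xi pxi.
have hE (u : {rmorphism algC -> algC}) v : u (map_poly ratr p).[v] = (map_poly ratr p).[u v].
  rewrite -horner_map -map_poly_comp; congr horner; apply: eq_map_poly => a /=.
  by rewrite fmorph_rat.
pose x := \prod_k cyclo_aut N1 k y.
have xE : x = \prod_(k : {unit 'Z_N}) (map_poly ratr p).[xi ^+ uexp k].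
  by apply: eq_bigr => k _; rewrite yE hE cyclo_autE.
pose a := \prod_(k : {unit 'Z_N}) (map_poly ratr p).[w ^+ uexp k].
have aE : QnC a = x.
  rewrite xE rmorph_prod; apply: eq_bigr => k _ /=.
  rewrite -horner_map -map_poly_comp rmorphXn; congr horner; apply: eq_map_poly => q /=.
  by rewrite fmorph_rat.
have xQ : x \in Crat.
  have afix : a \in fixedField 'Gal({:Qn} / 1)%g.
    apply/fixedFieldP; first exact: memvf.
    move=> nu nuG; apply: (fmorph_inj QnC).
    have [nuC nuE] := gQnC nu.
    rewrite -/(nu a) (nuE a) aE xE rmorph_prod.
    (* [nuC] raises xi to a power prime to N and so permutes the factors of the norm. *)
    have [l lE] := prim_rootP pxi (etrans (esym (rmorphXn nuC _ _)) (etrans (congr1 nuC xN) (rmorph1 nuC))).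
    have : coprime l N.
      have : N.-primitive_root (nuC xi) by rewrite fmorph_primitive_root.
      by rewrite lE prim_root_exp_coprime // coprime_sym.
    move=> /(uexp_surj N1)[u uE]; rewrite [RHS](reindex_inj (mulIg u)) /=.
    apply: eq_bigr => k _; rewrite hE; congr (_.[_]).
    have xkN : (xi ^+ uexp k) ^+ N = 1 by rewrite exprAC xN expr1n.
    rewrite (expr_uexpM N1 k u xN) uE (expr_mod l xkN) exprAC -lE.
    exact: rmorphXn.
  move: afix; have /galois_fixedField -> := galQn.
  by move=> /vlineP[q aq]; rewrite -aE aq alg_num_field fmorph_rat Crat_rat.
have xZ : x \in Num.int by apply: Cint_rat_Aint => //; apply: rpred_prod => k _; rewrite Aint_aut.
have xV : x^-1 \in Num.int.
  apply: Cint_rat_Aint; first by rewrite rpredV.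
  by rewrite -prodfV; apply: rpred_prod => k _; rewrite -fmorphV Aint_aut.
have x0 : x != 0 by apply/prodf_neq0 => k _; rewrite fmorph_eq0.
apply/eqP; rewrite eq_le (norm_intr_ge1 xZ x0) andbT.
have := norm_intr_ge1 xV; rewrite invr_eq0 => /(_ x0).
by rewrite normfV invf_ge1 ?normr_gt0.
Qed.
End CyclotomicNorm.

(** * Bass units *)

Section BassUnitInverse.
Variables (T : pzRingType) (n : nat).
Hypothesis n0 : (0 < n)%N.
Implicit Type x : T.

Lemma dvdz_one_sub_exp (k m : nat) : (k ^ m = 1 %[mod n])%N ->
  ((1 - k%:Z ^+ m) %/ n%:Z)%Z * n%:Z = 1 - k%:Z ^+ m.
Proof.
move=> h; apply: divzK; rewrite -eqz_mod_dvd eq_sym.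
have -> : k%:Z ^+ m = (k ^ m)%N%:Z by rewrite -[k%:Z]natz -natrX natz.
by rewrite (modz_nat (k ^ m)%N n) (modz_nat 1 n) h.
Qed.

Section Periodic.
Variable x : T.
Hypothesis xn : x ^+ n = 1.
Let Nn := \sum_(i < n) x ^+ i.

Lemma expr_mul_norm j : x ^+ j * Nn = Nn.
Proof.
elim: j => [|j IH]; first by rewrite mul1r.
rewrite exprSr -mulrA; suff -> : x * Nn = Nn by [].
rewrite /Nn; case: n n0 xn => // n' _ xn'.
rewrite big_distrr big_ord_recr /= -exprS xn' [RHS]big_ord_recl expr0 addrC.
by congr (_ + _); apply: eq_bigr => i _; rewrite -exprS.
Qed.

Lemma norm_mul_expr j : Nn * x ^+ j = Nn.
Proof.
rewrite -[RHS](expr_mul_norm j); apply/esym/commr_sum => i _.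
by rewrite /GRing.comm -!exprD addnC.
Qed.

Lemma norm_mul_sum r (f : nat -> nat) : Nn * (\sum_(i < r) x ^+ f i) = Nn *+ r.
Proof.
rewrite big_distrr /= (eq_bigr (fun=> Nn)) => [|i _]; last exact: norm_mul_expr.
by rewrite sumr_const card_ord.
Qed.

Lemma norm_mul_sumX r (f : nat -> nat) m :
  Nn * (\sum_(i < r) x ^+ f i) ^+ m = Nn *+ (r ^ m).
Proof.
elim: m => [|m IH]; first by rewrite mulr1 mulr1n.
by rewrite exprSr mulrA IH mulrnAl norm_mul_sum -mulrnA mulnC expnSr mulnC.
Qed.

Lemma norm_sqr : Nn * Nn = Nn *+ n.
Proof. exact: (norm_mul_sum n id). Qed.

Lemma commr_norm a : GRing.comm a x -> GRing.comm a Nn.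
Proof. by move=> ax; apply: commr_sum => i _; apply: commrX. Qed.

Lemma norm_coprime k : coprime k n -> \sum_(i < n) (x ^+ k) ^+ i = Nn.
Proof.
move=> ck; pose F (i : 'I_n) : 'I_n := Ordinal (ltn_pmod (k * i) n0).
have Finj : injective F.
  move=> i j /(congr1 val) /= /(coprime_modn_mull_inj ck).
  by rewrite !modn_small // => /val_inj.
rewrite /Nn [RHS](reindex_inj Finj) /=; apply: eq_bigr => i _.
by rewrite expr_mod // exprM.
Qed.

Lemma geom_sum_period q : \sum_(i < q * n) x ^+ i = Nn *+ q.
Proof.
elim: q => [|q IH]; first by rewrite mul0n big_ord0.
rewrite mulSn big_split_ord /= mulrS; congr (_ + _); rewrite -IH.
by apply: eq_bigr => i _; rewrite exprD xn mul1r.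
Qed.

Lemma geom_sum_comp k k' :
  (\sum_(i < k) x ^+ i) * (\sum_(i < k') (x ^+ k) ^+ i) = \sum_(i < k' * k) x ^+ i.
Proof.
elim: k' => [|k' IH]; first by rewrite mul0n !big_ord0 mulr0.
rewrite big_ord_recr mulrDr IH mulSn [in RHS]addnC big_split_ord /=; congr (_ + _).
rewrite big_distrl; apply: eq_bigr => i _ /=.
by rewrite -exprM -exprD addnC mulnC.
Qed.

(** Nn multiplies with itself like the integer n. A relation determining c replaces a formula, which
    would need a division by n. *)
Lemma one_plus_norm_expr q m : exists c : int,
  (1 + Nn *+ q) ^+ m = 1 + Nn *~ c /\ 1 + c * n%:Z = (1 + q%:Z * n%:Z) ^+ m.
Proof.
elim: m => [|m [c [e1 e2]]]; first by exists 0; rewrite mulr0z addr0 mul0r addr0.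
exists (q%:Z + c + q%:Z * c * n%:Z); split; last by rewrite exprS -e2; ring.
rewrite exprS e1 mulrDl mul1r mulrDr mulr1 mulrzAr mulrnAl norm_sqr.
rewrite !pmulrn -!mulrzA -addrA; congr (1 + _).
by rewrite -!mulrzDr; congr (Nn *~ _); ring.
Qed.

(** As k and k' are inverse modulo n, the two geometric sums multiply to 1 + q Nn. The whole product
    is 1 + s Nn for an integer s, and n s = 0 by the relations defining the correction terms. *)
Lemma bass_unit_mul k k' q m : coprime k n -> (k * k' = 1 + q * n)%N ->
    (k ^ m = 1 %[mod n])%N -> (k' ^ m = 1 %[mod n])%N ->
  bass_unit n k m x * bass_unit n k' m (x ^+ k) = 1.
Proof.
move=> ck kk' km km'; rewrite /bass_unit norm_coprime //.
set S := \sum_(i < k) x ^+ i; set S' := \sum_(i < k') _.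
have := dvdz_one_sub_exp km; have := dvdz_one_sub_exp km'.
set a := ((1 - k%:Z ^+ m) %/ _)%Z; set a' := ((1 - k'%:Z ^+ m) %/ _)%Z => ha' ha.
rewrite -/Nn.
have S'E : S' = \sum_(i < k') x ^+ (k * i) by apply: eq_bigr => i _; rewrite exprM.
have cSN : Nn * S ^+ m = S ^+ m * Nn.
  apply: commr_sym; apply: commr_norm; apply: commr_sym; apply: commrX.
  by apply: commr_sum => i _; apply: commrX.
have cSS : GRing.comm S S'.
  rewrite S'E; apply: commr_sum => i _; apply: commrX.
  by apply/commr_sym/commr_sum => j _; apply: commrX.
have SS : S * S' = 1 + Nn *+ q.
  rewrite geom_sum_comp mulnC kk' add1n big_ord_recr /= geom_sum_period.
  by rewrite mulnC exprM xn expr1n addrC.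
have [c [e1 e2]] := one_plus_norm_expr q m.
rewrite mulrDl !mulrDr -exprMn_comm // SS e1 mulrzAr -cSN (norm_mul_sumX k id).
rewrite mulrzAl {1}S'E norm_mul_sumX mulrzAr mulrzAl norm_sqr.
rewrite !pmulrn -!mulrzA -!addrA -!mulrzDr.
set s := c + _; suff -> : s = 0 by rewrite mulr0z addr0.
have nz : n%:Z != 0 by rewrite eqz_nat -lt0n.
apply: (mulIf nz); rewrite mul0r /s.
have kX : (k ^ m)%N%:Z = k%:Z ^+ m by rewrite -[k%:Z]natz -natrX natz.
have kX' : (k' ^ m)%N%:Z = k'%:Z ^+ m by rewrite -[k'%:Z]natz -natrX natz.
rewrite kX kX'.
have e3 : 1 + q%:Z * n%:Z = k%:Z * k'%:Z by rewrite -!PoszM kk' PoszD.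
rewrite e3 exprMn in e2.
have e4 : c * n%:Z = k%:Z ^+ m * k'%:Z ^+ m - 1 by rewrite -e2; ring.
have -> : (c + (k%:Z ^+ m * a' + (k'%:Z ^+ m * a + n%:Z * (a * a')))) * n%:Z =
  c * n%:Z + k%:Z ^+ m * (a' * n%:Z) + k'%:Z ^+ m * (a * n%:Z) + (a * n%:Z) * (a' * n%:Z).
  by ring.
by rewrite e4 ha ha'; ring.
Qed.
End Periodic.

(** k' = k^(m-1) inverts k modulo n, and (x^k)^k' = x, so the two factors can exchange roles and
    [bass_unit_mul] yields both products. *)
Lemma bass_unit_invertible x k m : x ^+ n = 1 -> coprime k n -> (0 < m)%N -> (0 < k)%N ->
    (k ^ m = 1 %[mod n])%N ->
  let k' := (k ^ m.-1)%N in
  bass_unit n k m x * bass_unit n k' m (x ^+ k) = 1 /\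
  bass_unit n k' m (x ^+ k) * bass_unit n k m x = 1.
Proof.
move=> xn ck m0 k0 km k'.
have kk' : (k * k' = k ^ m)%N by rewrite /k' -expnS prednK.
have km1 : (0 < k ^ m)%N by rewrite expn_gt0 k0.
have [q qE] : exists q, (k ^ m = 1 + q * n)%N.
  have : (n %| k ^ m - 1)%N by rewrite -eqn_mod_dvd // km.
  by case/dvdnP=> q hq; exists q; rewrite -hq subnKC.
have km' : (k' ^ m = 1 %[mod n])%N.
  by rewrite /k' -expnM mulnC expnM -modnXm km modnXm exp1n.
split; first by apply: (@bass_unit_mul x xn k k' q) => //; rewrite kk' qE.
have xk : (x ^+ k) ^+ n = 1 by rewrite exprAC xn expr1n.
have -> : bass_unit n k m x = bass_unit n k m ((x ^+ k) ^+ k').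
  congr bass_unit; rewrite -exprM kk' qE exprD expr1 mulnC exprM xn expr1n mulr1 //.
apply: (@bass_unit_mul (x ^+ k) xk k' k q) => //; last by rewrite mulnC kk' qE.
by rewrite /k' coprimeXl.
Qed.
End BassUnitInverse.

(** At z = 1 the correction term turns k^m into 1; elsewhere the full sum over the period
    vanishes. *)
Lemma bass_unit_root (F : fieldType) (n k m : nat) (z : F) : (0 < n)%N -> z ^+ n = 1 ->
    (k ^ m = 1 %[mod n])%N ->
  bass_unit n k m z = if z == 1 then 1 else ((1 - z ^+ k) / (1 - z)) ^+ m.
Proof.
move=> n0 zn km; rewrite /bass_unit; case: eqVneq => [->|z1].
  have s1 r : \sum_(i < r) (1 : F) ^+ i = r%:Z%:~R.
    rewrite (eq_bigr (fun=> 1)) => [|i _]; last by rewrite expr1n.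
    by rewrite sumr_const card_ord.
  rewrite !s1 -mulrzA mulrC dvdz_one_sub_exp // -rmorphXn /= -mulrzDr.
  by rewrite addrC subrK.
have d0 : 1 - z != 0 by rewrite subr_eq0 eq_sym.
have gs r : \sum_(i < r) z ^+ i = (1 - z ^+ r) / (1 - z).
  apply: (mulfI d0); rewrite mulrCA divff // mulr1 -[in RHS](expr1n F r) subrXX.
  by congr (_ * _); apply: eq_bigr => i _; rewrite expr1n mul1r.
by rewrite !gs zn subrr mul0r mul0rz addr0.
Qed.

Lemma expr_inv_mul (T : pzRingType) (a b : T) j : a * b = 1 -> b * a = 1 ->
  a ^+ j * b ^+ j = 1.
Proof. by move=> ab ba; rewrite -exprMn_comm ?ab ?expr1n // /GRing.comm ab ba. Qed.

Section Integrality.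
Variables (gT : finGroupType) (G : {group gT}).
Local Notation gmx := 'M[rat]_#|G|.
Local Notation gelt := (@gelt gT G).
Local Notation hat := (@hat gT G).
Local Notation ZG := (integral_group_ring G).
Implicit Types (a b u : gmx) (g h x y : gT) (H M K : {group gT}).

Lemma int_ring_span a : ZG a -> span_of G a.
Proof. by case=> c ->; exists (fun g => (c g)%:~R). Qed.

Lemma int_ring_coP a : ZG a <-> span_of G a /\ forall g, g \in G -> co a g \is a Num.int.
Proof.
split=> [[c ->]|[aS aZ]].
  split; first by exists (fun g => (c g)%:~R).
  by move=> g gG; rewrite (co_lin (fun g => (c g)%:~R)) // gG intr_int.
exists (fun g => Num.floor (co a g)); rewrite {1}(span_ofE (subxx _) aS).
by apply: eq_bigr => g gG; rewrite floorK ?aZ.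
Qed.

Lemma int_ring0 : ZG 0.
Proof. by exists (fun=> 0); rewrite big1 // => g _; rewrite scale0r. Qed.

Lemma int_ringD a b : ZG a -> ZG b -> ZG (a + b).
Proof.
move=> [c ->] [d ->]; exists (fun g => c g + d g); rewrite -big_split.
by apply: eq_bigr => g _; rewrite intrD scalerDl.
Qed.

Lemma int_ringMz a (k : int) : ZG a -> ZG (a *~ k).
Proof.
move=> [c ->]; exists (fun g => k * c g); rewrite -scaler_int scaler_sumr.
by apply: eq_bigr => g _; rewrite intrM scalerA.
Qed.

Lemma int_ringMn a (k : nat) : ZG a -> ZG (a *+ k).
Proof. by rewrite pmulrn; apply: int_ringMz. Qed.

Lemma int_ringZ a (k : nat) : ZG a -> ZG (k%:R *: a).
Proof. by rewrite scaler_nat; apply: int_ringMn. Qed.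

Lemma int_ringN a : ZG a -> ZG (- a).
Proof. by rewrite -mulrN1z; apply: int_ringMz. Qed.

Lemma int_ringB a b : ZG a -> ZG b -> ZG (a - b).
Proof. by move=> ha hb; apply: int_ringD => //; apply: int_ringN. Qed.

Lemma int_ring_sum (I : Type) (r : seq I) (P : pred I) (F : I -> gmx) :
  (forall i, P i -> ZG (F i)) -> ZG (\sum_(i <- r | P i) F i).
Proof.
move=> hF; elim/big_ind: _ => //; [exact: int_ring0 | exact: int_ringD].
Qed.

Lemma int_ring_gelt g : g \in G -> ZG (gelt g).
Proof.
move=> gG; exists (fun x => (x == g)%:R); rewrite (bigD1 g) //= eqxx scale1r.
by rewrite big1 ?addr0 // => x /andP[_ /negPf ->]; rewrite scale0r.
Qed.

Lemma int_ring1 : ZG 1.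
Proof. by rewrite -(@gelt1 _ G); apply: int_ring_gelt. Qed.

Lemma int_ringM a b : ZG a -> ZG b -> ZG (a * b).
Proof.
move=> [c ->] [d ->]; rewrite big_distrl; apply: int_ring_sum => g gG.
rewrite big_distrr; apply: int_ring_sum => h hG /=.
rewrite gscaleAl gscaleAr !scaler_int; do 2!apply: int_ringMz.
by rewrite -geltM //; apply: int_ring_gelt; rewrite groupM.
Qed.

Lemma int_ring_gconj a g : g \in G -> ZG a -> ZG (gconj a g).
Proof.
by move=> gG ha; do 2?apply: int_ringM => //; apply: int_ring_gelt; rewrite ?groupV.
Qed.

Lemma int_ring_hat H : H \subset G -> ZG (#|H|%:R *: hat H).
Proof.
move=> sHG; rewrite /hat scalerA mulfV ?scale1r ?pnatr_eq0 -?lt0n ?cardG_gt0 //.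
by apply: int_ring_sum => h hH; apply: int_ring_gelt; apply: (subsetP sHG).
Qed.

Lemma span_of_denominator a : span_of G a -> exists2 q : nat, (0 < q)%N & ZG (q%:R *: a).
Proof.
move=> [c ->]; pose q := (\prod_(g in G) `|denq (c g)|)%N.
have q0 : (0 < q)%N by apply: prodn_gt0 => g; rewrite absz_gt0 denq_neq0.
exists q => //; rewrite scaler_sumr; apply: int_ring_sum => g gG.
rewrite scalerA.
suff /intrP[z ->] : q%:R * c g \is a Num.int by rewrite scaler_int; apply/int_ringMz/int_ring_gelt.
rewrite /q (bigD1 g) //= natrM mulrAC; apply: rpredM; last by rewrite rpred_nat.
rewrite -{2}[c g]divq_num_den mulrCA natr_absz ger0_norm ?denq_ge0 // mulfV ?mulr1 ?intr_int //.
by rewrite intr_eq0 denq_neq0.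
Qed.

Lemma unit_groupM a b : unit_group G a -> unit_group G b -> unit_group G (a * b).
Proof.
move=> [Za [a' Za' [aa' a'a]]] [Zb [b' Zb' [bb' b'b]]]; split; first exact: int_ringM.
exists (b' * a'); first exact: int_ringM.
split; first by rewrite mulrA -[a * b * b']mulrA bb' mulr1.
by rewrite mulrA -[b' * a' * a]mulrA a'a mulr1.
Qed.

Lemma unit_group1 : unit_group G 1.
Proof. by split; [exact: int_ring1 | exists 1; [exact: int_ring1 | rewrite mulr1]]. Qed.

Lemma unit_group_gelt g : g \in G -> unit_group G (gelt g).
Proof.
move=> gG; split; first exact: int_ring_gelt.
by exists (gelt g^-1%g); [apply: int_ring_gelt; rewrite groupV | rewrite geltMV // geltVM].
Qed.

Lemma unit_group_gconj a g : g \in G -> unit_group G a -> unit_group G (gconj a g).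
Proof.
move=> gG [Za [a' Za' [aa' a'a]]]; split; first exact: int_ring_gconj.
exists (gconj a' g); first exact: int_ring_gconj.
by rewrite -!gconjM // aa' a'a gconj1.
Qed.

Lemma bounded_int_ring_finite (B : nat) :
  finite_set [set a | ZG a /\ forall g, g \in G -> `|co a g| <= B%:R]%classic.
Proof.
pose F (f : {ffun gT -> 'I_(B + B).+1}) : gmx :=
  \sum_(g in G) ((f g)%:Z - B%:Z)%:~R *: gelt g.
apply: (@sub_finite_set _ _ [set F f | f in [set: {ffun gT -> 'I_(B + B).+1}]]%classic).
  move=> a [/int_ring_coP[aS aZ] aB].
  exists [ffun g => inord (absz (Num.floor (co a g) + B%:Z))] => //.
  rewrite [RHS](span_ofE (subxx _) aS); apply: eq_bigr => g gG; congr (_ *: _).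
  have /intrP[z zE] := aZ g gG; rewrite ffunE; have := aB g gG; rewrite zE intrKfloor.
  rewrite -intr_norm -[B%:R]/(B%:Z%:~R) ler_int ler_norml => /andP[z1 z2].
  rewrite inordK; last by lia.
  by congr (_%:~R); lia.
by apply: finite_image; apply: finite_finset.
Qed.

(* Powers of b lie in a fixed lattice (1/q)ZG; two of them agree modulo q ZG. *)
Lemma power_in_unit_group b b' (q : nat) : (0 < q)%N -> b * b' = 1 -> b' * b = 1 ->
    (forall j, ZG (q%:R *: b ^+ j)) -> (forall j, ZG (q%:R *: b' ^+ j)) ->
  exists2 j, (0 < j)%N & ZG (b ^+ j) /\ ZG (b' ^+ j).
Proof.
move=> q0 bb' b'b Zb Zb'.
have [c cE] := boolp.choice Zb.
(* The modulus is q^2 because [c j] holds the coefficients of q b^j, while b^j - b^i must lie in q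
   ZG to absorb the denominator of b'^i. *)
pose f (j : nat) := [ffun g : gT => inord (absz (c j g %% (q * q)%N%:Z)%Z) : 'I_(q * q).+1].
have [i [j [ij fij]]] : exists i j, (i < j)%N /\ f i = f j.
  pose F (k : 'I_(#|{ffun gT -> 'I_(q * q).+1}|).+1) := f k.
  have /injectivePn[x [y xy Fxy]] : ~~ injectiveb F.
    by apply/negP => /injectiveP /leq_card; rewrite card_ord ltnn.
  case: (ltngtP x y) => h.
  - by exists x, y.
  - by exists y, x.
  by rewrite (val_inj h) eqxx in xy.
have qq0 : (q * q)%N%:Z != 0 by rewrite eqz_nat -lt0n muln_gt0 q0.
have dv g : (((q * q)%N%:Z) %| c j g - c i g)%Z.
  have /ffunP/(_ g) := fij; rewrite !ffunE => /(congr1 val) /=.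
  have bnd k : (absz (c k g %% (q * q)%N%:Z)%Z < (q * q).+1)%N.
    have := ltz_mod (c k g) qq0; have := modz_ge0 (c k g) qq0; lia.
  rewrite !inordK // => e; rewrite -eqz_mod_dvd; apply/eqP.
  have := modz_ge0 (c i g) qq0; have := modz_ge0 (c j g) qq0; lia.
pose w : gmx := \sum_(g in G) (((c j g - c i g) %/ (q * q)%N%:Z)%Z)%:~R *: gelt g.
have Zw : ZG w by exists (fun g => ((c j g - c i g) %/ (q * q)%N%:Z)%Z).
have qR : q%:R != 0 :> rat by rewrite pnatr_eq0 -lt0n.
have wE : b ^+ j - b ^+ i = q%:R *: w.
  apply: (scalerI qR); rewrite scalerBr !cE -sumrB scalerA /w scaler_sumr.
  apply: eq_bigr => g gG; rewrite -scalerBl scalerA; congr (_ *: _).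
  rewrite -intrB -[in LHS](divzK (dv g)) intrM mulrC; congr (_ * _).
  by rewrite -natrM.
have bX k : b ^+ k * b' ^+ k = 1 by apply: expr_inv_mul.
exists (j - i)%N; first by rewrite subn_gt0.
have e1 : b ^+ (j - i) - 1 = w * (q%:R *: b' ^+ i).
  rewrite gscaleAr -gscaleAl -wE mulrBl bX; congr (_ - _).
  by rewrite -{2}(subnK (ltnW ij)) exprD -mulrA bX mulr1.
have e2 : b' ^+ (j - i) - 1 = - (w * (q%:R *: b' ^+ j)).
  have -> : b' ^+ j = b' ^+ i * b' ^+ (j - i) by rewrite -exprD subnKC // ltnW.
  rewrite -gscaleAl mulrA -e1 mulrBl mul1r bX opprB.
  by [].
split; rewrite -[_ ^+ (j - i)](subrK 1) ?e1 ?e2; apply: int_ringD; try exact: int_ring1.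
  exact: int_ringM.
by apply: int_ringN; apply: int_ringM.
Qed.
End Integrality.

(** * The component Q(H/H') of QH *)

Section LinearEvaluation.
Variables (gT : finGroupType) (G H : {group gT}) (sHG : H \subset G).
Local Notation gmx := 'M[rat]_#|G|.
Local Notation gelt := (@gelt gT G).
Local Notation hat := (@hat gT G).
Local Notation ZG := (integral_group_ring G).
Implicit Types (a b u : gmx) (g h x y : gT) (M K : {group gT}).

Definition ev (theta : 'CF(H)) a : algC := extend ratr H theta a.

Section OneCharacter.
Variable theta : 'CF(H).
Hypothesis lin : theta \is a linear_char.

Let comm (q : rat) (v : algC) : ratr q * v = v * ratr q. Proof. exact: mulrC. Qed.
Let thM : {in H &, {morph theta : x y / (x * y)%g >-> x * y}}. Proof. exact: lin_charM. Qed.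

Lemma evD a b : ev theta (a + b) = ev theta a + ev theta b.
Proof. exact: (extendD H theta (rmorphD (@ratr algC))). Qed.

Lemma evN a : ev theta (- a) = - ev theta a.
Proof. exact: (extendN H theta (rmorphD (@ratr algC)) (rmorph0 (@ratr algC))). Qed.

Lemma evB a b : ev theta (a - b) = ev theta a - ev theta b.
Proof. by rewrite evD evN. Qed.

Lemma evZ q a : ev theta (q *: a) = ratr q * ev theta a.
Proof. exact: (extendZ H theta (rmorphM (@ratr algC))). Qed.

Lemma ev_sum (I : Type) (s : seq I) (P : pred I) (F : I -> gmx) :
  ev theta (\sum_(i <- s | P i) F i) = \sum_(i <- s | P i) ev theta (F i).
Proof. exact: (extend_sum H theta (rmorphD (@ratr algC)) (rmorph0 (@ratr algC))). Qed.

Lemma ev_gelt h : h \in H -> ev theta (gelt h) = theta h.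
Proof. exact: (extend_gelt theta sHG (rmorph0 (@ratr algC)) (rmorph1 (@ratr algC))). Qed.

Lemma ev1 : ev theta 1 = 1.
Proof. by rewrite -gelt1 ev_gelt // lin_char1. Qed.

Lemma evM a b : span_of H a -> span_of H b -> ev theta (a * b) = ev theta a * ev theta b.
Proof.
exact: (extendM sHG (rmorphD (@ratr algC)) (rmorphM (@ratr algC))
         (rmorph0 (@ratr algC)) (rmorph1 (@ratr algC)) comm thM).
Qed.

Lemma evX a n : span_of H a -> ev theta (a ^+ n) = ev theta a ^+ n.
Proof.
move=> aS; elim: n => [|n IH]; first exact: ev1.
by rewrite !exprS evM ?IH //; apply: span_ofX.
Qed.

Lemma evMz a (c : int) : ev theta (a *~ c) = ev theta a *~ c.
Proof. by rewrite -scaler_int evZ rmorph_int mulrzl. Qed.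

Lemma span_ofMz a (c : int) : span_of H a -> span_of H (a *~ c).
Proof. by rewrite -scaler_int; apply: span_ofZ. Qed.

Lemma ev_prod (I : Type) (s : seq I) (P : pred I) (F : I -> gmx) :
  (forall i, P i -> span_of H (F i)) ->
  ev theta (\prod_(i <- s | P i) F i) = \prod_(i <- s | P i) ev theta (F i).
Proof.
move=> FS; suff [] : span_of H (\prod_(i <- s | P i) F i) /\
   ev theta (\prod_(i <- s | P i) F i) = \prod_(i <- s | P i) ev theta (F i) by [].
elim/big_rec2: _ => [|i a c Pi [hS hE]]; first by split; [apply: span_of1 | apply: ev1].
split; first by apply: span_ofM => //; apply: FS.
by rewrite evM ?hE //; apply: FS.
Qed.

Lemma span_of_bass_unit n k m (x : gmx) : span_of H x -> span_of H (bass_unit n k m x).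
Proof.
move=> xS; apply: span_ofD.
  by apply: span_ofX => //; apply: span_of_sum => i _; apply: span_ofX.
by apply: span_ofMz; apply: span_of_sum => i _; apply: span_ofX.
Qed.

Lemma ev_bass_unit n k m (x : gmx) : span_of H x ->
  ev theta (bass_unit n k m x) = bass_unit n k m (ev theta x).
Proof.
move=> xS; rewrite /bass_unit evD evMz evX; last first.
  by apply: span_of_sum => i _; apply: span_ofX.
by rewrite !ev_sum; congr (_ ^+ _ + _ *~ _); apply: eq_bigr => i _; rewrite evX.
Qed.

Lemma ev_hat M : M \subset H -> ev theta (hat M) = (M \subset cfker theta)%:R.
Proof.
move=> sMH; rewrite /hat evZ /gset_mx ev_sum fmorphV rmorph_nat.
have -> : \sum_(x in M) ev theta (regular_repr rat G x) = \sum_(x in M) theta x.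
  by apply: eq_bigr => x xM; apply: ev_gelt; apply: (subsetP sMH).
have M0 : #|M|%:R != 0 :> algC by rewrite pnatr_eq0 -lt0n cardG_gt0.
case: (boolP (M \subset _)) => [sMK|/subsetPn[y yM yK]].
  rewrite (eq_bigr (fun=> 1)) => [|x xM]; first by rewrite sumr_const mulVf.
  by rewrite cfker1 ?lin_char1 // (subsetP sMK).
have yH := subsetP sMH y yM; have ty : theta y != 1.
  apply: contra yK => /eqP ty; rewrite cfkerEchar ?lin_charW //.
  by rewrite finset.in_set yH ty lin_char1 /= ?eqxx.
have e : theta y * (\sum_(x in M) theta x) = \sum_(x in M) theta x.
  rewrite big_distrr [RHS](reindex_inj (mulgI y)) /=.
  apply: eq_big => [x|x xM]; first by rewrite groupMl.
  by rewrite lin_charM // (subsetP sMH).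
have /eqP := e; rewrite -subr_eq0 -[X in _ - X]mul1r -mulrBl mulf_eq0 subr_eq0 (negPf ty) /=.
by move/eqP ->; rewrite mulr0.
Qed.

Lemma ev_aut (u : {rmorphism algC -> algC}) a : ev (cfAut u theta) a = u (ev theta a).
Proof.
rewrite /ev /extend rmorph_sum; apply: eq_bigr => h hH.
by rewrite cfunE rmorphM fmorph_rat.
Qed.

Lemma ev_in_cyclotomic N a : (#|H| %| N)%N -> in_cyclotomic N (ev theta a).
Proof.
move=> HN; apply: in_cyclotomic_sum => h hH; apply: in_cyclotomicM.
  exact: in_cyclotomic_rat.
apply: in_cyclotomic_char; first exact: lin_charW.
by apply: dvdn_trans HN; apply: order_dvdG.
Qed.

Lemma ev_Aint a : ZG a -> ev theta a \in Aint.
Proof.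
move=> /int_ring_coP[_ aZ]; apply: rpred_sum => h hH; apply: rpredM.
  have /intrP[z ->] := aZ h (subsetP sHG h hH); rewrite rmorph_int.
  exact: Aint_int.
exact/Aint_char/lin_charW.
Qed.
End OneCharacter.

Local Notation D := H^`(1)%G.
Local Notation A := (H / D)%G.

(* All linear characters of H, indexed by the characters of H / H'. *)
Definition lin_of (i : Iirr A) : 'CF(H) := ('chi_i %% D)%CF.

Lemma quot_der_abelian : abelian A.
Proof. exact: der_abelian 0 H. Qed.

Lemma lin_ofE i h : h \in H -> lin_of i h = 'chi_i (coset D h).
Proof. by move=> hH; rewrite cfModE // der_normal. Qed.

Lemma lin_of_linear i : lin_of i \is a linear_char.
Proof. by apply: cfMod_lin_char; apply/char_abelianP/quot_der_abelian. Qed.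

Lemma linear_lin_of (theta : 'CF(H)) : theta \is a linear_char -> exists i, theta = lin_of i.
Proof.
move=> lin; have sDK := lin_char_der1 lin.
have : (theta / D)%CF \in irr A.
  by apply/lin_char_irr/cfQuo_lin_char => //; apply: der_normal.
by case/irrP=> i e; exists i; rewrite /lin_of -e cfQuoK ?der_normal.
Qed.

(* The ideal QH hat(H') of QH, a copy of Q(H/H'). *)
Definition der_part a := span_of H a /\ a * hat D = a.

Lemma sDH : D \subset H. Proof. exact: der_sub. Qed.
Lemma sDG : D \subset G. Proof. exact: fintype.subset_trans sDH sHG. Qed.

Lemma hatD_span : span_of H (hat D).
Proof. exact/span_of_hat/sDH. Qed.

Lemma hat_normal_comm M a : (M <| H)%g -> span_of H a -> hat M * a = a * hat M.
Proof.
move=> /andP[sMH nMH] [c ->]; rewrite big_distrr big_distrl; apply: eq_bigr => h hH /=.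
have hG := subsetP sHG h hH; rewrite (gscaleAr (c h)) (gscaleAl (c h)); congr (_ *: _).
apply/esym/gelt_comm_gconj => //; rewrite gconj_hat ?(normP (subsetP nMH h hH)) //.
exact: fintype.subset_trans sMH sHG.
Qed.

Lemma hatD_comm a : span_of H a -> hat D * a = a * hat D.
Proof. by apply: hat_normal_comm; apply: der_normal. Qed.

Lemma hatD_idem : hat D * hat D = hat D.
Proof. exact/hat_idem/sDG. Qed.

Lemma der_partMl a b : span_of H a -> der_part b -> der_part (a * b).
Proof. by move=> aS [bS bD]; split; [apply: span_ofM | rewrite -mulrA bD]. Qed.

Lemma der_partB a b : der_part a -> der_part b -> der_part (a - b).
Proof. by move=> [aS aD] [bS bD]; split; [apply: span_ofB | rewrite mulrBl aD bD]. Qed.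

Lemma der_part_hat M : D \subset M -> M \subset H -> der_part (hat M).
Proof.
move=> sDM sMH; split; first exact: span_of_hat.
rewrite -hatD_comm; last exact: span_of_hat.
by apply: hat_mul_sub => //; apply: fintype.subset_trans sMH sHG.
Qed.

(* Fourier inversion on H / H'. *)
Lemma der_part_co a h : der_part a -> h \in H ->
  ratr (co a h) = #|H|%:R^-1 * \sum_i ev (lin_of i) a * lin_of i h^-1%g.
Proof.
move=> [aS aD] hH.
have Da : hat D * a = a by rewrite hatD_comm.
have inv d : d \in D -> gelt d * a = a.
  by move=> dD; rewrite -Da mulrA hat_geltl // sDG.
have sum_lin y : y \in H -> \sum_i lin_of i y = (#|A|%:R *+ (y \in D) : algC).
  move=> yH; transitivity (cfReg A (coset D y)).
    rewrite cfReg_sum sum_cfunE; apply: eq_bigr => i _.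
    rewrite cfunE lin_ofE // lin_char1 ?mul1r //.
    by apply/char_abelianP/quot_der_abelian.
  have yN : y \in 'N(D)%g by apply: (subsetP (der_norm 1 H)).
  rewrite cfRegE; congr (_ *+ _); congr nat_of_bool.
  by apply/eqP/idP => [|/coset_id //]; apply: coset_idr.
have cardA : (#|A| * #|D| = #|H|)%N.
  by rewrite mulnC card_quotient ?Lagrange ?sDH // gFnorm.
have H0 : #|H|%:R != 0 :> algC by rewrite pnatr_eq0 -lt0n cardG_gt0.
apply: (mulfI H0); rewrite mulVKf //.
transitivity (\sum_(x in H) ratr (co a x) * \sum_i lin_of i (x * h^-1)%g : algC).
  transitivity (\sum_(d in D) #|A|%:R * ratr (co a h) : algC).
    by rewrite sumr_const -cardA natrM -[RHS]mulr_natl; ring.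
  have hG := subsetP sHG h hH.
  rewrite [RHS](bigID (fun x => x * h^-1 \in D)%g) /= [X in _ + X]big1 ?addr0; last first.
    move=> x /andP[xH /negPf xD].
    by rewrite (sum_lin _ (groupM xH (groupVr hH))) xD mulr0n mulr0.
  rewrite [RHS](reindex_inj (mulIg h)) /=; apply: eq_big => [d|d dD].
    rewrite mulgK andb_idl // => dD; rewrite groupM //; exact: (subsetP sDH).
  rewrite mulgK sum_lin ?(subsetP sDH) // dD mulr1n mulrC; congr (ratr _ * _).
  have dG := subsetP sDG d dD.
  have := @co_geltM _ _ d^-1%g a h; rewrite invgK inv ?groupV //; apply=> //.
  exact: span_ofS aS.
under eq_bigr do rewrite big_distrr /=.
rewrite exchange_big; apply: eq_bigr => i _; rewrite /ev /extend big_distrl /=.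
apply: eq_bigr => x xH.
by rewrite (lin_charM (lin_of_linear i)) ?groupV // mulrA.
Qed.
End LinearEvaluation.

Lemma least_positive_exists (P : nat -> Prop) :
  (exists2 j, (0 < j)%N & P j) -> exists n, least_positive P n.
Proof.
move=> [j j0 Pj]; pose Q n := `[< (0 < n)%N /\ P n >].
have exQ : exists n, Q n by exists j; apply/asboolP.
have [n /asboolP[n0 Pn] nmin] := ex_minnP exQ.
exists n; split=> // i i0 Pi; apply: nmin; exact/asboolP.
Qed.

Lemma finite_set_pigeonhole (T : choiceType) (F : set T) (f : nat -> T) :
  finite_set F -> (forall n, F (f n)) -> exists i j, (i < j)%N /\ f i = f j.
Proof.
move=> /finite_seqP[s sE] Ff.
have fs n : f n \in s by have := Ff n; rewrite sE.
pose F' (k : 'I_(size s).+1) : 'I_(size s) := Ordinal (etrans (index_mem (f k) s) (fs k)).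
have /injectivePn[x [y xy Fxy]] : ~~ injectiveb F'.
  by apply/negP => /injectiveP /leq_card; rewrite !card_ord ltnn.
have fxy : f x = f y.
  have := congr1 (nth (f x) s \o val) Fxy; rewrite /= nth_index //.
  by rewrite nth_index.
case: (ltngtP x y) => h; first by exists x, y.
  by exists y, x.
by rewrite (val_inj h) eqxx in xy.
Qed.

Section EmbeddingFacts.
Variable R : realType.
Local Notation phi := (@algC_embed R).

Lemma normc_embed_unit (x : algC) : `|x| = 1 -> normc (phi x) = 1.
Proof.
move=> x1; have : normc (phi x) * normc (phi (x^*)%R) = 1.
  by rewrite -normcM -rmorphM -normCK x1 expr1n rmorph1 normc1.
rewrite algC_embed_normc_conj -expr2 => /eqP; rewrite sqrp_eq1 ?normc_ge0 //.
by move/eqP.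
Qed.

Lemma normc_embed_rat q : normc (phi (ratr q)) = `|ratr q|.
Proof. by rewrite fmorph_rat -normc_real; congr normc; apply/esym/(fmorph_rat (real_complex R)). Qed.

Lemma normc_gt0 (x : R[i]) : x != 0 -> 0 < normc x.
Proof.
move=> x0; rewrite lt_neqAle normc_ge0 andbT eq_sym.
by apply: contraNneq x0 => /eq0_normc ->.
Qed.

Lemma normc_embed_gt0 (x : algC) : x != 0 -> 0 < normc (phi x).
Proof. by move=> x0; rewrite normc_gt0 // fmorph_eq0. Qed.
End EmbeddingFacts.

Section DerPart.
Variables (gT : finGroupType) (G H : {group gT}) (sHG : H \subset G).
Local Notation gmx := 'M[rat]_#|G|.
Local Notation hat := (@hat gT G).
Local Notation D := H^`(1)%G.
Implicit Types (a b u : gmx) (g h x y : gT).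

(** By Fourier inversion. Identities in this component, including those for epsilon(H, K), can thus
    be checked on linear characters. *)
Lemma der_part_eq0 a : der_part H a -> (forall i, ev (@lin_of _ H i) a = 0) -> a = 0.
Proof.
move=> ad a0; rewrite (span_ofE sHG ad.1) big1 // => h hH.
suff -> : co a h = 0 by rewrite scale0r.
have : ratr (co a h) = 0 :> algC.
  by rewrite (der_part_co sHG ad hH) big1 ?mulr0 // => i _; rewrite a0 mul0r.
by move/eqP; rewrite fmorph_eq0 => /eqP.
Qed.

Lemma der_part_comm a b : der_part H a -> der_part H b -> a * b = b * a.
Proof.
move=> ad bd; apply/eqP; rewrite -subr_eq0; apply/eqP; apply: der_part_eq0.
  by apply: der_partB; apply: der_partMl => //; [case: ad | case: bd].
move=> i; have lin := lin_of_linear i; have [[aS _] [bS _]] := (ad, bd).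
by rewrite evB !(evM sHG lin) // mulrC subrr.
Qed.

Lemma der_part_central a c : der_part H a -> span_of H c -> c * a = a * c.
Proof.
move=> ad cS; have [aS aD] := ad.
have cD : der_part H (c * hat D).
  by apply: der_partMl => //; apply: der_part_hat => //; exact: sDH.
have Da : hat D * a = a by rewrite hatD_comm.
have -> : c * a = (c * hat D) * a by rewrite -mulrA Da.
rewrite (der_part_comm cD ad) -[in RHS]aD -mulrA; congr (_ * _).
by rewrite hatD_comm.
Qed.

Lemma complement_mul a b : der_part H a -> der_part H b ->
  (1 - hat D + a) * (1 - hat D + b) = 1 - hat D + a * b.
Proof.
move=> [aS aD] [bS bD].
have Db : hat D * b = b by rewrite hatD_comm.
have e1 : (1 - hat D) * (1 - hat D) = 1 - hat D :> gmx.
  by rewrite mulrBl mul1r mulrBr mulr1 hatD_idem // subrr subr0.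
have e2 : (1 - hat D) * b = 0 by rewrite mulrBl mul1r Db subrr.
have e3 : a * (1 - hat D) = 0 by rewrite mulrBr mulr1 aD subrr.
by rewrite [(_ + a) * _]mulrDl mulrDr e1 e2 addr0 mulrDr e3 add0r.
Qed.

Lemma der_part_hatD : der_part H (hat D).
Proof. by apply: der_part_hat => //; exact: sDH. Qed.
End DerPart.

(** * Units trivial outside Q(H/H') *)

Section QuotientUnits.
Variables (R : realType) (N : nat) (N1 : (1 < N)%N).
Variables (gT : finGroupType) (G H : {group gT}) (sHG : H \subset G).
Hypothesis GN : (#|G| %| N)%N.
Local Notation phi := (@algC_embed R).
Local Notation gmx := 'M[rat]_#|G|.
Local Notation gelt := (@gelt gT G).
Local Notation hat := (@hat gT G).
Local Notation ZG := (integral_group_ring G).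
Local Notation D := H^`(1)%G.
Local Notation A := (H / D)%G.
Local Notation lin_of := (@lin_of gT H).
Implicit Types (a b u x y : gmx) (g h : gT).

Lemma card_subgroup_dvd : (#|H| %| N)%N.
Proof. exact: dvdn_trans (cardSg sHG) GN. Qed.

Lemma orderN h : h \in H -> (#[h]%g %| N)%N.
Proof. by move=> hH; apply: dvdn_trans card_subgroup_dvd; apply: order_dvdG. Qed.

Definition linear_arg h : gmx := 1 - hat D + gelt h * hat D.

Lemma der_gelt h : h \in H -> der_part H (gelt h * hat D).
Proof.
move=> hH; apply: der_partMl => //; first exact: span_of_gelt.
exact: der_part_hatD.
Qed.

Lemma linear_arg_span h : h \in H -> span_of H (linear_arg h).
Proof.
move=> hH; apply: span_ofD; last by have [] := der_gelt hH.
by apply: span_ofB; [apply: span_of1 | apply: hatD_span].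
Qed.

Lemma linear_argX h j : h \in H -> linear_arg h ^+ j = linear_arg (h ^+ j)%g.
Proof.
move=> hH; elim: j => [|j IH].
  by rewrite expr0 /linear_arg expg0 gelt1 mul1r subrK.
have hjH := groupX j hH.
rewrite exprS IH /linear_arg (complement_mul sHG (der_gelt hH) (der_gelt hjH)); congr (_ + _).
have -> : gelt h * hat D * (gelt (h ^+ j)%g * hat D) = gelt h * (hat D * gelt (h ^+ j)%g) * hat D.
  by rewrite !mulrA.
rewrite (hatD_comm sHG (span_of_gelt G hjH)) !mulrA -mulrA hatD_idem //.
by rewrite -geltM ?groupX ?(subsetP sHG) // -expgS.
Qed.

Lemma linear_arg_expn h : h \in H -> linear_arg h ^+ #[h]%g = 1.
Proof. by move=> hH; rewrite linear_argX // expg_order /linear_arg gelt1 mul1r subrK. Qed.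

Lemma linear_arg_complement h : h \in H -> linear_arg h * (1 - hat D) = 1 - hat D.
Proof.
move=> hH; rewrite /linear_arg mulrDl mulrBl mul1r mulrBr mulr1 hatD_idem // subrr subr0.
by rewrite mulrBr mulr1 -mulrA hatD_idem // subrr addr0.
Qed.

Lemma ev_linear_arg h i : h \in H -> ev (lin_of i) (linear_arg h) = lin_of i h.
Proof.
move=> hH; have lin := lin_of_linear i.
rewrite evD evB ev1 // (evM sHG lin (span_of_gelt G hH) (hatD_span G H)) ev_gelt //.
by rewrite ev_hat ?sDH // lin_char_der1 // mulr1 subrr add0r.
Qed.

(** One denominator for all products a x^i: multiplying a by an integer polynomial in x preserves
    it, whence all powers of a Bass unit share a denominator. *)
Definition has_int_powers (q : nat) x a := forall i, ZG (q%:R *: (a * x ^+ i)).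

Lemma int_powersD q x a b :
  has_int_powers q x a -> has_int_powers q x b -> has_int_powers q x (a + b).
Proof. by move=> ha hb i; rewrite mulrDl scalerDr; apply: int_ringD. Qed.

Lemma int_powersMz q x a (c : int) : has_int_powers q x a -> has_int_powers q x (a *~ c).
Proof.
move=> ha i; rewrite -scaler_int gscaleAl scalerA mulrC -scalerA scaler_int.
exact: int_ringMz.
Qed.

Lemma int_powers_bass q x a n k m r : has_int_powers q x a ->
  has_int_powers q x (a * bass_unit n k m (x ^+ r)).
Proof.
have sumP a' l : has_int_powers q x a' ->
    has_int_powers q x (a' * \sum_(i < l) (x ^+ r) ^+ i).
  move=> ha i; rewrite big_distrr big_distrl scaler_sumr; apply: int_ring_sum => j _ /=.
  by rewrite -mulrA -exprM -exprD.
move=> ha; rewrite /bass_unit mulrDr mulrzAr; apply: int_powersD; last first.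
  exact/int_powersMz/sumP.
elim: m => [|m IH]; first by rewrite mulr1.
by rewrite exprSr mulrA; apply: sumP.
Qed.

Lemma int_powers_arg h : h \in H -> has_int_powers #|D| (linear_arg h) 1.
Proof.
move=> hH i; rewrite mul1r linear_argX // /linear_arg scalerDr scalerBr.
have Zh := int_ring_hat (sDG sHG).
apply: int_ringD; last first.
  rewrite -gscaleAr; apply: int_ringM => //; apply: int_ring_gelt.
  by rewrite (subsetP sHG) ?groupX.
by apply: int_ringB => //; apply: int_ringZ; apply: int_ring1.
Qed.

(* The units of ZH that are trivial outside the component Q(H/H'). *)
Record quot_unit u : Prop := QuotUnit {
  quot_unit_span : span_of H u;
  quot_unit_complement : u * (1 - hat D) = 1 - hat D;
  quot_unit_int : ZG u;
  quot_unit_inv : exists2 u', ZG u' & [/\ span_of H u', u * u' = 1 & u' * u = 1] }.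

Lemma least_unit_power b b' (q : nat) : (0 < q)%N -> b * b' = 1 -> b' * b = 1 ->
    (forall j, ZG (q%:R *: b ^+ j)) -> (forall j, ZG (q%:R *: b' ^+ j)) ->
    span_of H b -> span_of H b' -> b * (1 - hat D) = 1 - hat D ->
  exists2 nb, least_positive (fun j => unit_group G (b ^+ j)) nb & quot_unit (b ^+ nb).
Proof.
move=> q0 bb' b'b Zb Zb' bS b'S bC.
have [|nb nbP] := @least_positive_exists (fun j => unit_group G (b ^+ j)).
  have [j j0 [h1 h2]] := power_in_unit_group q0 bb' b'b Zb Zb'.
  exists j => //; split=> //; exists (b' ^+ j) => //.
  by split; apply: expr_inv_mul.
exists nb => //; have [nb0 [Zv [y Zy [vy yv]]] _] := nbP.
have yE : y = b' ^+ nb by rewrite -[y]mul1r -(expr_inv_mul nb b'b bb') -mulrA vy mulr1.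
split=> //; first exact: span_ofX.
  by elim: (nb) => [|l IH]; rewrite ?mul1r // exprSr -mulrA bC.
by exists y => //; split=> //; rewrite yE; apply: span_ofX.
Qed.

(* The unit b = u_{k,m}(1 - hat H' + h hat H') before raising to the power n_b. *)
Lemma bass_element h k m : h \in H -> (0 < k)%N -> (0 < m)%N -> coprime k #[h]%g ->
    (k ^ m = 1 %[mod #[h]%g])%N ->
  exists b v, [/\ @generalized_bass_unit gT G H h k m v, quot_unit v,
    (exists2 nb, (0 < nb)%N & v = b ^+ nb),
    span_of H b & (exists b', [/\ span_of H b', b * b' = 1, b' * b = 1,
      forall j, ZG (#|D|%:R *: b ^+ j) & forall j, ZG (#|D|%:R *: b' ^+ j)]) /\
    forall i, ev (lin_of i) b =
      if lin_of i h == 1 then 1 else ((1 - lin_of i h ^+ k) / (1 - lin_of i h)) ^+ m].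
Proof.
move=> hH k0 m0 ck km; set X := linear_arg h.
have [|n nP] := @least_positive_exists (fun j => X ^+ j = 1).
  by exists #[h]%g; rewrite ?order_gt0 ?linear_arg_expn.
have [n0 Xn nmin] := nP.
have nh : (n %| #[h]%g)%N.
  rewrite /dvdn eqn0Ngt; apply/negP => r0.
  have Xr : X ^+ (#[h]%g %% n) = 1.
    have := linear_arg_expn hH; rewrite -/X {1}(divn_eq #[h]%g n) exprD mulnC exprM Xn.
    by rewrite expr1n mul1r.
  by have := nmin _ r0 Xr; rewrite leqNgt ltn_pmod.
have ckn : coprime k n by apply: coprime_dvdr nh ck.
have kmn : (k ^ m = 1 %[mod n])%N.
  by rewrite -(modn_dvdm _ nh) km modn_dvdm.
have XS : span_of H X by apply: linear_arg_span.
set b := bass_unit n k m X; set b' := bass_unit n (k ^ m.-1) m (X ^+ k).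
have [bb' b'b] : b * b' = 1 /\ b' * b = 1 by apply: bass_unit_invertible.
have bS : span_of H b by apply: span_of_bass_unit.
have b'S : span_of H b' by apply: span_of_bass_unit => //; apply: span_ofX.
have Pb j : has_int_powers #|D| X (b ^+ j).
  elim: j => [|j IH]; first exact: int_powers_arg.
  by rewrite exprSr /b -[X in bass_unit _ _ _ X]expr1; apply: int_powers_bass.
have Pb' j : has_int_powers #|D| X (b' ^+ j).
  elim: j => [|j IH]; first exact: int_powers_arg.
  by rewrite exprSr; apply: int_powers_bass.
have Zb j : ZG (#|D|%:R *: b ^+ j) by have := Pb j 0%N; rewrite mulr1.
have Zb' j : ZG (#|D|%:R *: b' ^+ j) by have := Pb' j 0%N; rewrite mulr1.
(* X acts as 1 on the complement, so b acts there as k^m + (1 - k^m) = 1. *)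
have bC : b * (1 - hat D) = 1 - hat D.
  have XC i : X ^+ i * (1 - hat D) = 1 - hat D.
    elim: i => [|i IH]; first by rewrite mul1r.
    by rewrite exprSr -mulrA linear_arg_complement.
  have SC l : (\sum_(i < l) X ^+ i) * (1 - hat D) = (1 - hat D) *+ l.
    rewrite big_distrl (eq_bigr (fun=> 1 - hat D)) => [|i _]; last exact: XC.
    by rewrite sumr_const card_ord.
  have SX l : (\sum_(i < k) X ^+ i) ^+ l * (1 - hat D) = (1 - hat D) *+ (k ^ l).
    elim: l => [|l IH]; first by rewrite mul1r.
    by rewrite exprSr -mulrA SC mulrnAr IH -mulrnA expnS mulnC.
  rewrite /b /bass_unit mulrDl SX mulrzAl SC !pmulrn -mulrzA -mulrzDr.
  rewrite [(n%:Z * _)%R]mulrC dvdz_one_sub_exp //.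
  have -> : (k ^ m)%N%:Z = k%:Z ^+ m by rewrite -[k%:Z]natz -natrX natz.
  by rewrite [X in _ *~ X]addrC subrK.
have evb i : ev (lin_of i) b =
    if lin_of i h == 1 then 1 else ((1 - lin_of i h ^+ k) / (1 - lin_of i h)) ^+ m.
  have lin := lin_of_linear i; rewrite /b (ev_bass_unit sHG lin n k m XS).
  rewrite ev_linear_arg // bass_unit_root //.
  by rewrite -(ev_linear_arg i hH) -(evX sHG lin n XS) Xn ev1.
have [nb nbP lv] := least_unit_power (cardG_gt0 D) bb' b'b Zb Zb' bS b'S bC.
have bdef : b = bass_unit n k m X by [].
move: b b' bb' b'b Zb Zb' bS b'S bC evb nbP lv bdef {Pb Pb'} =>
  b b' bb' b'b Zb Zb' bS b'S bC evb nbP lv bdef.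
have nb0 : (0 < nb)%N by case: nbP.
exists b, (b ^+ nb); split=> //; last by split=> //; exists b'.
  exists n, nb; move: nbP; rewrite bdef => nbP; split; [exact: nP|exact: nbP|by []].
by exists nb.
Qed.

Definition quot_unit_log u (i : Iirr A) : R := ln (normc (phi (ev (lin_of i) u))).

Lemma quot_unit_ev_neq0 u i : quot_unit u -> ev (lin_of i) u != 0.
Proof.
case=> uS _ _ [u' _ [u'S uu' _]]; apply/eqP => e.
have /eqP := ev1 sHG (lin_of_linear i).
by rewrite -uu' (evM sHG (lin_of_linear i) uS u'S) e mul0r eq_sym oner_eq0.
Qed.

Lemma quot_unitM x y : quot_unit x -> quot_unit y -> quot_unit (x * y).
Proof.
move=> [xS xC xZ [x' x'Z [x'S xx' x'x]]] [yS yC yZ [y' y'Z [y'S yy' y'y]]]; split.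
- exact: span_ofM.
- by rewrite -mulrA yC xC.
- exact: int_ringM.
exists (y' * x'); first exact: int_ringM.
split; first exact: span_ofM.
  by rewrite mulrA -[x * y * y']mulrA yy' mulr1.
by rewrite mulrA -[y' * x' * x]mulrA x'x mulr1.
Qed.

Lemma quot_unit1 : quot_unit 1.
Proof.
split; rewrite ?mul1r //; [exact: span_of1 | exact: int_ring1 |].
by exists 1; [exact: int_ring1 | rewrite mulr1; split=> //; apply: span_of1].
Qed.

Lemma quot_unitX x n : quot_unit x -> quot_unit (x ^+ n).
Proof.
by move=> hx; elim: n => [|n IH]; [exact: quot_unit1 | rewrite exprS; apply: quot_unitM].
Qed.

Lemma quot_unit_logM x y i : quot_unit x -> quot_unit y -> quot_unit_log (x * y) i = quot_unit_log x i + quot_unit_log y i.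
Proof.
move=> hx hy; have [[xS _ _ _] [yS _ _ _]] := (hx, hy).
rewrite /quot_unit_log (evM sHG (lin_of_linear i) xS yS).
by rewrite rmorphM normcM lnM ?posrE ?normc_embed_gt0 ?(quot_unit_ev_neq0 i hx) ?(quot_unit_ev_neq0 i hy).
Qed.

(** Bounded logarithms bound the values at all linear characters, hence the coefficients of u
    hat(H') by [der_part_co]; the remaining summand 1 - hat(H') adds at most 2. *)
Lemma quot_unit_log_bounded_finite (B : R) :
  finite_set [set u | quot_unit u /\ forall i, `|quot_unit_log u i| <= B]%classic.
Proof.
pose K := Num.bound (expR B * #|A|%:R + 2).
apply: sub_finite_set (bounded_int_ring_finite G K).
move=> u [hu uB]; have [uS uC uZ _] := hu; split=> // g gG.
have [gH|gH] := boolP (g \in H); last first.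
  by rewrite (span_ofE sHG uS) (co_lin (co u)) // (negPf gH) normr0.
have hDp : der_part H (u * hat D).
  by apply: der_partMl => //; apply: der_part_hatD.
have uE : u = 1 - hat D + u * hat D.
  by rewrite -[in RHS]uC -mulrDr subrK mulr1.
rewrite {1}uE coD.
have c1 : `|co (1 - hat D : gmx) g| <= 2.
  rewrite coD coN; apply: le_trans (ler_normB _ _) _.
  have le1 (t : rat) : 0 <= t <= 1 -> `|t| <= 1 by case/andP=> t0 t1; rewrite ger0_norm.
  have -> : 2 = 1 + 1 :> rat by [].
  apply: lerD; apply: le1.
    by rewrite -gelt1 co_gelt //; case: (_ == _).
  rewrite /hat coZ /gset_mx co_sum.
  have -> : \sum_(d in D) co (regular_repr rat G d) g = (g \in D)%:R.
    have := co_lin (fun=> 1) (sDG sHG) gG.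
    rewrite (eq_bigr (fun d => gelt d)) => [|d _]; last by rewrite scale1r.
    by rewrite co_sum => ->; case: (g \in D).
  case: (g \in D); rewrite ?mulr0 ?lexx ?ler01 // mulr1 invr_ge0 ler0n /=.
  by rewrite invf_le1 ?ltr0n ?ler1n ?cardG_gt0.
have c2 : `|ratr (co (u * hat D) g)| <= expR B * #|A|%:R :> R.
  rewrite -normc_embed_rat (der_part_co sHG hDp gH) rmorphM normcM.
  rewrite fmorphV rmorph_nat normcV.
  have Hn : normc (#|H|%:R : R[i]) = #|H|%:R.
    by rewrite -(rmorph_nat (real_complex R)) normc_real ger0_norm.
  rewrite Hn mulrC ler_pdivrMr ?ltr0n ?cardG_gt0 // rmorph_sum.
  apply: le_trans (normc_sum_le _ (G := fun=> expR B) _) _ => [i _|]; last first.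
    rewrite sumr_const -mulrA -natrM -[_ *+ _]mulr_natr ler_pM2l ?expR_gt0 // ler_nat.
    rewrite card_Iirr_abelian ?quot_der_abelian //.
    by rewrite leq_pmulr // cardG_gt0.
  have lin := lin_of_linear i.
  rewrite (evM sHG lin uS (hatD_span G H)) ev_hat ?sDH // lin_char_der1 // mulr1.
  rewrite rmorphM normcM [normc (phi (lin_of i _))]normc_embed_unit ?mulr1; last first.
    by rewrite normC_lin_char // groupV.
  rewrite -[leLHS]lnK ?posrE ?normc_embed_gt0 ?(quot_unit_ev_neq0 i hu) // ler_expR.
  exact: le_trans (ler_norm _) (uB i).
apply: le_trans (ler_normD _ _) _.
rewrite -(ler_rat R) rmorphD /= ratr_nat; apply: le_trans (ltW (archi_boundP _)); last first.
  by rewrite addr_ge0 // mulr_ge0 ?expR_ge0.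
rewrite addrC lerD //.
  by rewrite (le_trans _ c2) // ratr_norm.
by rewrite -(ratr_nat R 2) ler_rat.
Qed.
End QuotientUnits.

(** * Generalized Bass units in the component Q(H/H') *)

Section QuotientUnitIndex.
Variables (R : realType) (N : nat) (N1 : (1 < N)%N).
Variables (gT : finGroupType) (G H : {group gT}) (sHG : H \subset G).
Hypothesis GN : (#|G| %| N)%N.
Local Notation phi := (@algC_embed R).
Local Notation gmx := 'M[rat]_#|G|.
Local Notation hat := (@hat gT G).
Local Notation ZG := (integral_group_ring G).
Local Notation D := H^`(1)%G.
Local Notation A := (H / D)%G.
Local Notation lin_of := (@lin_of gT H).
Local Notation quot_unit := (@quot_unit gT G H).
Local Notation quot_unit_log := (@quot_unit_log R gT G H).
Implicit Types (a b u x y : gmx) (g h : gT) (i : Iirr A).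

Lemma card_abelianization_dvd : (#|A| %| N)%N.
Proof. exact: dvdn_trans (dvdn_quotient H D) (card_subgroup_dvd sHG GN). Qed.

Lemma lin_of_aut (nu : {rmorphism algC -> algC}) i :
  lin_of (aut_Iirr nu i) = cfAut nu (lin_of i).
Proof.
by apply/cfun_inP => h hH; rewrite cfunE !lin_ofE // aut_IirrE cfunE.
Qed.

Lemma quot_unit_log_conj u i : quot_unit_log u (conjC_Iirr i) = quot_unit_log u i.
Proof.
by rewrite /quot_unit_log lin_of_aut ev_aut algC_embed_normc_conj.
Qed.

Lemma quot_unit_log_sum0 u i : quot_unit u -> \sum_k quot_unit_log u (irr_act N1 k i) = 0.
Proof.
move=> hu; have lin := lin_of_linear i.
have [uS _ uZ [u' u'Z [u'S uu' _]]] := hu.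
have e0 := quot_unit_ev_neq0 sHG i hu.
have eV : (ev (lin_of i) u)^-1 = ev (lin_of i) u'.
  apply: (mulfI e0); rewrite divff // -(evM sHG lin uS u'S) uu' ev1 //.
have n1 : `|\prod_k cyclo_aut N1 k (ev (lin_of i) u)| = 1.
  apply: cyclotomic_norm => //.
  - by apply: ev_in_cyclotomic => //; apply: card_subgroup_dvd sHG GN.
  - exact: ev_Aint.
  - by rewrite eV; apply: ev_Aint.
have := normc_embed_unit R n1; rewrite rmorph_prod normc_prod => /(congr1 (@ln R)).
rewrite ln1 => n0.
pose F k := normc (phi (cyclo_aut N1 k (ev (lin_of i) u))).
have F0 k : 0 < F k by rewrite normc_embed_gt0 // fmorph_eq0.
have lnF : ln (\prod_k F k) = \sum_k ln (F k).
  suff [] : 0 < \prod_k F k /\ ln (\prod_k F k) = \sum_k ln (F k) by [].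
  elim/big_rec2: _ => [|k y x _ [x0 xE]]; first by rewrite ln1.
  by split; [rewrite mulr_gt0 | rewrite lnM ?posrE // xE].
rewrite -[RHS]n0 lnF; apply: eq_bigr => k _.
by rewrite /quot_unit_log lin_of_aut ev_aut.
Qed.

Lemma bass_log b (m : nat) h k i : h \in H -> coprime k N ->
    ev (lin_of i) b =
      (if lin_of i h == 1 then 1 else ((1 - lin_of i h ^+ k) / (1 - lin_of i h)) ^+ m) ->
  ln (normc (phi (ev (lin_of i) b))) =
    m%:R * (log_dist1 R (lin_of i h ^+ k) - log_dist1 R (lin_of i h)).
Proof.
move=> hH ck ->; set z := lin_of i h; rewrite /log_dist1.
case: (eqVneq z 1) => [->|z1].
  by rewrite expr1n eqxx subrr mulr0 rmorph1 normc1 ln1.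
have zN : z ^+ N = 1.
  have /dvdnP[q ->] := orderN sHG GN hH.
  by rewrite mulnC exprM lin_char_unity_root ?lin_of_linear // expr1n.
have zk1 : z ^+ k != 1.
  apply: contra z1 => /eqP zk; have k0 : (0 < k)%N.
    by case: (k) ck => //; rewrite /coprime gcd0n => /eqP N1'; move: N1; rewrite N1'.
  have [c _ /dvdnP[d dE]] := Bezoutl N k0.
  move: dE; rewrite (eqP ck) => dE; apply/eqP.
  have : z ^+ (1 + c * N) = 1 by rewrite dE mulnC exprM zk expr1n.
  by rewrite exprD expr1 mulnC exprM zN expr1n mulr1.
rewrite (negPf zk1) rmorphXn fmorph_div normcX normcM normcV.
have p1 : 0 < normc (phi (1 - z)) by rewrite normc_embed_gt0 // subr_eq0 eq_sym.
have pk : 0 < normc (phi (1 - z ^+ k)) by rewrite normc_embed_gt0 // subr_eq0 eq_sym.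
by rewrite lnXn ?divr_gt0 // ln_div ?posrE // mulr_natl.
Qed.

Variable gen : set gmx.
Hypothesis gen_sub : is_subgroup (unit_group G) gen.
Hypothesis gen_bass : forall h k m v, h \in H -> (0 < k)%N -> (0 < m)%N ->
  coprime k #[h]%g -> (k ^ m = 1 %[mod #[h]%g])%N ->
  @generalized_bass_unit gT G H h k m v -> gen v.

(** k is prime to N, not only to the order of h, since it also serves as a Galois exponent; Euler's
    theorem provides the exponent m. *)
Lemma uexp_params h (k : {unit 'Z_N}) : h \in H ->
  [/\ (0 < uexp k)%N, (0 < totient N)%N, coprime (uexp k) #[h]%g &
   (uexp k ^ totient N = 1 %[mod #[h]%g])%N].
Proof.
move=> hH; have ck := uexp_coprime N1 k; have hN := orderN sHG GN hH.
split.
- by rewrite lt0n; apply: contraTneq ck => ->; rewrite /coprime gcd0n neq_ltn N1 orbT.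
- by rewrite totient_gt0 ltnW.
- exact: coprime_dvdr hN ck.
by rewrite -(modn_dvdm _ hN) Euler_exp_totient // modn_dvdm.
Qed.

Lemma quot_unit_dual (lam : Iirr A -> R) :
    (forall u, quot_unit u -> gen u -> \sum_i lam i * quot_unit_log u i = 0) ->
  forall (x : coset_of D) (k : {unit 'Z_N}), x \in A ->
   \sum_i lam i * (log_dist1 R ('chi_i x ^+ uexp k) - log_dist1 R ('chi_i x)) = 0.
Proof.
move=> lam0 hb k /morphimP[h hN hH ->].
have [k0 m0 ck km] := uexp_params k hH.
have [b [v [bv lv [nb nb0 vE] bS [_ evb]]]] := bass_element sHG hH k0 m0 ck km.
have := lam0 v lv (gen_bass hH k0 m0 ck km bv).
have c0 : (totient N)%:R * nb%:R != 0 :> R.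
  by rewrite mulf_neq0 // pnatr_eq0 -lt0n.
have -> : \sum_i lam i * quot_unit_log v i = ((totient N)%:R * nb%:R) *
  \sum_i lam i * (log_dist1 R ('chi_i (coset D h) ^+ uexp k) - log_dist1 R ('chi_i (coset D h))).
  rewrite big_distrr; apply: eq_bigr => i _ /=; rewrite -lin_ofE //.
  have lv0 := quot_unit_ev_neq0 sHG i lv; have lin := lin_of_linear i.
  rewrite /quot_unit_log vE (evX sHG lin nb bS) rmorphXn normcX.
  have b0 : ev (lin_of i) b != 0.
    by apply: contraNneq lv0 => b0; rewrite vE (evX sHG lin nb bS) b0 expr0n gtn_eqF.
  rewrite lnXn ?normc_embed_gt0 // (bass_log hH (uexp_coprime N1 k) (evb i)).
  by rewrite -mulr_natr; ring.
by move/eqP; rewrite mulf_eq0 (negPf c0) => /eqP.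
Qed.

Lemma gen_inv u : quot_unit u -> gen u -> exists2 y, quot_unit y /\ gen y & u * y = 1.
Proof.
case=> uS uC uZ [u' u'Z [u'S uu' u'u]] gu; have [_ _ _ gV] := gen_sub.
exists u' => //; split; last exact: gV gu uu' u'u.
split=> //; first by rewrite -{1}uC mulrA u'u mul1r.
by exists u.
Qed.

(** [lattice_finite_index] and [bass_milnor_dual] show that [gen] meets the [quot_unit] elements in
    finite index; two powers of u then agree up to [gen]. *)
Lemma quot_unit_power u : quot_unit u -> exists2 J, (0 < J)%N & gen (u ^+ J).
Proof.
move=> hu; have [gU g1 gM gV] := gen_sub.
have [||||||||F Ffin HF] :=
  @lattice_finite_index R gmx quot_unit [set x | quot_unit x /\ gen x]%classic (Iirr A) quot_unit_log.
- by move=> x y; apply: quot_unitM.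
- by move=> x [].
- by split; [exact: quot_unit1 | exact: g1].
- by move=> x y [lx gx] [ly gy]; split; [apply: quot_unitM | apply: gM].
- by move=> x [lx gx]; have [y ygen xy] := gen_inv lx gx; exists y.
- by move=> x y i; apply: quot_unit_logM.
- by move=> B; apply: quot_unit_log_bounded_finite.
- move=> lam lam0 z lz; apply: (@bass_milnor_dual R N N1 _ A) => //.
  + exact: quot_der_abelian.
  + exact: card_abelianization_dvd.
  + by apply: quot_unit_dual => x lx gx; apply: lam0.
  + by move=> i; apply: quot_unit_log_conj.
  + by move=> i; apply: quot_unit_log_sum0.
have /boolp.choice[a Ha] n : exists a, (quot_unit a /\ gen a) /\ F (u ^+ n * a).
  by have [a aA Fa] := HF (u ^+ n) (quot_unitX sHG n hu); exists a.
have [i [j [ij e]]] := finite_set_pigeonhole Ffin (fun n => (Ha n).2).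
exists (j - i)%N; first by rewrite subn_gt0.
have [[lai gai] _] := Ha i; have [[laj gaj] _] := Ha j.
have [uS _ _ [u' _ [u'S uu' u'u]]] := hu.
have e2 : a i = u ^+ (j - i) * a j.
  rewrite -[a i]mul1r -(expr_inv_mul i u'u uu') -mulrA e.
  by rewrite -(subnKC (ltnW ij)) exprD !mulrA (expr_inv_mul i u'u uu') mul1r addKn.
have [y [ly gy] ay] := gen_inv laj gaj.
have -> : u ^+ (j - i) = a i * y by rewrite e2 -mulrA ay mulr1.
exact: gM.
Qed.

(** 1 - eps + b eps is b on one component and 1 elsewhere, but eps has denominators: one power makes
    it integral, and a further power lies in [gen] by [quot_unit_power]. *)
Lemma component_power (eps b b' : gmx) (q : nat) : (0 < q)%N ->
    der_part H eps -> eps * eps = eps -> span_of H b -> span_of H b' ->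
    b * b' = 1 -> b' * b = 1 ->
    (forall j, ZG (q%:R *: b ^+ j)) -> (forall j, ZG (q%:R *: b' ^+ j)) ->
  exists2 J, (0 < J)%N & gen (1 + (b ^+ J - 1) * eps).
Proof.
move=> q0 ed ee bS b'S bb' b'b Zb Zb'; have [eS eD] := ed.
have mul a c : span_of H a -> span_of H c ->
    (1 - eps + a * eps) * (1 - eps + c * eps) = 1 - eps + a * c * eps.
  move=> aS cS; have ec := der_part_central sHG ed cS.
  have pe : (1 - eps) * eps = 0 by rewrite mulrBl mul1r ee subrr.
  have ep : eps * (1 - eps) = 0 by rewrite mulrBr mulr1 ee subrr.
  have pp : (1 - eps) * (1 - eps) = 1 - eps by rewrite mulrBr mulr1 pe subr0.
  rewrite mulrDl (mulrDr (1 - eps)) (mulrDr (a * eps)) pp {1}ec [(1 - eps) * (eps * c)]mulrA pe mul0r addr0.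
  rewrite -[a * eps * (1 - eps)]mulrA ep mulr0 add0r; congr (_ + _).
  by rewrite -!mulrA [eps * _]mulrA -ec -mulrA ee.
pose w := 1 - eps + b * eps; pose w' := 1 - eps + b' * eps.
have wX j c c' : span_of H c -> c = c' -> (1 - eps + c * eps) ^+ j = 1 - eps + c' ^+ j * eps.
  move=> cS <-; elim: j => [|j IH]; first by rewrite mul1r subrK.
  by rewrite exprS IH mul ?exprS //; apply: span_ofX.
have ww' : w * w' = 1 by rewrite mul // bb' mul1r subrK.
have w'w : w' * w = 1 by rewrite mul // b'b mul1r subrK.
have [q1 q10 Ze] := span_of_denominator (span_ofS sHG eS).
have Zw c j : span_of H c -> (forall j, ZG (q%:R *: c ^+ j)) ->
    ZG ((q * q1)%N%:R *: (1 - eps + c * eps) ^+ j).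
  move=> cS Zc; rewrite (wX j c c cS erefl) scalerDr scalerBr natrM -!scalerA.
  apply: int_ringD.
    by apply: int_ringB; apply: int_ringZ => //; apply: int_ringZ; apply: int_ring1.
  by rewrite -gscaleAr -gscaleAl; apply: int_ringM.
have wS : span_of H w.
  by apply: span_ofD; [apply: span_ofB => //; apply: span_of1 | apply: span_ofM].
have w'S : span_of H w'.
  by apply: span_ofD; [apply: span_ofB => //; apply: span_of1 | apply: span_ofM].
have eDl : eps * (1 - hat D) = 0 by rewrite mulrBr mulr1 eD subrr.
have wC : w * (1 - hat D) = 1 - hat D.
  by rewrite /w mulrDl mulrBl mul1r -mulrA eDl mulr0 subr0 addr0.
have qq0 : (0 < q * q1)%N by rewrite muln_gt0 q0.
have [nb [nb0 _ _] lv] := least_unit_power sHG qq0 ww' w'w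
   (fun j => Zw b j bS Zb) (fun j => Zw b' j b'S Zb') wS w'S wC.
have [J J0 gJ] := quot_unit_power lv.
exists (nb * J)%N; first by rewrite muln_gt0 nb0.
have -> : 1 + (b ^+ (nb * J) - 1) * eps = w ^+ (nb * J).
  by rewrite /w (wX _ b b bS erefl) mulrBl mul1r addrCA addrC.
by rewrite exprM.
Qed.
End QuotientUnitIndex.

(** * Strong Shoda pairs and their conjugates *)

Section Epsilon.
Variables (gT : finGroupType) (G H K : {group gT}) (sHG : H \subset G).
Hypothesis nKH : (K <| H)%g.
Hypothesis cHK : cyclic (H / K)%g.
Local Notation gmx := 'M[rat]_#|G|.
Local Notation gelt := (@gelt gT G).
Local Notation hat := (@hat gT G).
Local Notation eps := (@epsilon gT G H K).
Local Notation der_part := (@der_part gT G H).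
Implicit Types (a b : gmx) (M : {group gT}).

Lemma der_sub_cyclic : H^`(1)%g \subset K.
Proof. by apply: der1_min; [apply: normal_norm | apply: cyclic_abelian]. Qed.

Lemma minnormal_between (L : {group gT}) : K \proper L -> (L <| H)%g ->
  exists M : {group gT}, [&& K \subset M, M \subset H & minnormal (M / K)%g (H / K)%g]
     /\ M \subset L.
Proof.
move=> /andP[sKL nsLK] nLH; have [sKH nK] := andP nKH.
have [sLH nL] := andP nLH.
have nKL : L \subset 'N(K)%g := fintype.subset_trans sLH nK.
have LK1 : (L / K)%G :!=: 1%g by rewrite -subG1 quotient_sub1.
have [X minX sX] := minnormal_exists LK1 (quotient_norms K nL).
have sXH : X \subset (H / K)%g by apply: fintype.subset_trans sX (quotientS K sLH).
have [M XE sKM sMH] := inv_quotientS nKH sXH.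
exists M; rewrite sKM sMH -XE minX; split => //.
by rewrite -(quotientSGK _ sKL) -?XE // (fintype.subset_trans sMH nK).
Qed.

(** The second alternative is the empty product 1, which need not lie in QH hat(H'). *)
Lemma der_part_prod (s : seq {group gT}) (P : pred {group gT}) :
  (forall M, P M -> K \subset M /\ M \subset H) ->
  der_part (\prod_(M <- s | P M) (hat K - hat M)) \/ ~~ has P s.
Proof.
move=> hP; elim: s => [|M s IH]; first by right.
rewrite big_cons /=; case: (boolP (P M)) => [PM|nPM] /=; last by case: IH; auto.
have [sKM sMH] := hP M PM; left.
have sKH := normal_sub nKH.
have dM : der_part (hat K - hat M).
  by apply: der_partB; apply: der_part_hat => //;
    [apply: der_sub_cyclic | apply: fintype.subset_trans sKM; apply: der_sub_cyclic].
case: IH => [IH|IH]; last by rewrite big_hasC // mulr1.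
by apply: der_partMl => //; case: dM.
Qed.

Lemma epsilon_der_part : der_part eps.
Proof.
rewrite /epsilon; case: eqP => [_|/eqP nHK].
  by apply: der_part_hat => //; apply: der_sub.
case: (@der_part_prod (index_enum {group gT})
  (fun M => [&& K \subset M, M \subset H & minnormal (M / K)%g (H / K)%g])) => //.
  by move=> M /and3P[].
have pKH : K \proper H by rewrite finset.properEneq eq_sym nHK normal_sub.
have [M [MP _]] := minnormal_between pKH (normal_refl H).
by case/hasP; exists M => //; apply: mem_index_enum.
Qed.

(** theta sends a factor to [K in the kernel] - [M in the kernel]. All factors are 1 exactly when
    the kernel contains K but no minimal M above it. *)
Lemma ev_epsilon (theta : 'CF(H)) : theta \is a linear_char ->
  ev theta eps = (cfker theta == K)%:R.
Proof.
move=> lin; have sKH := normal_sub nKH; rewrite /epsilon.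
case: eqP => [HK|/eqP nHK].
  by rewrite ev_hat // -HK finset.eqEsubset cfker_sub.
rewrite ev_prod //; last first.
  by move=> M /and3P[sKM sMH _]; apply: span_ofB; apply: span_of_hat.
rewrite (eq_bigr (fun M : {group gT} => (K \subset cfker theta)%:R - (M \subset cfker theta)%:R)); last first.
  by move=> M /and3P[sKM sMH _]; rewrite evB !ev_hat.
have zero M : [&& K \subset M, M \subset H & minnormal (M / K)%g (H / K)%g] ->
   (K \subset cfker theta) = (M \subset cfker theta) ->
   \prod_(M : {group gT} | [&& K \subset M, M \subset H & minnormal (M / K)%g (H / K)%g])
     ((K \subset cfker theta)%:R - (M \subset cfker theta)%:R) = 0 :> algC.
  by move=> MP KM; rewrite (bigD1 M) //= -KM subrr mul0r.
case: eqP => [Kth|/eqP nK].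
  rewrite Kth big1 // => M /and3P[sKM sMH minM]; rewrite subxx.
  case: (boolP (M \subset K)) => [sMK|_]; last by rewrite subr0.
  have /mingroupp /andP[] := minM; rewrite -subG1 quotient_sub1 ?sMK //.
  exact: fintype.subset_trans sMH (normal_norm nKH).
have /orP[sKk|sKk] := orbN (K \subset cfker theta); last first.
  have pKH : K \proper H by rewrite finset.properEneq eq_sym nHK.
  have [M [MP _]] := minnormal_between pKH (normal_refl H).
  have /and3P[sKM _ _] := MP.
  apply: (zero M MP); rewrite (negPf sKk); apply/esym/negP => sM.
  by move/negP: sKk; apply; apply: fintype.subset_trans sM.
have pK : K \proper cfker_group theta by rewrite finset.properEneq eq_sym nK.
have [M [MP sM]] := minnormal_between pK (cfker_normal theta).
by have := zero M MP; rewrite sKk sM; apply.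
Qed.

Lemma epsilon_idem : eps * eps = eps.
Proof.
apply/eqP; rewrite -subr_eq0; apply/eqP.
have ed := epsilon_der_part; have [eS _] := ed.
apply: (der_part_eq0 sHG); first by apply: der_partB => //; apply: der_partMl.
move=> i; have lin := lin_of_linear i; rewrite evB evM // ev_epsilon //.
by case: eqP; rewrite ?mulr1 ?mulr0 subrr.
Qed.

Variable theta : 'CF(H).
Hypothesis lin : theta \is a linear_char.
Hypothesis kth : cfker theta = K.

Lemma epsilon_ev1 : ev theta eps = 1.
Proof. by rewrite ev_epsilon // kth eqxx. Qed.

(* Hence epsilon (H, K) determines K, and its stabilizer normalizes K. *)
Lemma epsilon_stab x : x \in G -> (gelt x * eps = eps <-> x \in K).
Proof.
move=> xG; have ed := epsilon_der_part; have [eS _] := ed.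
have sKH := normal_sub nKH; split=> [xe|xK]; last first.
  have xH := subsetP sKH x xK; have xS := span_of_gelt G xH.
  apply/eqP; rewrite -subr_eq0; apply/eqP.
  apply: (der_part_eq0 sHG); first by apply: der_partB => //; apply: der_partMl.
  move=> i; have li := lin_of_linear i; rewrite evB // evM // ev_epsilon // ev_gelt //.
  case: eqP => [ki|]; last by rewrite mulr0 subrr.
  by rewrite cfker1 ?ki // lin_char1 // mulr1 subrr.
(* By [ev_epsilon] this coefficient is a sum of zeros and ones, divided by |H|, with a one at theta.
   It puts x in the support of epsilon(H, K), hence in H. *)
have co1 : co eps 1%g != 0.
  suff: ratr (co eps 1%g) != 0 :> algC by rewrite fmorph_eq0.
  rewrite (der_part_co sHG ed (group1 H)).
  have [j je] := linear_lin_of lin.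
  rewrite mulf_neq0 ?invr_eq0 ?pnatr_eq0 -?lt0n ?cardG_gt0 //.
  rewrite gt_eqF // (bigD1 j) //= -je epsilon_ev1 invg1 lin_char1 // mulr1.
  rewrite ltr_wpDr ?ltr01 //; apply: sumr_ge0 => i _.
  by rewrite ev_epsilon ?lin_of_linear // lin_char1 ?lin_of_linear // mulr1 ler0n.
have cox : co eps x != 0.
  by rewrite -{1}xe co_geltM ?mulVg //; apply: span_ofS eS.
have xH : x \in H.
  by apply: contraR cox => xH; rewrite (span_ofE sHG eS) co_lin // (negPf xH).
rewrite -kth cfkerEchar ?lin_charW // finset.in_set xH lin_char1 //.
have xS := span_of_gelt G xH.
by have := evM sHG lin xS eS; rewrite xe epsilon_ev1 mulr1 ev_gelt // => <- /=.
Qed.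

Lemma epsilon_conj_norm g : g \in G -> gconj eps g = eps -> g \in 'N_G(K)%g.
Proof.
move=> gG ge; rewrite finset.inE gG; apply/normP/eqP.
rewrite eqEcard cardJg leqnn andbT; apply/subsetP => y /imsetP[x xK ->].
have xG : x \in G by apply: (subsetP sHG); apply: (subsetP (normal_sub nKH)).
apply/epsilon_stab; first exact: groupJ.
by rewrite -gconj_gelt // -{1}ge -gconjM // (epsilon_stab xG).2.
Qed.
End Epsilon.

(** * Conjugates of strong Shoda pairs and of their Bass units *)

Section ConjugatePairs.
Variables (gT : finGroupType) (G : {group gT}).
Local Notation gmx := 'M[rat]_#|G|.
Local Notation hat := (@hat gT G).
Local Notation epsilon := (@epsilon gT G).
Implicit Types (a b : gmx) (H K M R : {group gT}) (g h : gT).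

Lemma conj_linear_char H R g (theta : 'CF(R)) : H \subset G -> g \in G ->
    R :=: (H :^ g)%g -> theta \is a linear_char ->
  exists theta' : 'CF(H), [/\ theta' \is a linear_char,
    forall x, x \in H -> theta' x = theta (x ^ g)%g,
    cfker theta = (cfker theta' :^ g)%g &
    forall a, span_of H a -> ev theta (gconj a g) = ev theta' a].
Proof.
move=> sHG gG RE lin.
have isoRH : isom R H (conjgm_morphism R g^-1%g).
  apply/isomP; split; first exact: injm_conj.
  by rewrite morphim_conj finset.setIid RE conjsgK.
have sRG : R \subset G by rewrite RE conj_subG.
have E x : x \in H -> cfIsom isoRH theta x = theta (x ^ g)%g.
  move=> xH; have xR : (x ^ g)%g \in R by rewrite RE memJ_conjg.
  by rewrite -(cfIsomE isoRH theta xR) /= /conjgm conjgK.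
have lin' : cfIsom isoRH theta \is a linear_char by rewrite cfIsom_lin_char.
exists (cfIsom isoRH theta); split=> //.
  apply/setP => x; rewrite mem_conjg !cfkerEchar ?lin_charW // !finset.in_set.
  have -> : (x \in R) = (x ^ g^-1 \in H)%g by rewrite RE mem_conjg.
  case: (boolP (x ^ g^-1 \in H)%g) => //= xH.
  by rewrite E // conjgKV !lin_char1.
move=> a [c ->]; rewrite gconj_sum !ev_sum; apply: eq_bigr => h hH.
have hG := subsetP sHG h hH; rewrite gconjZ !evZ gconj_gelt // (ev_gelt sHG) // (ev_gelt sRG) ?E //.
by rewrite RE memJ_conjg.
Qed.

Lemma shoda_sub H K : @strong_shoda_pair gT G H K -> H \subset G.
Proof.
by case=> _ /normal_sub sHN _ _ _; apply: fintype.subset_trans sHN (finset.subsetIl _ _).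
Qed.

Lemma shoda_normal H K : @strong_shoda_pair gT G H K -> (K <| H)%g.
Proof.
case=> sKH /normal_sub sHN _ _ _; rewrite /normal sKH.
exact: fintype.subset_trans sHN (finset.subsetIr _ _).
Qed.

(* The linear characters of H separate the elements of QH hat(H'), so no
   transport of the minimal normal subgroups of H / K is needed. *)
Lemma gconj_epsilon H K g : g \in G -> H \subset G -> (K <| H)%g -> cyclic (H / K)%g ->
    cyclic (H :^ g / K :^ g)%g ->
  gconj (epsilon H K) g = epsilon (H :^ g)%G (K :^ g)%G.
Proof.
move=> gG sHG nKH cHK cHKg; have sHgG : (H :^ g)%G \subset G by rewrite conj_subG.
have nKHg : ((K :^ g)%G <| (H :^ g)%G)%g by rewrite normalJ.
have [eS eD] := epsilon_der_part sHG nKH cHK.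
have sDG := sDG sHG.
apply/eqP; rewrite -subr_eq0; apply/eqP; apply: (der_part_eq0 sHgG).
  apply: der_partB; last exact: epsilon_der_part.
  split; first exact: span_of_gconj.
  have -> : hat (H :^ g)^`(1)%G = gconj (hat H^`(1)%G) g.
    by rewrite gconj_hat //; congr Defs.hat; rewrite /= derJ.
  by rewrite -gconjM // eD.
move=> i; have li := lin_of_linear i.
have [th [lin' _ kE evE]] := conj_linear_char sHG gG erefl li.
rewrite evB evE // !ev_epsilon // kE; apply/eqP; rewrite subr_eq0; apply/eqP.
by congr (_%:R); congr nat_of_bool; apply/eqP/eqP => [->//|/= /conjsg_inj].
Qed.

Lemma normaliser_conj K g : g \in G -> 'N_G(K :^ g)%g = ('N_G(K) :^ g)%g.
Proof. by move=> gG; rewrite normJ conjIg conjGid. Qed.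

(* The quotient of conjugation by g is an isomorphism N_G(K)/K -> N_G(K^g)/K^g. *)
Lemma conj_cyclic_max H K g : g \in G -> (H <| 'N_G(K))%g -> K \subset H -> cyclic (H / K)%g ->
    [max (H / K)%g of M | (M \subset ('N_G(K) / K)%g) && abelian M]%g ->
  cyclic (H :^ g / K :^ g)%g /\
  [max (H :^ g / K :^ g)%g of M | (M \subset ('N_G(K :^ g) / K :^ g)%g) && abelian M]%g.
Proof.
move=> gG nHN sKH cHK maxHK; rewrite normaliser_conj //.
move: nHN maxHK; rewrite -['N_G(K)%g]/(gval 'N_G(K)%G); 
have sNK : 'N_G(K)%G \subset 'N(K)%g by apply: finset.subsetIr.
move: 'N_G(K)%G sNK => N sNK nHN maxHK.
have nKN : (K <| N)%g.
  by rewrite /normal (fintype.subset_trans sKH (normal_sub nHN)).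
pose f := conjgm_morphism N g.
have injf : ('injm f)%g := injm_conj N g.
have sHN := normal_sub nHN.
have fH : (f @* H)%g = (H :^ g)%g by rewrite morphim_conj (finset.setIidPr sHN).
have fK : (f @* K)%g = (K :^ g)%g by rewrite morphim_conj (finset.setIidPr (normal_sub nKN)).
have fN : (f @* N)%g = (N :^ g)%g by rewrite morphim_conj finset.setIid.
(* The type of the quotient depends on K^g, which is abstracted to L and then replaced by the image
   of K. *)
suff main (L : {group gT}) : (f @* K)%g = L ->
  cyclic (H :^ g / L)%g /\
  [max (H :^ g / L)%g of M | (M \subset (N :^ g / L)%g) && abelian M]%g.
  exact: (main (K :^ g)%G).
move=> KL; have {KL}-> : L = (f @* K)%G by apply/val_inj/esym.
have inj2 : ('injm (quotm_morphism f nKN))%g by apply: injm_quotm.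
have qH : (quotm_morphism f nKN @* (H / K))%g = (f @* H / f @* K)%g by rewrite morphim_quotm.
have qN : (quotm_morphism f nKN @* (N / K))%g = (f @* N / f @* K)%g by rewrite morphim_quotm.
rewrite -fH -fN -qH -qN; have sq : (H / K \subset N / K)%g by apply: quotientS.
split; first by rewrite injm_cyclic.
have /maxgroupP[/andP[_ abH] maxH] := maxHK.
apply/maxgroupP; split; first by rewrite injm_abelian // abH andbT morphimS.
move=> M /andP[sMN abM] sHM.
have ME : M :=: (quotm_morphism f nKN @* (quotm_morphism f nKN @*^-1 M))%g.
  by rewrite morphpreK.
rewrite ME; congr (_ @* _)%g; apply: maxH.
  rewrite finset.subsetIl /= -(injm_abelian inj2) ?finset.subsetIl //=.
  by move: abM; rewrite {1}ME.
by rewrite -sub_morphim_pre.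
Qed.

Lemma shoda_conj H K g : g \in G ->
  @strong_shoda_pair gT G H K -> @strong_shoda_pair gT G (H :^ g)%G (K :^ g)%G.
Proof.
move=> gG ssp; have sHG := shoda_sub ssp; have nKH := shoda_normal ssp.
have [sKH nHN cHK maxHK orth] := ssp.
have [cHKg maxg] := conj_cyclic_max gG nHN sKH cHK maxHK.
have eE := gconj_epsilon gG sHG nKH cHK cHKg.
split; [by rewrite conjSg | by rewrite normaliser_conj // normalJ | exact: cHKg | exact: maxg |].
move=> g1 g2 g1G g2G; rewrite -eE; cbv zeta; rewrite (gconj_comp _ gG g1G) (gconj_comp _ gG g2G).
exact: orth (groupM gG g1G) (groupM gG g2G).
Qed.

Lemma unit_group_gconjE a g : g \in G -> unit_group G (gconj a g) <-> unit_group G a.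
Proof.
move=> gG; split; last exact: unit_group_gconj.
by rewrite -{2}(gconjK a gG); apply: unit_group_gconj; rewrite groupV.
Qed.

Lemma gconj_inj g : g \in G -> injective (fun a => gconj a g).
Proof. by move=> gG a b /(congr1 (fun c => gconj c g^-1%g)); rewrite !gconjK. Qed.

Lemma gconjMz a (c : int) g : gconj (a *~ c) g = gconj a g *~ c.
Proof. by rewrite -!scaler_int gconjZ. Qed.

Lemma gconj_bass_unit n k m a g : g \in G ->
  gconj (bass_unit n k m a) g = bass_unit n k m (gconj a g).
Proof.
move=> gG; have S j : gconj (\sum_(i < j) a ^+ i) g = \sum_(i < j) gconj a g ^+ i.
  by rewrite gconj_sum; apply: eq_bigr => i _; rewrite gconjX.
by rewrite /bass_unit gconjD gconjMz gconjX // !S.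
Qed.

Lemma generalized_bass_unit_gconj H h k m v g : H \subset G -> h \in H -> g \in G ->
  @generalized_bass_unit gT G H h k m v ->
  @generalized_bass_unit gT G (H :^ g)%G (h ^ g)%g k m (gconj v g).
Proof.
move=> sHG hH gG [n [nb /=]]; set x := 1 - _ + _ => -[xn bn ->].
have hG := subsetP sHG h hH.
exists n, nb => /=; set y := 1 - _ + _.
have yE : y = gconj x g.
  have hE : hat (H :^ g)^`(1)%g = gconj (hat H^`(1)%g) g.
    by rewrite (gconj_hat (M := H^`(1)%G)) ?sDG //= derJ.
  by rewrite /y hE /x gconjD gconjD gconjN gconj1 // gconjM // gconj_gelt.
have [n0 xn1 nmin] := xn; have [nb0 bnU nbmin] := bn.
have yX j : y ^+ j = gconj (x ^+ j) g by rewrite yE gconjX.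
have bX j : bass_unit n k m y ^+ j = gconj (bass_unit n k m x ^+ j) g.
  by rewrite yE -gconj_bass_unit // gconjX.
split; last exact: esym (bX nb).
  split; [exact: n0 | by rewrite yX xn1 gconj1 |].
  by move=> j j0; rewrite yX -(gconj1 gG) => /(gconj_inj gG); apply: nmin.
split; [exact: nb0 | by rewrite bX; apply: unit_group_gconj |].
by move=> j j0; rewrite bX => /(unit_group_gconjE _ gG); apply: nbmin.
Qed.

Lemma shoda_bass_units_gconj v g : g \in G ->
  shoda_bass_units G v -> shoda_bass_units G (gconj v g).
Proof.
move=> gG [H [K [h [k [m [ssp hH km [ck kn] bv]]]]]].
exists (H :^ g)%G, (K :^ g)%G, (h ^ g)%g, k, m.
split; [exact: shoda_conj | by rewrite memJ_conjg | exact: km | by rewrite orderJ |].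
exact: generalized_bass_unit_gconj (shoda_sub ssp) hH gG bv.
Qed.

Local Notation gen := (generated_in (unit_group G) (shoda_bass_units G)).

Lemma unit_groupV x y : unit_group G x -> x * y = 1 -> y * x = 1 -> unit_group G y.
Proof.
move=> [xZ [z zZ [xz zx]]] xy yx; have <- : z = y by rewrite -[z]mulr1 -xy mulrA zx mul1r.
by split=> //; exists x.
Qed.

Lemma shoda_bass_units_sub : (shoda_bass_units G `<=` unit_group G)%classic.
Proof. by move=> v [H [K [h [k [m [_ _ _ _ [n [nb /= [_ [_ bU _] ->]]]]]]]]]. Qed.

Lemma unit_group_is_subgroup : is_subgroup (unit_group G) (unit_group G).
Proof.
split=> //; first exact: unit_group1.
- by move=> x y; apply: unit_groupM.
- by move=> x y; apply: unit_groupV.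
Qed.

Lemma generated_is_subgroup : is_subgroup (unit_group G) gen.
Proof.
split.
- by move=> x gx; apply: gx; split; [apply: unit_group_is_subgroup | apply: shoda_bass_units_sub].
- by move=> A [[_ A1 _ _] _].
- by move=> x y gx gy A AP; have [[_ _ AM _] _] := AP; apply: AM; [apply: gx | apply: gy].
- move=> x y gx xy yx A AP; have [[_ _ _ AV] _] := AP.
  by apply: AV xy yx; apply: gx.
Qed.

Lemma generated_gconj x g : g \in G -> gen x -> gen (gconj x g).
Proof.
move=> gG gx A [[AU A1 AM AV] AX].
(* Minimality is applied to the preimage of A under conjugation by g. *)
suff : [set x | unit_group G x /\ A (gconj x g)]%classic x by case.
apply: gx; split; last first.
  move=> v vX; split; first exact: shoda_bass_units_sub.
  by apply: AX; apply: shoda_bass_units_gconj.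
split.
- by move=> y [].
- by split; [apply: unit_group1 | rewrite gconj1].
- by move=> y z [yU yA] [zU zA]; split; [apply: unit_groupM | rewrite gconjM //; apply: AM].
- move=> y z [yU yA] yz zy; split; first exact: unit_groupV yz zy.
  by apply: AV yA _ _; rewrite -gconjM // ?yz ?zy gconj1.
Qed.
End ConjugatePairs.

(** * Central characters and central units *)

Section CentralCharacters.
Variables (gT : finGroupType) (G : {group gT}).
Local Notation gmx := 'M[rat]_#|G|.
Local Notation gelt := (@gelt gT G).
Local Notation ZG := (integral_group_ring G).
Local Notation aG := (regular_repr algC G).
Local Notation R_G := (group_ring algC G).
Implicit Types (a b z : gmx) (g h x y : gT) (i : Iirr G) (H : {group gT}).

Definition liftC a : 'M[algC]_#|G| := map_mx (@ratr algC) a.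

Lemma liftC_gelt g : liftC (gelt g) = aG g.
Proof. exact: map_regular_mx. Qed.

Lemma liftCM a b : liftC (a * b) = liftC a *m liftC b.
Proof. exact: map_mxM. Qed.

Lemma liftC1 : liftC 1 = 1%:M.
Proof. exact: map_mx1. Qed.

Lemma liftC_span H a : H \subset G -> span_of H a ->
  liftC a = \sum_(h in H) ratr (co a h) *: aG h.
Proof.
move=> sHG aS; rewrite {1}(span_ofE sHG aS) /liftC raddf_sum; apply: eq_bigr => h hH /=.
by rewrite map_mxZ -[map_mx _ _]/(liftC _) liftC_gelt.
Qed.

Lemma liftC_ring a : span_of G a -> (liftC a \in R_G)%MS.
Proof.
move=> aS; rewrite (liftC_span (subxx G) aS) linear_sum summx_sub // => h hG.
by rewrite linearZ scalemx_sub //; apply: envelop_mx_id.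
Qed.

Lemma xcfun_liftC (chi : 'CF(G)) a : span_of G a -> xcfun chi (liftC a) = ev chi a.
Proof.
move=> aS; rewrite (liftC_span (subxx G) aS) raddf_sum; apply: eq_bigr => h hG /=.
by rewrite xcfunZr xcfunG.
Qed.

(* The scalar by which a central element acts in the irreducible
   representation affording chi_i. *)
Definition mode i a : algC := ev 'chi_i a / 'chi_i 1%g.

Definition central a := span_of G a /\ forall g, g \in G -> gelt g * a = a * gelt g.

Lemma central_liftC a : central a -> (liftC a \in 'Z(R_G))%MS.
Proof.
move=> [aS aC]; apply/center_mxP; split=> [|B /envelop_mxP[c ->]]; first exact: liftC_ring.
rewrite mulmx_suml mulmx_sumr; apply: eq_bigr => h hG.
by rewrite -scalemxAl -scalemxAr -liftC_gelt -!liftCM aC.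
Qed.

Lemma xcfun_central i z C : central z -> (C \in R_G)%MS ->
  xcfun 'chi_i (liftC z *m C) = mode i z * xcfun 'chi_i C.
Proof.
move=> zC CR; have [zS _] := zC; have zR := liftC_ring zS.
have om : xcfun (gring_irr_mode i) (liftC z) = mode i z.
  by rewrite gring_irr_mode.unlock xcfunZl xcfun_liftC // mulrC.
rewrite -irrRepr !xcfun_repr gring_opM // irr_gring_center ?central_liftC //.
by rewrite mul_scalar_mx mxtraceZ om.
Qed.

Lemma ev_central i z a : central z -> span_of G a ->
  ev 'chi_i (z * a) = mode i z * ev 'chi_i a.
Proof.
move=> zC aS; rewrite -!xcfun_liftC //; last by apply: span_ofM => //; case: zC.
by rewrite liftCM xcfun_central // liftC_ring.
Qed.

Lemma ev_irr1 (chi : 'CF(G)) : ev chi (1 : gmx) = chi 1%g.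
Proof. by rewrite -gelt1 ev_gelt. Qed.

Lemma modeM i a b : central a -> central b -> mode i (a * b) = mode i a * mode i b.
Proof. by move=> aC bC; rewrite {1}/mode ev_central ?mulrA //; case: bC. Qed.

Lemma mode1 i : mode i 1 = 1.
Proof. by rewrite /mode ev_irr1 divff ?irr1_neq0. Qed.

Lemma modeB i a b : mode i (a - b) = mode i a - mode i b.
Proof. by rewrite /mode evB mulrBl. Qed.

Lemma modeZ i q a : mode i (q *: a) = ratr q * mode i a.
Proof. by rewrite /mode evZ mulrA. Qed.

Lemma mode_aut (u : {rmorphism algC -> algC}) i a : mode (aut_Iirr u i) a = u (mode i a).
Proof.
rewrite /mode aut_IirrE ev_aut rmorphM fmorphV cfunE; congr (_ / _).
Qed.

Lemma centralM a b : central a -> central b -> central (a * b).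
Proof.
move=> [aS aC] [bS bC]; split; first exact: span_ofM.
by move=> g gG; rewrite mulrA aC // -mulrA bC // mulrA.
Qed.

Lemma co_geltMr y a g : y \in G -> g \in G -> span_of G a ->
  co (a * gelt y) g = co a (g * y^-1)%g.
Proof.
move=> yG gG aS; rewrite {1}(span_ofE (subxx _) aS) big_distrl /=.
rewrite (eq_bigr (fun h => co a h *: gelt (h * y)%g)) => [|h hG]; last first.
  by rewrite gscaleAl geltM.
rewrite (reindex_inj (mulIg y^-1%g)) /=.
rewrite (eq_big (fun h => h \in G) (fun h => co a (h * y^-1)%g *: gelt h)) => [|h|h _].
- by rewrite (co_lin (fun h => co a (h * y^-1)%g)) // gG.
- by rewrite groupMr ?groupV.
by rewrite mulgKV.
Qed.

Lemma central_co_conj z x y : central z -> x \in G -> y \in G -> co z (x ^ y)%g = co z x.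
Proof.
move=> [zS zC] xG yG.
have e1 : co (gelt y * z) (x * y)%g = co z (x ^ y)%g.
  by rewrite co_geltM ?groupM // conjgE mulgA.
have e2 : co (z * gelt y) (x * y)%g = co z x by rewrite co_geltMr ?groupM // mulgK.
by rewrite -e1 -e2 zC.
Qed.

(** Grouped by classes, the value is an integer combination of the numbers |C| chi(x) / chi(1),
    which are algebraic integers. *)
Lemma mode_Aint i z : central z -> ZG z -> mode i z \in Aint.
Proof.
move=> zC /int_ring_coP[_ zZ]; rewrite /mode /ev /extend sum_by_classes; last first.
  by move=> x y xG yG; rewrite central_co_conj // cfunJ.
rewrite mulr_suml rpred_sum // => C /repr_classesP[xG CE].
have /intrP[c ->] := zZ _ xG; rewrite rmorph_int mulrCA -mulrA rpredM ?Aint_int //.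
by have := Aint_class_div_irr1 i xG; rewrite -CE.
Qed.

Lemma mode_cyclotomic N i z : (#|G| %| N)%N -> in_cyclotomic N (mode i z).
Proof.
move=> GN; rewrite /mode /ev /extend mulr_suml; apply: in_cyclotomic_sum => h hG.
rewrite -mulrA mulrC; apply: in_cyclotomicM; last exact: in_cyclotomic_rat.
apply: in_cyclotomicM.
  apply: in_cyclotomic_char; first exact: irr_char.
  exact: dvdn_trans (order_dvdG hG) GN.
have /natrP[n ->] := Cnat_irr1 i.
by rewrite -(ratr_nat algC n) -fmorphV; apply: in_cyclotomic_rat.
Qed.

(* Evaluate the regular character on z g^-1. *)
Lemma central_co z g : central z -> g \in G ->
  ratr (co z g) = #|G|%:R^-1 * \sum_i 'chi_i 1%g * mode i z * 'chi_i g^-1%g.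
Proof.
move=> zC gG; have zS := zC.1.
have G0 : #|G|%:R != 0 :> algC by rewrite pnatr_eq0 -lt0n cardG_gt0.
apply: (mulfI G0); rewrite mulVKf //.
have gS : span_of G (gelt g^-1%g) by apply: span_of_gelt; rewrite groupV.
transitivity (ev (cfReg G) (z * gelt g^-1%g)).
  rewrite -zC.2 ?groupV // /ev /extend (bigD1 1%g) //= cfRegE eqxx.
  rewrite co_geltM ?groupV // invgK mulg1 mulrC big1 ?addr0 // => h /andP[_ /negPf h1].
  by rewrite cfRegE h1 mulr0.
rewrite cfReg_sum /ev /extend.
under eq_bigr do rewrite sum_cfunE big_distrr /=.
rewrite exchange_big /=; apply: eq_bigr => i _.
transitivity ('chi_i 1%g * ev 'chi_i (z * gelt g^-1%g)).
  by rewrite /ev /extend big_distrr; apply: eq_bigr => h _ /=; rewrite cfunE mulrCA.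
by rewrite ev_central // ev_gelt ?groupV // mulrA.
Qed.
End CentralCharacters.

(* The factor t collects the primes of N that do not divide m. *)
Lemma coprime_lift (m n N : nat) : (0 < m)%N -> (0 < N)%N -> coprime m n ->
  exists2 m', coprime m' N & (m' = m %[mod n])%N.
Proof.
move=> m0 N0 cmn; pose t := (N`_(\pi(m)^'))%N; exists (m + n * t)%N; last first.
  by rewrite addnC mulnC modnMDl.
apply: contraT => ncop.
have g1 : (1 < gcdn (m + n * t) N)%N.
  by rewrite ltn_neqAle eq_sym ncop gcdn_gt0 N0 orbT.
have [p pp] := pdivP g1; rewrite dvdn_gcd => /andP[pm pN].
have [pdm|pndm] := boolP (p %| m)%N.
  have pnt : (p %| n * t)%N by rewrite -(dvdn_addr _ pdm).
  move: pnt; rewrite Euclid_dvdM // => /orP[pn|pt].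
    have : (p %| gcdn m n)%N by rewrite dvdn_gcd pdm.
    by rewrite (eqP cmn) dvdn1 => /eqP p1; move: pp; rewrite p1.
  have := pnat_dvd pt (part_pnat (\pi(m)^') N).
  by rewrite pnatE // !inE mem_primes pp m0 pdm.
have pt : (p %| t)%N.
  have pn : (\pi(m)^').-nat p by rewrite pnatE // !inE mem_primes pp m0 (negPf pndm).
  by rewrite -(part_pnat_id pn) partn_dvd.
move: pm; rewrite dvdn_addl ?(negPf pndm) //.
by rewrite dvdn_mull.
Qed.

Section SameKernel.
Variables (N : nat) (N1 : (1 < N)%N) (gT : finGroupType) (H K : {group gT}).
Hypotheses (HN : (#|H| %| N)%N) (nKH : (K <| H)%g) (cHK : cyclic (H / K)%g).

Lemma linear_expN (theta : 'CF(H)) h : theta \is a linear_char -> h \in H -> theta h ^+ N = 1.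
Proof.
move=> lin hH; have /dvdnP[q ->] := dvdn_trans (order_dvdG hH) HN.
by rewrite mulnC exprM lin_char_unity_root // expr1n.
Qed.

Lemma cyclo_aut_linear k (theta : 'CF(H)) h : theta \is a linear_char -> h \in H ->
  cfAut (cyclo_aut N1 k) theta h = theta h ^+ uexp k.
Proof. by move=> lin hH; rewrite cfunE cyclo_autE // linear_expN. Qed.

(** Both characters are faithful on the cyclic group H / K and send a generator to primitive roots
    of the same order n; [coprime_lift] makes the exponent relating them prime to N. *)
Lemma same_kernel_conjugate (theta theta' : 'CF(H)) :
    theta \is a linear_char -> theta' \is a linear_char ->
    cfker theta = K -> cfker theta' = K ->
  exists k, theta' = cfAut (cyclo_aut N1 k) theta.
Proof.
move=> lin lin' kth kth'; have sKH := normal_sub nKH.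
have /cyclicP[X XE] := cHK.
have XH : X \in (H / K)%g by rewrite XE cycle_id.
have /morphimP[x xN xH XEx] := XH.
have kerE (t : 'CF(H)) (j : nat) : t \is a linear_char -> cfker t = K ->
    (t x ^+ j == 1) = (#|(H / K)%g| %| j)%N.
  move=> lt kt; have xjH : (x ^+ j)%g \in H by rewrite groupX.
  have -> : #|(H / K)%g| = #[X]%g by rewrite XE.
  rewrite -lin_charX // order_dvdn XEx -morphX //.
  have -> : (t (x ^+ j)%g == 1) = ((x ^+ j)%g \in K).
    by rewrite -kt cfkerEchar ?lin_charW // finset.in_set xjH lin_char1.
  apply/idP/eqP => [xK|]; first exact: coset_id.
  by apply: coset_idr; rewrite groupX.
set n := #|(H / K)%g| in kerE.
have n0 : (0 < n)%N by apply: cardG_gt0.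
have prim (t : 'CF(H)) : t \is a linear_char -> cfker t = K -> n.-primitive_root (t x).
  move=> lt kt; have tn : t x ^+ n = 1 by apply/eqP; rewrite kerE.
  have [m pm mn] := prim_order_exists n0 tn.
  have nm : (n %| m)%N by rewrite -(kerE t) // (prim_expr_order pm).
  by have /eqP <- : m == n by rewrite eqn_dvd mn.
have [i tE] := prim_rootP (prim _ lin kth) (prim_expr_order (prim _ lin' kth')).
(* i may be 0 when n = 1, and [coprime_lift] needs a positive number. *)
have cin : coprime (i + n) n.
  rewrite -coprime_modl modnDr coprime_modl -(prim_root_exp_coprime _ (prim _ lin kth)) -tE.
  exact: prim.
have [|m' cm' m'E] := @coprime_lift (i + n) n N _ (ltnW N1) cin.
  by rewrite addn_gt0 n0 orbT.
have [k kE] := uexp_surj N1 cm'; exists k.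
apply/cfun_inP => h hH; rewrite cyclo_aut_linear //.
have hN : h \in 'N(K)%g by apply: (subsetP (normal_norm nKH)).
have : coset K h \in (H / K)%g by apply: mem_quotient.
rewrite XE => /cycleP[a]; rewrite XEx -morphX // => e.
have [y yK hE] : exists2 y, y \in K & h = (y * x ^+ a)%g.
  have := introT (rcoset_kercosetP hN (groupX a xN)) e; case/rcosetP=> y yK ->.
  by exists y.
have yH := subsetP sKH y yK; have xaH := groupX a xH.
have val1 (t : 'CF(H)) : t \is a linear_char -> cfker t = K -> t h = t x ^+ a.
  move=> lt kt; rewrite hE lin_charM // lin_charX // (_ : t y = 1) ?mul1r //.
  by rewrite cfker1 ?kt // lin_char1.
have thN := prim_expr_order (prim _ lin kth).
have nN : (n %| N)%N by apply: dvdn_trans (dvdn_quotient H K) HN.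
have ik : theta x ^+ i = theta x ^+ uexp k.
  rewrite -(expr_mod (uexp k) thN) kE modn_dvdm // m'E modnDr expr_mod //.
by rewrite !val1 // tE ik -!exprM mulnC.
Qed.
End SameKernel.

(** For [conj_prod]: conjugation by an element of G only permutes its factors. *)
Lemma prod_perm_comm (T : pzRingType) (I : eqType) (F : I -> T) (s t : seq I) :
    {in s &, forall i j, F i * F j = F j * F i} -> perm_eq s t ->
  \prod_(i <- s) F i = \prod_(i <- t) F i.
Proof.
have extract (r : seq I) i : {in r &, forall i j, F i * F j = F j * F i} -> i \in r ->
    \prod_(j <- r) F j = F i * \prod_(j <- rem i r) F j.
  elim: r => // j r IH comm; rewrite in_cons big_cons /=.
  have [->|ji] := eqVneq j i => [//|] /= ir.
  rewrite big_cons IH //; last by move=> x y xr yr; apply: comm; rewrite in_cons ?xr ?yr orbT.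
  by rewrite !mulrA (comm j i) // in_cons ?eqxx ?ir ?orbT.
elim: s t => [|i s IH] t comm st.
  by have /perm_size /esym /eqP := st; rewrite size_eq0 => /eqP ->.
have it : i \in t by rewrite -(perm_mem st) in_cons eqxx.
have ct : {in t &, forall i j, F i * F j = F j * F i}.
  by move=> x y; rewrite -!(perm_mem st); apply: comm.
rewrite big_cons (extract t i) // (IH (rem i t)) //.
  by move=> x y xs ys; apply: comm; rewrite in_cons ?xs ?ys orbT.
by rewrite -(perm_cons i) (perm_trans st) // perm_to_rem.
Qed.

(** * The product of the conjugates of a component *)

Section ConjugateProduct.
Variables (N : nat) (N1 : (1 < N)%N).
Variables (gT : finGroupType) (G : {group gT}) (GN : (#|G| %| N)%N).
Variables (H K : {group gT}) (ssp : @strong_shoda_pair gT G H K).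
Variables (theta : 'CF(H)) (lin : theta \is a linear_char) (kth : cfker theta = K).
Variables (i0 : Iirr G) (chiE : 'chi_i0 = 'Ind[G] theta).
Local Notation gmx := 'M[rat]_#|G|.
Local Notation hat := (@hat gT G).
Local Notation eps := (@epsilon gT G H K).
Local Notation D := H^`(1)%G.
Local Notation aG := (regular_repr algC G).
Local Notation R_G := (group_ring algC G).
Local Notation lin_of := (@lin_of gT H).
Implicit Types (a b : gmx) (g h x y : gT).

Let sHG : H \subset G := shoda_sub ssp.
Let nKH : (K <| H)%g := shoda_normal ssp.
Let cHK : cyclic (H / K)%g. Proof. by case: ssp. Qed.
Let nHN : (H <| 'N_G(K))%g. Proof. by case: ssp. Qed.
Let HN : (#|H| %| N)%N := dvdn_trans (cardSg sHG) GN.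

Lemma eps_der : der_part H eps. Proof. exact: epsilon_der_part. Qed.
Lemma eps_span : span_of H eps. Proof. by case: eps_der. Qed.

Lemma eps_orth g : g \in G -> gconj eps g <> eps -> eps * gconj eps g = 0 /\ gconj eps g * eps = 0.
Proof.
move=> gG ne; have [_ _ _ _ orth] := ssp.
have := orth 1%g g (group1 G) gG; have := orth g 1%g gG (group1 G).
rewrite /= gconj_id => h1 h2; split; last exact: h1.
by apply: h2 => e; apply: ne.
Qed.

Lemma norm_conj g : g \in 'N_G(K)%g -> g \in G /\ (H :^ g)%G = H.
Proof.
move=> gN; have gG : g \in G by move: gN; rewrite finset.inE => /andP[].
by split=> //; apply/val_inj/normP/(subsetP (normal_norm nHN)).
Qed.

Lemma der_part_gconj g a : g \in 'N_G(K)%g -> der_part H a -> der_part H (gconj a g).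
Proof.
move=> gN [aS aD]; have [gG Hg] := norm_conj gN; split.
  by have := span_of_gconj sHG gG aS; rewrite Hg.
have -> : hat D = gconj (hat D) g.
  by rewrite (gconj_hat (sDG sHG) gG) /= -derJ -[(H :^ g)%g]/(gval (H :^ g)%G) Hg.
by rewrite -gconjM // aD.
Qed.

Variables (gen : set gmx) (d : gmx).
Hypothesis gen_sub : is_subgroup (unit_group G) gen.
Hypothesis gen_conj : forall a g, g \in G -> gen a -> gen (gconj a g).
Hypothesis dd : der_part H d.
Hypothesis deps : d * eps = d.
Hypothesis gen_w : gen (1 + d).

Let epsd : eps * d = d. Proof. by rewrite -(der_part_comm sHG dd eps_der). Qed.

(** If g fixes epsilon(H, K), it normalizes H and both factors lie in the commutative ring QH
    hat(H'); otherwise orthogonality makes both products 0. *)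
Lemma component_conj_comm g : g \in G -> d * gconj d g = gconj d g * d.
Proof.
move=> gG; have [e|ne] := pselect (gconj eps g = eps).
  have gN := epsilon_conj_norm sHG nKH cHK lin kth gG e.
  by apply: (der_part_comm sHG) => //; apply: der_part_gconj.
have [o1 o2] := eps_orth gG ne.
have e1 : gconj d g = gconj eps g * gconj d g by rewrite -gconjM // epsd.
have e2 : gconj d g = gconj d g * gconj eps g by rewrite -gconjM // deps.
rewrite -{1}deps e1 -mulrA [eps * _]mulrA o1 mul0r mulr0.
by rewrite -e1 e2 -[in RHS]epsd -mulrA [gconj eps g * _]mulrA o2 mul0r mulr0.
Qed.

Lemma gconj_add1 g : g \in G -> gconj (1 + d) g = 1 + gconj d g.
Proof. by move=> gG; rewrite gconjD gconj1. Qed.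

(* The factors commute, so the order of enumeration is irrelevant. *)
Definition conj_prod : gmx := \prod_(g <- enum G) gconj (1 + d) g.

Lemma conj_factors_comm :
  {in enum G &, forall g h, gconj (1 + d) g * gconj (1 + d) h = gconj (1 + d) h * gconj (1 + d) g}.
Proof.
move=> g h; rewrite !mem_enum => gG hG.
have hgG : (h * g^-1)%g \in G by rewrite groupM ?groupV.
have -> : gconj (1 + d) h = gconj (gconj (1 + d) (h * g^-1)%g) g.
  by rewrite gconj_comp // mulgKV.
rewrite -!gconjM // gconj_add1 //; congr (gconj _ _).
by rewrite !mulrDl !mulrDr !mul1r !mulr1 component_conj_comm // addrACA.
Qed.

Lemma conj_prod_gconj x : x \in G -> gconj conj_prod x = conj_prod.
Proof.
move=> xG; rewrite /conj_prod gconj_prod //.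
transitivity (\prod_(g <- [seq (g * x)%g | g <- enum G]) gconj (1 + d) g).
  rewrite big_map big_seq [RHS]big_seq; apply: eq_bigr => g; rewrite mem_enum => gG.
  exact: gconj_comp.
apply/esym/prod_perm_comm; first exact: conj_factors_comm.
apply: uniq_perm; rewrite ?enum_uniq ?map_inj_uniq ?enum_uniq //; first exact: mulIg.
move=> g; rewrite mem_enum; apply/idP/mapP => [gG|[h]].
  by exists (g * x^-1)%g; rewrite ?mem_enum ?mulgKV // groupM ?groupV.
by rewrite mem_enum => hG ->; apply: groupM.
Qed.

Lemma d_span : span_of G d. Proof. exact: span_ofS sHG (dd.1). Qed.

Lemma gconj_span g a : g \in G -> span_of G a -> span_of G (gconj a g).
Proof.
by move=> gG aS; do 2?apply: span_ofM => //; apply: span_of_gelt; rewrite ?groupV.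
Qed.

Lemma conj_prod_central : central conj_prod.
Proof.
split; last by move=> g gG; apply: gelt_comm_gconj => //; apply: conj_prod_gconj.
rewrite /conj_prod big_seq; apply: span_of_prod => // g; rewrite mem_enum => gG.
apply: gconj_span => //; apply: span_ofD; [exact: span_of1 | exact: d_span].
Qed.

Lemma conj_prod_gen : gen conj_prod.
Proof.
have [_ g1 gM _] := gen_sub; rewrite /conj_prod big_seq.
by elim/big_ind: _ => // g; rewrite mem_enum => gG; apply: gen_conj.
Qed.

Definition idem_stab := #|[set g in G | gconj eps g == eps]%SET|.

(* The sum of the distinct conjugates of epsilon (H, K). *)
Definition central_idem : gmx := idem_stab%:R^-1 *: \sum_(g in G) gconj eps g.

Lemma idem_stab_gt0 : (0 < idem_stab)%N.
Proof.
by apply/card_gt0P; exists 1%g; rewrite finset.in_set group1 gconj_id eqxx.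
Qed.

Lemma eps_central_idem : eps * central_idem = eps.
Proof.
rewrite /central_idem gscaleAr big_distrr /=.
rewrite (bigID (fun g => gconj eps g == eps)) /= [X in _ + X]big1 ?addr0; last first.
  by move=> g /andP[gG /eqP ne]; have [-> _] := eps_orth gG ne.
rewrite (eq_bigr (fun=> eps)) => [|g /andP[_ /eqP ->]]; last exact: epsilon_idem.
rewrite sumr_const -scaler_nat scalerA (_ : #|_| = idem_stab); last first.
  by apply: eq_card => g; rewrite finset.in_set.
by rewrite mulVf ?scale1r // pnatr_eq0 -lt0n idem_stab_gt0.
Qed.

Lemma central_idem_gconj x : x \in G -> gconj central_idem x = central_idem.
Proof.
move=> xG; rewrite /central_idem gconjZ gconj_sum; congr (_ *: _).
rewrite [RHS](reindex_inj (mulIg x)) /=; apply: eq_big => [g|g gG].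
  by rewrite groupMr.
exact: gconj_comp.
Qed.

Lemma central_idem_central : central central_idem.
Proof.
split; last by move=> g gG; apply: gelt_comm_gconj => //; apply: central_idem_gconj.
apply: span_ofZ; apply: span_of_sum => g gG; apply: gconj_span => //.
exact: span_ofS sHG eps_span.
Qed.

Lemma conj_prod_compl : conj_prod * (1 - central_idem) = 1 - central_idem.
Proof.
have e0 : (1 + d) * (1 - central_idem) = 1 - central_idem.
  rewrite mulrDl mul1r -{1}deps -mulrA mulrBr mulr1 eps_central_idem subrr mulr0.
  exact: addr0.
rewrite /conj_prod.
have : {subset enum G <= G} by move=> g; rewrite mem_enum.
elim: (enum G) => [|g s IH] sG; first by rewrite big_nil mul1r.
have gG : g \in G by apply: sG; rewrite in_cons eqxx.
rewrite big_cons -mulrA IH; last by move=> x xs; apply: sG; rewrite in_cons xs orbT.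
have {1}-> : 1 - central_idem = gconj (1 - central_idem) g.
  by rewrite gconjD gconjN gconj1 // central_idem_gconj.
by rewrite -gconjM // e0 gconjD gconjN gconj1 // central_idem_gconj.
Qed.

Lemma ev_gconj (phi : 'CF(G)) a g : g \in G -> span_of G a -> ev phi (gconj a g) = ev phi a.
Proof.
move=> gG [c ->]; rewrite gconj_sum !ev_sum; apply: eq_bigr => h hG.
by rewrite gconjZ !evZ gconj_gelt // !ev_gelt ?groupJ // cfunJ.
Qed.

Lemma ev_Res (phi : 'CF(G)) a : span_of H a -> ev phi a = ev ('Res[H] phi) a.
Proof.
move=> [c ->]; rewrite !ev_sum; apply: eq_bigr => h hH.
by rewrite !evZ (ev_gelt sHG) // ev_gelt ?(subsetP sHG) // cfResE.
Qed.

Lemma ev_der_part (phi : 'CF(H)) a : der_part H a ->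
  ev phi a = \sum_i ev (lin_of i) a * '[phi, lin_of i].
Proof.
move=> ad; rewrite {1}/ev /extend.
rewrite (eq_bigr (fun h => \sum_i #|H|%:R^-1 * ev (lin_of i) a * (phi h * (lin_of i h)^*))).
  rewrite exchange_big; apply: eq_bigr => i _ /=.
  by rewrite -big_distrr /= cfdotE mulrCA mulrA.
move=> h hH; rewrite (der_part_co sHG ad hH) big_distrr big_distrl; apply: eq_bigr => i _ /=.
rewrite lin_charV_conj ?lin_of_linear //.
by rewrite -!mulrA; congr (_ * (_ * _)); rewrite mulrC.
Qed.

(** Only linear characters with kernel K see epsilon(H, K). They are Galois conjugates of theta, so
    by Frobenius reciprocity they occur only in conjugates of chi_i0. *)
Lemma ev_eps_off i : (forall k, i != aut_Iirr (cyclo_aut N1 k) i0) -> ev 'chi_i eps = 0.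
Proof.
move=> off; rewrite (ev_Res _ eps_span) (ev_der_part _ eps_der) big1 // => j _.
have lj := lin_of_linear j; rewrite (ev_epsilon sHG nKH lj).
case: eqP => [kj|]; last by rewrite mul0r.
have [k jE] := same_kernel_conjugate N1 HN nKH cHK lin lj kth kj.
rewrite mul1r cfdot_Res_l jE -cfAutInd -chiE -aut_IirrE cfdot_irr.
by rewrite (negPf (off k)).
Qed.

(** 1 - [central_idem] acts as 1 on such a character, and [conj_prod] fixes it by multiplication. *)
Lemma mode_conj_prod_off i : (forall k, i != aut_Iirr (cyclo_aut N1 k) i0) ->
  mode i conj_prod = 1.
Proof.
move=> off; have cE := central_idem_central.
have cz := conj_prod_central.
have E0 : mode i central_idem = 0.
  rewrite modeZ /mode ev_sum big1 ?mul0r ?mulr0 // => g gG.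
  by rewrite (ev_gconj _ gG (span_ofS sHG eps_span)) ev_eps_off.
have c1 : central (1 - central_idem).
  split; first by apply: span_ofB; [apply: span_of1 | case: cE].
  by move=> g gG; rewrite mulrBl mulrBr mul1r mulr1 cE.2.
have := modeM i cz c1; rewrite conj_prod_compl modeB mode1 E0 subr0 mulr1.
by move=> <-.
Qed.

(* The idempotent through which H acts by t: central characters of Ind t are
   computed by their action on it. *)
Definition char_idem (t : 'CF(H)) : 'M[algC]_#|G| :=
  #|H|%:R^-1 *: \sum_(h in H) t h^-1%g *: aG h.

Lemma char_idem_ring t : (char_idem t \in R_G)%MS.
Proof.
rewrite linearZ scalemx_sub // linear_sum summx_sub // => h hH.
by rewrite linearZ scalemx_sub //; apply: envelop_mx_id; apply: (subsetP sHG).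
Qed.

Lemma liftC_char_idem a : span_of H a -> liftC a *m char_idem theta = ev theta a *: char_idem theta.
Proof.
move=> aS; rewrite (liftC_span sHG aS) mulmx_suml scaler_suml; apply: eq_bigr => x xH.
rewrite -scalemxAl -[RHS]scalerA; congr (_ *: _).
rewrite /char_idem -scalemxAr [RHS]scalerA [theta x * _]mulrC -[RHS]scalerA; congr (_ *: _).
rewrite mulmx_sumr scaler_sumr [LHS](reindex_inj (mulgI x^-1%g)) /=.
apply: eq_big => [h|h]; first by rewrite groupMl ?groupV.
rewrite groupMl ?groupV // => hH.
rewrite -scalemxAr -repr_mxM ?groupM ?groupV ?(subsetP sHG) // mulKVg scalerA.
by rewrite invMg invgK lin_charM ?groupV // mulrC.
Qed.

Lemma xcfun_char_idem : xcfun 'chi_i0 (char_idem theta) = 1.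
Proof.
rewrite /char_idem xcfunZr raddf_sum /=.
transitivity '['Res[H] 'chi_i0, theta].
  rewrite cfdotE; congr (_ * _); apply: eq_bigr => h hH.
  by rewrite xcfunZr xcfunG ?(subsetP sHG) // cfResE // lin_charV_conj // mulrC.
by rewrite cfdot_Res_l -chiE cfnorm_irr.
Qed.

(** For g in N_G(K) the factor stays in QH and acts through theta. Otherwise it fixes epsilon(H, K)
    by orthogonality, and [char_idem theta] is fixed by epsilon(H, K). *)
Lemma liftC_conj_char_idem g : g \in G ->
  liftC (gconj (1 + d) g) *m char_idem theta =
    (if g \in 'N_G(K)%g then ev theta (gconj (1 + d) g) else 1) *: char_idem theta.
Proof.
move=> gG; case: ifP => gN.
  apply: liftC_char_idem; rewrite gconj_add1 //; apply: span_ofD; first exact: span_of1.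
  by have [] := der_part_gconj gN dd.
have ne : gconj eps g <> eps.
  by move=> e; rewrite (epsilon_conj_norm sHG nKH cHK lin kth gG e) in gN.
have [_ o2] := eps_orth gG ne.
have e2 : gconj d g = gconj d g * gconj eps g by rewrite -gconjM // deps.
have we : gconj (1 + d) g * eps = eps.
  by rewrite gconj_add1 // mulrDl mul1r e2 -mulrA o2 mulr0 addr0.
have epsC : liftC eps *m char_idem theta = char_idem theta.
  by rewrite (liftC_char_idem eps_span) (epsilon_ev1 sHG nKH lin kth) scale1r.
by rewrite scale1r -{1}epsC mulmxA -liftCM we.
Qed.

Lemma mode_conj_prod :
  mode i0 conj_prod = \prod_(g in 'N_G(K)%g) ev theta (gconj (1 + d) g).
Proof.
have := xcfun_central i0 conj_prod_central (char_idem_ring theta).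
rewrite xcfun_char_idem mulr1 => <-.
pose c g := if g \in 'N_G(K)%g then ev theta (gconj (1 + d) g) else 1.
have -> : liftC conj_prod *m char_idem theta = (\prod_(g <- enum G) c g) *: char_idem theta.
  rewrite /conj_prod.
  have : {subset enum G <= G} by move=> g; rewrite mem_enum.
  elim: (enum G) => [|g s IH] sG; first by rewrite !big_nil liftC1 mul1mx scale1r.
  have gG : g \in G by apply: sG; rewrite in_cons eqxx.
  rewrite !big_cons liftCM -mulmxA IH; last by move=> x xs; apply: sG; rewrite in_cons xs orbT.
  by rewrite -scalemxAr liftC_conj_char_idem // scalerA mulrC.
rewrite xcfunZr xcfun_char_idem mulr1 big_enum /= [RHS]big_mkcond [LHS]big_mkcond /=.
by apply: eq_bigr => g _; rewrite /c finset.in_setI; case: (g \in G).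
Qed.

(** g in N_G(K) moves theta to a linear character with the same kernel, a Galois conjugate. Both
    induce chi_i0, so that automorphism fixes i0. *)
Lemma mode_conj_prod_aut : exists kap : gT -> {unit 'Z_N},
  (forall g, g \in 'N_G(K)%g -> aut_Iirr (cyclo_aut N1 (kap g)) i0 = i0) /\
  mode i0 conj_prod = \prod_(g in 'N_G(K)%g) cyclo_aut N1 (kap g) (ev theta (1 + d)).
Proof.
have /boolp.choice[kap kapP] (g : gT) : exists k, g \in 'N_G(K)%g ->
    aut_Iirr (cyclo_aut N1 k) i0 = i0 /\
    ev theta (gconj (1 + d) g) = cyclo_aut N1 k (ev theta (1 + d)).
  have [gN|] := boolP (g \in 'N_G(K)%g); last by exists 1%g.
  have [gG Hg] := norm_conj gN; have Hg' : H :=: (H :^ g)%g by rewrite -[in LHS]Hg.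
  have [t [lt tE ker evE]] := conj_linear_char sHG gG Hg' lin.
  have kt : cfker t = K.
    apply: (@conjsg_inj _ g); rewrite -ker kth; apply/esym/normP.
    by move: gN; rewrite finset.in_setI => /andP[].
  have [k kE] := same_kernel_conjugate N1 HN nKH cHK lin lt kth kt.
  exists k => _; split; last first.
    rewrite evE ?kE ?ev_aut //; apply: span_ofD; [exact: span_of1 | by case: dd].
  apply: irr_inj; rewrite aut_IirrE chiE cfAutInd -kE.
  apply/cfun_inP => x xG; rewrite !cfIndE //; congr (_ * _).
  rewrite [RHS](reindex_inj (mulIg g)) /=; apply: eq_big => y; first by rewrite groupMr.
  move=> yG; rewrite conjgM; case: (boolP (x ^ y \in H)%g) => xyH; first exact: tE.
  by rewrite !cfun0 // Hg' memJ_conjg.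
exists kap; split; first by move=> g /kapP[].
by rewrite mode_conj_prod; apply: eq_bigr => g /kapP[].
Qed.
End ConjugateProduct.

(** * The dual criterion for the centre *)

Section GaloisOrbits.
Variables (N : nat) (N1 : (1 < N)%N) (gT : finGroupType) (G : {group gT}).
Hypothesis GN : (#|G| %| N)%N.
Implicit Types (i j : Iirr G) (k l : {unit 'Z_N}).
Local Notation act k i := (aut_Iirr (cyclo_aut N1 k) i).

Lemma gal_actM k l i : act (k * l)%g i = act k (act l i).
Proof.
apply: irr_inj; rewrite !aut_IirrE; apply/cfun_inP => g gG; rewrite !cfunE.
apply: cyclo_autM; apply: in_cyclotomic_char; first exact: irr_char.
exact: dvdn_trans (order_dvdG gG) GN.
Qed.

Lemma gal_act1 i : act 1%g i = i.
Proof. by apply: (@aut_Iirr_inj _ _ (cyclo_aut N1 1)); rewrite -gal_actM mulg1. Qed.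

Lemma sum_gal_act (T : nmodType) (F : Iirr G -> T) k : \sum_i F (act k i) = \sum_i F i.
Proof. by rewrite [RHS](reindex_inj (@aut_Iirr_inj _ _ (cyclo_aut N1 k))). Qed.

(** Double counting: orbit sums over units are constant on the orbit and vanish off it, and their
    total is a multiple of sum_i F(i). *)
Lemma orbit_sum0 (R : realType) (F : Iirr G -> R) i0 :
    (forall i, (forall k, i != act k i0) -> F i = 0) -> \sum_i F i = 0 ->
  \sum_k F (act k i0) = 0.
Proof.
move=> off F0; pose S i := \sum_k F (act k i).
have Son l : S (act l i0) = S i0.
  rewrite /S [RHS](reindex_inj (mulIg l)); apply: eq_bigr => k _ /=.
  by rewrite gal_actM.
have Soff i : (forall k, i != act k i0) -> S i = 0.
  move=> ni; rewrite /S big1 // => k _; apply: off => l; apply: contra (ni (k^-1 * l)%g).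
  by move=> /eqP e; rewrite gal_actM -e -gal_actM mulVg gal_act1.
have tot : \sum_i S i = 0.
  rewrite /S exchange_big big1 // => k _; rewrite sum_gal_act //.
pose P := [pred i | [exists k, i == act k i0]].
have : \sum_i S i = S i0 *+ #|P|.
  rewrite (bigID P) /= [X in _ + X]big1 ?addr0; last first.
    move=> i /existsPn ni; exact: Soff.
  rewrite (eq_bigr (fun=> S i0)) => [|i /existsP[k /eqP ->]]; last exact: Son.
  by rewrite sumr_const.
rewrite tot => /esym/eqP; rewrite mulrn_eq0 => /orP[|/eqP //].
rewrite -leqn0 leqNgt => /negP[]; apply/card_gt0P; exists i0.
by apply/existsP; exists 1%g; rewrite gal_act1.
Qed.

Lemma sum_orbit_sum0 (R : realType) (F : Iirr G -> R) :
  (forall i, \sum_k F (act k i) = 0) -> \sum_i F i = 0.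
Proof.
move=> F0; have : \sum_i \sum_k F (act k i) = 0 by rewrite big1.
rewrite exchange_big (eq_bigr (fun=> \sum_i F i)) => [|k _]; last exact: sum_gal_act.
rewrite sumr_const => /eqP; rewrite mulrn_eq0 => /orP[|/eqP //].
by rewrite -leqn0 leqNgt => /negP[]; apply/card_gt0P; exists 1%g.
Qed.
End GaloisOrbits.

Lemma ln_prod (R : realType) (I : Type) (s : seq I) (P : pred I) (F : I -> R) : (forall i, 0 < F i) ->
  ln (\prod_(i <- s | P i) F i) = \sum_(i <- s | P i) ln (F i).
Proof.
move=> F0; suff [] : 0 < \prod_(i <- s | P i) F i /\
    ln (\prod_(i <- s | P i) F i) = \sum_(i <- s | P i) ln (F i) by [].
elim/big_rec2: _ => [|i x y _ [x0 xE]]; first by rewrite ln1.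
by split; [rewrite mulr_gt0 | rewrite lnM ?posrE // xE].
Qed.

(** * Logarithms of central units *)

Section Center.
Variables (R : realType) (N : nat) (N1 : (1 < N)%N).
Variables (gT : finGroupType) (G : {group gT}).
Hypothesis GN : (#|G| %| N)%N.
Local Notation phi := (@algC_embed R).
Local Notation gmx := 'M[rat]_#|G|.
Local Notation Z := (center_of (unit_group G)).
Local Notation act k i := (aut_Iirr (cyclo_aut N1 k) i).
Implicit Types (a b u z : gmx) (g h : gT) (i j : Iirr G) (k l : {unit 'Z_N}).

(** Elements of G are units of ZG, so commuting with the units is enough. *)
Lemma center_central z : Z z -> central z.
Proof.
move=> [[zZ _] zC]; split; first exact: int_ring_span.
by move=> g gG; rewrite zC //; apply: unit_group_gelt.
Qed.

Lemma central_comm z a : central z -> span_of G a -> z * a = a * z.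
Proof.
move=> [_ zC] [c ->]; rewrite big_distrr big_distrl; apply: eq_bigr => h hG /=.
by rewrite gscaleAr gscaleAl zC.
Qed.

Lemma centralP z : unit_group G z -> central z -> Z z.
Proof.
move=> zU zC; split=> // u [uZ _]; apply: central_comm => //; exact: int_ring_span.
Qed.

Lemma center_inv z : Z z -> exists z', [/\ Z z', z * z' = 1 & z' * z = 1].
Proof.
move=> hz; have [[zZ [z' z'Z [zz' z'z]]] _] := hz; have zC := center_central hz.
have z'U : unit_group G z' by split=> //; exists z.
exists z'; split=> //; apply: centralP => //; split; first exact: int_ring_span.
move=> g gG; have := zC.2 g gG => e.
by rewrite -[LHS]mul1r -z'z -mulrA [z * _]mulrA -e -[_ * z * z']mulrA zz' mulr1.
Qed.

Lemma centerM x z : Z x -> Z z -> Z (x * z).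
Proof.
move=> hx hz; apply: centralP; last by apply: centralM; apply: center_central.
by apply: unit_groupM; [case: hx | case: hz].
Qed.

Lemma center1 : Z 1.
Proof. by split; [exact: unit_group1 | move=> u _; rewrite mul1r mulr1]. Qed.

Lemma mode_inv i z z' : Z z -> Z z' -> z * z' = 1 -> mode i z * mode i z' = 1.
Proof.
by move=> hz hz' e; rewrite -modeM ?e ?mode1 //; apply: center_central.
Qed.

Lemma mode_neq0 i z : Z z -> mode i z != 0.
Proof.
move=> hz; have [z' [hz' zz' _]] := center_inv hz.
by apply: contra_eq_neq (mode_inv i hz hz' zz') => ->; rewrite mul0r eq_sym oner_neq0.
Qed.

Definition mode_log z i : R := ln (normc (phi (mode i z))).

Lemma mode_logM x z i : Z x -> Z z -> mode_log (x * z) i = mode_log x i + mode_log z i.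
Proof.
move=> hx hz; rewrite /mode_log modeM; try exact: center_central.
by rewrite rmorphM normcM lnM ?posrE ?normc_embed_gt0 ?mode_neq0.
Qed.

Lemma mode_log_conj z i : mode_log z (conjC_Iirr i) = mode_log z i.
Proof. by rewrite /mode_log mode_aut algC_embed_normc_conj. Qed.

Lemma mode_log_sum0 z i : Z z -> \sum_k mode_log z (act k i) = 0.
Proof.
move=> hz; have [z' [hz' zz' _]] := center_inv hz.
have m0 := mode_neq0 i hz; have e := mode_inv i hz hz' zz'.
have mV : (mode i z)^-1 = mode i z' by apply: (mulfI m0); rewrite divff.
have n1 : `|\prod_k cyclo_aut N1 k (mode i z)| = 1.
  apply: cyclotomic_norm => //; first exact: mode_cyclotomic.
    by apply: mode_Aint; [apply: center_central | case: hz => -[]].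
  by rewrite mV; apply: mode_Aint; [apply: center_central | case: hz' => -[]].
have := normc_embed_unit R n1; rewrite rmorph_prod normc_prod => /(congr1 (@ln R)).
rewrite ln1 ln_prod => [n0|k]; last by rewrite normc_embed_gt0 // fmorph_eq0.
by rewrite -[RHS]n0; apply: eq_bigr => k _; rewrite /mode_log mode_aut.
Qed.

(** Bounded logarithms bound every |mode i z|, hence the coefficients, by [central_co]. *)
Lemma mode_log_bounded_finite (B : R) :
  finite_set [set z | Z z /\ forall i, `|mode_log z i| <= B]%classic.
Proof.
pose c (g : gT) i : algC := #|G|%:R^-1 * ('chi_i 1%g * 'chi_i g^-1%g).
pose C := \sum_(g : gT) \sum_i normc (phi (c g i)) * expR B.
apply: sub_finite_set (bounded_int_ring_finite G (Num.bound C)).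
move=> z [hz zB]; have zC := center_central hz.
split=> [|g gG]; first by case: hz => -[].
rewrite -(ler_rat R) ratr_nat ratr_norm; apply: le_trans (ltW (archi_boundP _)); last first.
  apply: sumr_ge0 => x _; apply: sumr_ge0 => i _.
  by rewrite mulr_ge0 ?normc_ge0 ?expR_ge0.
rewrite -normc_embed_rat (central_co zC gG) mulr_sumr rmorph_sum.
apply: le_trans (normc_sum_le _ (G := fun i => normc (phi (c g i)) * expR B) _) _.
  move=> i _; have -> : #|G|%:R^-1 * ('chi_i 1%g * mode i z * 'chi_i g^-1%g) = c g i * mode i z.
    by rewrite /c [X in _ * X]mulrAC mulrA.
  rewrite rmorphM normcM ler_wpM2l ?normc_ge0 //.
  rewrite -[leLHS]lnK ?posrE ?normc_embed_gt0 ?mode_neq0 // ler_expR.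
  exact: le_trans (ler_norm _) (zB i).
rewrite /C (bigD1 g) // lerDl; apply: sumr_ge0 => x _; apply: sumr_ge0 => i _.
by rewrite mulr_ge0 ?normc_ge0 ?expR_ge0.
Qed.
End Center.

(** * Forms vanishing on the generated central units *)

Section Dual.
Variables (R : realType) (N : nat) (N1 : (1 < N)%N).
Variables (gT : finGroupType) (G : {group gT}).
Hypothesis GN : (#|G| %| N)%N.
Local Notation phi := (@algC_embed R).
Local Notation gmx := 'M[rat]_#|G|.
Local Notation Z := (center_of (unit_group G)).
Local Notation gen := (generated_in (unit_group G) (shoda_bass_units G)).
Local Notation act k i := (aut_Iirr (cyclo_aut N1 k) i).
Local Notation mode_log := (@mode_log R gT G).
Implicit Types (a b u z : gmx) (g h : gT) (i : Iirr G) (k l : {unit 'Z_N}).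

Lemma gen_subgroup : is_subgroup (unit_group G) gen.
Proof. exact: generated_is_subgroup. Qed.

Lemma gen_bass H K h (k m : nat) v : @strong_shoda_pair gT G H K -> h \in H ->
    (0 < k)%N -> (0 < m)%N -> coprime k #[h]%g -> (k ^ m = 1 %[mod #[h]%g])%N ->
  @generalized_bass_unit gT G H h k m v -> gen v.
Proof.
move=> ssp hH k0 m0 ck km bv A [_ AX]; apply: AX.
by exists H, K, h, k, m; split.
Qed.

Section OneOrbit.
Variables (H K : {group gT}) (ssp : @strong_shoda_pair gT G H K).
Variables (theta : 'CF(H)) (lin : theta \is a linear_char) (kth : cfker theta = K).
Variables (i0 : Iirr G) (chiE : 'chi_i0 = 'Ind[G] theta).
Local Notation D := H^`(1)%G.
Local Notation A := (H / D)%G.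
Local Notation lin_of := (@lin_of gT H).
Variables (j0 : Iirr A) (thE : theta = lin_of j0).
Variable lam : Iirr G -> R.
Hypothesis lam0 : forall z, Z z -> gen z -> \sum_i lam i * mode_log z i = 0.

Let sHG : H \subset G := shoda_sub ssp.
Let nKH : (K <| H)%g := shoda_normal ssp.
Let cHK : cyclic (H / K)%g. Proof. by case: ssp. Qed.
Let AN : (#|A| %| N)%N := card_abelianization_dvd sHG GN.

(* The relation lam satisfies on the product of the conjugates of
   1 + (b ^+ J - 1) epsilon (H, K); the factors outside N_G(K) and the
   characters outside the Galois orbit of i0 contribute nothing. *)
Lemma orbit_relation (b : gmx) (J : nat) (L : {unit 'Z_N} -> R) :
    (0 < J)%N -> span_of H b -> gen (1 + (b ^+ J - 1) * @epsilon gT G H K) ->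
    (forall k, ev (cfAut (cyclo_aut N1 k) theta) b != 0) ->
    (forall k, L k = ln (normc (phi (ev (cfAut (cyclo_aut N1 k) theta) b)))) ->
  \sum_k lam (act k i0) * L k = 0.
Proof.
move=> J0 bS gw b0 LE; have ed := epsilon_der_part sHG nKH cHK; have eS := ed.1.
have ee := epsilon_idem sHG nKH cHK.
pose d := (b ^+ J - 1) * @epsilon gT G H K.
have bJS : span_of H (b ^+ J) by apply: span_ofX.
have dS : span_of H (b ^+ J - 1) by apply: span_ofB => //; apply: span_of1.
have dd : der_part H d by apply: der_partMl.
have deps : d * @epsilon gT G H K = d by rewrite /d -mulrA ee.
have zC := conj_prod_central ssp lin kth dd deps.
have zg := conj_prod_gen gen_subgroup (fun a g gG => generated_gconj gG) gw.
have [kap [kapi modeE]] := mode_conj_prod_aut N1 GN ssp lin kth chiE dd deps.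
rewrite -/d in zg; set z := conj_prod d in zC zg modeE.
have zZ : Z z by apply: centralP => //; have [gU _ _ _] := gen_subgroup; apply: gU.
have ev1d : ev theta (1 + d) = ev theta b ^+ J.
  have dS' : span_of H (b ^+ J - 1) := dS.
  rewrite evD ev1 // /d evM // (epsilon_ev1 sHG nKH lin kth) mulr1 evB ev1 // evX //.
  by rewrite addrC subrK.
have y_cyc : in_cyclotomic N (ev theta (1 + d)).
  by apply: ev_in_cyclotomic => //; apply: dvdn_trans (cardSg sHG) GN.
have modek k : mode_log z (act k i0) = \sum_(g in 'N_G(K)%g) J%:R * L (k * kap g)%g.
  rewrite /mode_log mode_aut modeE rmorph_prod rmorph_prod normc_prod ln_prod; last first.
    move=> g; rewrite normc_embed_gt0 // !fmorph_eq0 ev1d expf_eq0 J0 /=.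
    by have := b0 1%g; rewrite ev_aut fmorph_eq0.
  apply: eq_bigr => g gN; rewrite -cyclo_autM // ev1d rmorphXn LE ev_aut rmorphXn normcX.
  by rewrite lnXn ?mulr_natl // normc_embed_gt0 // -ev_aut.
have F0 : \sum_k lam (act k i0) * mode_log z (act k i0) = 0.
  apply: (orbit_sum0 GN (F := fun i => lam i * mode_log z i)); last exact: lam0.
  move=> i off; rewrite /mode_log (mode_conj_prod_off GN ssp lin kth chiE dd deps off).
  by rewrite rmorph1 normc1 ln1 mulr0.
have e2 : \sum_k lam (act k i0) * mode_log z (act k i0) =
    #|'N_G(K)%g|%:R * J%:R * \sum_k lam (act k i0) * L k.
  transitivity (\sum_k \sum_(g in 'N_G(K)%g) J%:R * (lam (act k i0) * L (k * kap g)%g)).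
    by apply: eq_bigr => k _; rewrite modek mulr_sumr; apply: eq_bigr => g _; rewrite mulrCA.
  rewrite exchange_big /=.
  rewrite (eq_bigr (fun=> J%:R * \sum_k lam (act k i0) * L k)) => [|g gN].
    by rewrite sumr_const -[LHS]mulr_natl mulrA.
  (* kap g fixes i0, so reindexing by it undoes the shift in L. *)
  rewrite -mulr_sumr; congr (_ * _); rewrite [RHS](reindex_inj (mulIg (kap g))).
  by apply: eq_bigr => k _; rewrite gal_actM // kapi.
move: e2; rewrite F0 => /esym/eqP; rewrite !mulf_eq0 !pnatr_eq0 [J == _]gtn_eqF //.
by rewrite [_ == 0%N]gtn_eqF ?cardG_gt0 //= => /eqP.
Qed.

(* lam pushed to the Galois orbit of theta; by multiplicity, since the orbits
   of theta and of Ind theta may differ in size. *)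
Let lamH (j : Iirr A) : R := \sum_(k | irr_act N1 k j0 == j) lam (act k i0).

Lemma lamH_sum (F : Iirr A -> R) :
  \sum_j lamH j * F j = \sum_k lam (act k i0) * F (irr_act N1 k j0).
Proof.
rewrite [RHS](partition_big (fun k => irr_act N1 k j0) xpredT) //=.
apply: eq_bigr => j _; rewrite /lamH mulr_suml.
by apply: eq_bigr => k /eqP ->.
Qed.

(** b is the Bass element for h and k before its power n_b is taken; [component_power] supplies the
    membership required by [orbit_relation], and [bass_log] computes the logarithms. *)
Lemma lamH_dual (x : coset_of D) (k : {unit 'Z_N}) : x \in A ->
  \sum_j lamH j * (log_dist1 R ('chi_j x ^+ uexp k) - log_dist1 R ('chi_j x)) = 0.
Proof.
move=> /morphimP[h hN hH ->]; rewrite lamH_sum.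
have [k0 m0 ck km] := uexp_params N1 sHG GN k hH.
have [b [v [bv lv _ bS [[b' [b'S bb' b'b Zb Zb']] evb]]]] := bass_element sHG hH k0 m0 ck km.
have D0 : (0 < #|D|)%N := cardG_gt0 D.
have [J J0 gw] := component_power R N1 sHG GN gen_subgroup
  (fun h (k m : nat) v => @gen_bass H K h k m v ssp) D0 (epsilon_der_part sHG nKH cHK)
  (epsilon_idem sHG nKH cHK) bS b'S bb' b'b Zb Zb'.
have m0' : (totient N)%:R != 0 :> R by rewrite pnatr_eq0 -lt0n.
apply: (mulfI m0'); rewrite mulr0 mulr_sumr.
rewrite (eq_bigr (fun l => lam (act l i0) *
    ln (normc (phi (ev (cfAut (cyclo_aut N1 l) theta) b))))) => [|l _]; last first.
  rewrite mulrCA -!lin_ofE // thE -lin_of_aut; congr (_ * _).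
  by rewrite (bass_log R N1 sHG GN hH (uexp_coprime N1 k) (evb _)).
apply: (@orbit_relation b J _ J0 bS gw) => [l|//].
rewrite thE -lin_of_aut; have li := lin_of_linear (act l j0).
apply/eqP => e; have /eqP := ev1 sHG li.
by rewrite -bb' (evM sHG li bS b'S) e mul0r eq_sym oner_eq0.
Qed.

Lemma orbit_dual (f : Iirr G -> R) :
    (forall i, f (conjC_Iirr i) = f i) -> (forall i, \sum_k f (act k i) = 0) ->
  \sum_k lam (act k i0) * f (act k i0) = 0.
Proof.
move=> fconj fsum.
(* f is pulled back along induction, with 0 where the induced character is reducible. Induction
   commutes with the Galois action, so gH inherits both constraints. *)
pose gH (j : Iirr A) : R :=
  if 'Ind[G] (lin_of j) \in irr G then f (cfIirr ('Ind[G] (lin_of j))) else 0.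
have IndK (u : {rmorphism algC -> algC}) j i : 'Ind[G] (lin_of j) = 'chi_i ->
    cfIirr ('Ind[G] (lin_of (aut_Iirr u j))) = aut_Iirr u i.
  by move=> e; rewrite lin_of_aut -cfAutInd e -aut_IirrE irrK.
have Indirr (u : {rmorphism algC -> algC}) j :
    ('Ind[G] (lin_of (aut_Iirr u j)) \in irr G) = ('Ind[G] (lin_of j) \in irr G).
  by rewrite lin_of_aut -cfAutInd cfAut_irr.
have gHact k : gH (irr_act N1 k j0) = f (act k i0).
  rewrite /gH Indirr -thE -chiE mem_irr; congr f.
  by apply: IndK; rewrite -thE chiE.
transitivity (\sum_j lamH j * gH j).
  by rewrite lamH_sum; apply: eq_bigr => k _; rewrite gHact.
apply: (@bass_milnor_dual R N N1 _ A) => //.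
- exact: quot_der_abelian.
- by move=> x k; apply: lamH_dual.
- move=> j; rewrite /gH /conjC_Iirr; have := Indirr Num.conj j.
  rewrite /aut_Iirr => ->; case: ifP => // /irrP[i e].
  by have := IndK Num.conj j i e; rewrite /aut_Iirr => ->; rewrite fconj e irrK.
move=> j; have [jirr|nj] := boolP ('Ind[G] (lin_of j) \in irr G); last first.
  by rewrite big1 // => k _; rewrite /gH Indirr (negPf nj).
have /irrP[i e] := jirr; rewrite -[RHS](fsum i); apply: eq_bigr => k _.
by rewrite /gH Indirr jirr (IndK _ _ _ e).
Qed.
End OneOrbit.

Hypothesis G_sm : strongly_monomial G.

Lemma center_dual (lam : Iirr G -> R) :
    (forall z, Z z -> gen z -> \sum_i lam i * mode_log z i = 0) ->
  forall z, Z z -> \sum_i lam i * mode_log z i = 0.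
Proof.
move=> lam0 z hz; apply: (@sum_orbit_sum0 N N1 gT G R (fun i => lam i * mode_log z i)) => i0.
have [H [K [theta [ssp lin kth chiE]]]] := G_sm i0.
have [j0 thE] := linear_lin_of lin.
apply: (orbit_dual ssp lin kth chiE thE lam0).
- by move=> i; apply: mode_log_conj.
- by move=> i; apply: mode_log_sum0.
Qed.
End Dual.

Theorem theorem5p1 (gT : finGroupType) (G : {group gT})
    (G_sm : strongly_monomial G) :
  exists A : set 'M[rat]_#|G|,
    [/\ is_subgroup (center_of (unit_group G)) A,
        finite_index (center_of (unit_group G)) A
      & subset A (generated_in (unit_group G) (shoda_bass_units G))].
Proof.
set Z := center_of _; set gen := generated_in _ _.
pose R : realType := Rstruct.RbaseSymbolsImpl_R__canonical__reals_Real.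
(* The factor 2 ensures N > 1 for trivial G as well. *)
pose N := (#|G|.*2)%N.
have N1 : (1 < N)%N by have := cardG_gt0 G; rewrite /N; lia.
have GN : (#|G| %| N)%N by rewrite /N -mul2n dvdn_mull.
have [gU g1 gM gV] := gen_subgroup G.
pose A : set 'M[rat]_#|G| := [set z | Z z /\ gen z]%classic.
have A1 : A 1 by split; [exact: center1 | exact: g1].
have AM x y : A x -> A y -> A (x * y).
  by move=> [xZ xg] [yZ yg]; split; [apply: centerM | apply: gM].
have ZV x y : Z x -> x * y = 1 -> Z y.
  move=> hx xy; have [x' [hx' xx' x'x]] := center_inv hx.
  by have -> : y = x' by rewrite -[y]mul1r -x'x -mulrA xy mulr1.
exists A; split; last by move=> x [].
  split=> //; first by move=> x [].
  by move=> x y [xZ xg] xy yx; split; [apply: ZV xy | apply: gV xy yx].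
have AV x : A x -> exists2 y, A y & x * y = 1.
  move=> [xZ xg]; have [y [yZ xy yx]] := center_inv xZ.
  by exists y => //; split=> //; apply: gV xy yx.
have [||||||||F Ffin HF] := @lattice_finite_index R 'M[rat]_#|G| Z A (Iirr G)
  (@mode_log R gT G).
- exact: centerM.
- by move=> x [].
- exact: A1.
- exact: AM.
- exact: AV.
- by move=> x y i; apply: mode_logM.
- by move=> B; apply: mode_log_bounded_finite.
- move=> lam lam0; apply: (center_dual N1 GN G_sm) => z zZ zg; exact: lam0.
(* x A = (x a) A for a in A, so every coset comes from an element of the finite set F. *)
apply: sub_finite_set (finite_image (fun x => [set x * a | a in A]%classic) Ffin).
move=> C [x xZ <-]; have [a aA Fxa] := HF x xZ; exists (x * a) => //.
have [a' a'A aa'] := AV a aA.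
apply/seteqP; split => y [c cA <-].
  by exists (a * c); [apply: AM | rewrite mulrA].
by exists (a' * c); [apply: AM | rewrite -mulrA [a * _]mulrA aa' mul1r].
Qed.
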